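(* Let $j:(U_{\mathrm{ad}},\|\cdot\|_{L^q(\Omega)})\to\mathbb{R}$ be bounded below and differentiable on $U_{\mathrm{ad}}$ with respect to feasible variations, with $\nabla_R j:(U_{\mathrm{ad}},\|\cdot\|_{L^q})\to L^{q'}(\Omega)$ Lipschitz continuous. Let $j':(U_{\mathrm{ad}},\|\cdot\|_{L^q})\to(L^q(\Omega))^*$ be continuously differentiable on $U_{\mathrm{ad}}$ with bounded derivative on $U_{\mathrm{ad}}$. Let $r\in[1,\infty)$ with $r>0.5\,q$. Consider a sequence $(u_k)_k$ of iterates produced by the trust-region algorithm described in the context, started at $u_0\in U_{\mathrm{ad}}$, and suppose that the trust-region model assumption and the approximate step assumption described in the context hold, with a constant $\kappa_{umh}\ge1$ that is uniform on a subset $\mathcal{F}\subset U_{\mathrm{ad}}$ containing the iterates. Then all iterates $u_k$ are feasible (i.e. $u_k\in U_{\mathrm{ad}}$) and the objective values $j(u_k)+\alpha\mathrm{TV}(u_k)$ are monotonically decreasing (nonincreasing) in $k$. Every subsequence of iterates admits a weak-$^*$ cluster point in $BV(\Omega)$. Every weak-$^*$ cluster point is feasible, is a strict cluster point (that is, with respect to strict convergence in $BV(\Omega)$), is also a cluster point in $L^q(\Omega)$, and is stationary.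
   Context: $\Omega\subset\mathbb{R}^d$, $d\ge2$, is a bounded domain with Lipschitz boundary (of class $C^{1,\alpha'}$ for some $\alpha'>0$). $0<u_\ell\le u_u$ are fixed scalars, $U_{\mathrm{ad}}=\{u\in BV(\Omega):u_\ell\le u(x)\le u_u\text{ a.e.}\}$, $\delta_{U_{\mathrm{ad}}}$ is its $\{0,\infty\}$-valued indicator function, $\mathrm{TV}:L^1(\Omega)\to[0,\infty]$ is the total variation seminorm, $\alpha>0$ is a fixed weight. Fix $s>2$ and $q>\frac{2s}{s-2}$ (so $2<q<\infty$); $q'=q/(q-1)$. The problem is $\min\{j(u)+\alpha\mathrm{TV}(u):u\in U_{\mathrm{ad}}\}$. Differentiability on $U_{\mathrm{ad}}$ is with respect to feasible variations: $T$ is differentiable at $u$ if there is a bounded linear $T'(u)$ on $L^q(\Omega)$ with $\|T(u+\phi)-T(u)-T'(u)\phi\|/\|\phi\|_{L^q}\to0$ as $\phi\to0$ in $L^q$ with $u+\phi\in U_{\mathrm{ad}}$. $\nabla_R j(u)\in L^{q'}(\Omega)$ is the representative of $j'(u)\in(L^q(\Omega))^*$. Stationarity. For $u\in U_{\mathrm{ad}}$ put $m_u(v)=\int_\Omega\nabla_R j(u)(v-u)\,dx+\frac1q\|v-u\|_{L^q}^q+\alpha\mathrm{TV}(v)$ and $\mathcal{C}(u)=\alpha\mathrm{TV}(u)-\min_{v\in U_{\mathrm{ad}}}m_u(v)$. A point $u\in U_{\mathrm{ad}}$ is stationary if $\mathcal{C}(u)=0$ (equivalently, $u$ minimizes $m_u$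 over $U_{\mathrm{ad}}$). Trust-region model assumption. For $u\in U_{\mathrm{ad}}$, $\tilde m_u(v)=q_u(v)+\alpha\mathrm{TV}(v)+\delta_{U_{\mathrm{ad}}}(v)$, where $q_u:L^q(\Omega)\to\mathbb{R}$ is twice differentiable, $q_u(u)=j(u)$, $\nabla_R q_u(u)=\nabla_R j(u)$, and $\sup_{v\in U_{\mathrm{ad}}}\|q_u''(v)\|_{\mathcal{L}(L^q,(L^q)^* )}\le\kappa_{umh}-1$ for some $\kappa_{umh}\ge1$. ''Uniform on $\mathcal{F}$'' means the same $\kappa_{umh}$ can be used for all $u\in\mathcal{F}$. Trust-region subproblem, for $u\in U_{\mathrm{ad}}$, $\Delta>0$: (TR) $\min_v q_u(v)+\alpha\mathrm{TV}(v)$ s.t. $v\in U_{\mathrm{ad}}$, $\|v-u\|_{L^r}\le\Delta$; $\inf(\mathrm{TR})$ is its infimal value. Algorithm. Input: $\Delta_{\mathrm{res}}=\Delta_0>0$, $u_0\in U_{\mathrm{ad}}$, $\underline\sigma\in(0,1)$, $\gamma\in(0,1)$. For $k=0,1,2,\dots$: compute $v_k$, an approximate solution (feasible point) of (TR) with $u=u_k$, $\Delta=\Delta_k$; set $$\sigma_k=\frac{j(u_k)+\alpha\mathrm{TV}(u_k)-j(v_k)-\alpha\mathrm{TV}(v_k)}{\tilde m_{u_k}(u_k)-\tilde m_{u_k}(v_k)}$$ (with $\sigma_k=0$ if numerator and denominator are both zero); if $\sigma_k<\underline\sigma$ set $u_{k+1}=u_k$, $\Delta_{k+1}=\gamma\Delta_k$;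 if $\sigma_k\ge\underline\sigma$ set $u_{k+1}=v_k$, $\Delta_{k+1}=\Delta_{\mathrm{res}}$. Approximate step assumption. There is $\eta\in(0,1]$ such that all $v_k$ satisfy $v_k\in BV(\Omega)\cap U_{\mathrm{ad}}$ and $\tilde m_{u_k}(u_k)-\tilde m_{u_k}(v_k)\ge\eta\,(\tilde m_{u_k}(u_k)-\inf(\mathrm{TR}))$, where (TR) is taken with $u=u_k$, $\Delta=\Delta_k$. Strict convergence $u_n\to u$ in $BV(\Omega)$: $u_n\to u$ in $L^1(\Omega)$ and $\mathrm{TV}(u_n)\to\mathrm{TV}(u)$. *)

(* Defs.v *)
From HB Require Import structures.
From mathcomp Require Import all_boot all_order all_algebra.
From mathcomp Require Import all_classical all_reals all_analysis.
From mathcomp Require Import measurable_realfun.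

Set Implicit Arguments.
Unset Strict Implicit.
Unset Printing Implicit Defensive.

Import Order.TTheory GRing.Theory Num.Theory.
Import numFieldNormedType.Exports.

Local Open Scope classical_set_scope.
Local Open Scope ring_scope.

Definition rV_display : measure_display.
Proof. exact: default_measure_display. Qed.

(* The measurable sets of R^n are the Borel sets. *)
HB.instance Definition _ (R : realType) (n : nat) :=
  @isMeasurable.Build rV_display 'rV[R]_n <<s @open 'rV[R]_n >>
    (@sigma_algebra0 _ setT _) (@sigma_algebraC _ _)
    (@sigma_algebra_bigcup _ setT _).

Lemma open_measurable_rV (R : realType) n (A : set 'rV[R]_n) :
  open A -> measurable A.
Proof. exact: sub_sigma_algebra. Qed.

Lemma measurable_fun_rV d (T : measurableType d) (R : realType) n
    (f : T -> 'rV[R]_n) :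
  (forall i, measurable_fun setT (fun t => f t ord0 i)) ->
  measurable_fun setT f.
Proof.
move=> mf; apply: (measurability (@open 'rV[R]_n)) => // _ [U oU <-].
rewrite setTI.
pose cube (ck : 'rV[rat]_n * nat) : set 'rV[R]_n :=
  [set y | forall i, `|y ord0 i - ratr (ck.1 ord0 i)| < ck.2.+1%:R^-1].
pose J := [set ck | cube ck `<=` U].
have -> : f @^-1` U =
    \bigcup_ck (if `[< J ck >] then f @^-1` cube ck else set0).
  apply/seteqP; split=> [t Ut|t [ck _]]; last by case: asboolP => [cU /cU|_ []].
  have /nbhs_ballP[e /= e0 eU] : nbhs (f t) U by exact: open_nbhs_nbhs.
  have [k] := @ltr_add_invr R 0 (e / 2) (divr_gt0 e0 (ltr0n _ 2)).
  rewrite add0r => ke.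
  have kp : 0 < k.+1%:R^-1 :> R by rewrite invr_gt0.
  have /choice[c cP] i : exists q : rat, `|f t ord0 i - ratr q| < k.+1%:R^-1.
    have [|q] := @rat_in_itvoo R (f t ord0 i - k.+1%:R^-1)
      (f t ord0 i + k.+1%:R^-1); first by rewrite ltrD2l gtrN.
    by rewrite in_itv/= => qP; exists q; rewrite distrC ltr_distl.
  exists (\row_i c i, k) => //.
  have cubet : cube (\row_i c i, k) (f t).
    by move=> i; rewrite /= mxE; exact: cP.
  case: asboolP => // -[] y yP; apply: eU.
  rewrite mx_norm_ball /ball_/= {1}/Num.norm/= mx_normrE.
  apply/bigmax_ltP; split => // -[a i] _; rewrite /= ord1 !mxE.
  rewrite -(subrKA (ratr (c i))) (le_lt_trans (ler_normD _ _))//.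
  rewrite [ltRHS]splitr ltrD// (lt_trans _ ke)//.
  by move: (yP i); rewrite /= mxE distrC.
apply: countable_bigcupT_measurable => [|ck]; first exact: countableP.
case: ifPn => // _.
rewrite (_ : f @^-1` _ = \bigcap_(i in [set: 'I_n])
  ((fun t => f t ord0 i) @^-1`
     ball (ratr (ck.1 ord0 i) : R) ck.2.+1%:R^-1)); last first.
  by apply/seteqP; split => t /= H i => [_|];
    [rewrite /= /ball/= distrC; exact: H|
     have := H i I; rewrite /ball/= distrC].
apply: fin_bigcap_measurable => // i _; rewrite -[X in measurable X]setTI.
by apply: mf => //; apply: open_measurable; exact: ball_open.
Qed.

Section lebesgue_rV.
Variable R : realType.

Definition rV_cons n (p : 'rV[R]_n * measurableTypeR R) : 'rV[R]_n.+1 :=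
  \row_i oapp (p.1 ord0) p.2 (unlift ord0 i).

Lemma measurable_coord n (i : 'I_n) :
  measurable_fun setT (fun x : 'rV[R]_n => x ord0 i : measurableTypeR R).
Proof.
apply: (measurability (@RGenOpens.G R)); first exact: RGenOpens.measurableE.
move=> _ [_ [a [b ->]] <-]; rewrite setTI; apply: open_measurable_rV.
by apply: open_comp; [move=> x _; exact: coord_continuous|exact: interval_open].
Qed.

Lemma measurable_rV_cons n : measurable_fun setT (@rV_cons n).
Proof.
apply: measurable_fun_rV => i.
case: (unliftP ord0 i) => [j ->|->].
  under eq_fun do rewrite mxE liftK /=.
  exact: (measurableT_comp (measurable_coord j) measurable_fst).
under eq_fun do rewrite mxE unlift_none /=.
exact: measurable_snd.
Qed.

Definition lebesgue_rV_step n (m : {measure set 'rV[R]_n -> \bar R}) :=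
  pushforward (m \x @lebesgue_measure R)%E (@rV_cons n).

HB.instance Definition _ n m := Measure.copy (@lebesgue_rV_step n m)
  (measure_function_pushforward__canonical__measure_function_Measure
     (m \x @lebesgue_measure R)%E (@measurable_rV_cons n)).

(* n-dimensional Lebesgue measure, as an iterated product *)
Fixpoint lebesgue_rV n : {measure set 'rV[R]_n -> \bar R} :=
  if n is m.+1 then lebesgue_rV_step (lebesgue_rV m) else \d_(0 : 'rV[R]_0).

Lemma lebesgue_rV_box n (a b : 'rV[R]_n) :
  (forall i, a ord0 i <= b ord0 i) ->
  lebesgue_rV n [set x : 'rV[R]_n | forall i, a ord0 i <= x ord0 i <= b ord0 i] =
  (\prod_i (b ord0 i - a ord0 i))%:E.
Proof.
elim: n a b => [|n ih] a b ab.
  rewrite /= diracE big_ord0 (_ : _ \in _ = true)//.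
  by apply/mem_set => -[].
rewrite /= /lebesgue_rV_step /pushforward.
pose a' : 'rV[R]_n := \row_i a ord0 (lift ord0 i).
pose b' : 'rV[R]_n := \row_i b ord0 (lift ord0 i).
have -> : @rV_cons n @^-1`
    [set x : 'rV[R]_n.+1 | forall i, a ord0 i <= x ord0 i <= b ord0 i] =
    [set x : 'rV[R]_n | forall i, a' ord0 i <= x ord0 i <= b' ord0 i] `*`
    (`[a ord0 ord0, b ord0 ord0]%classic : set (measurableTypeR R)).
  apply/seteqP; split=> -[x t]/=.
    move=> H; split=> [i|].
      by have := H (lift ord0 i); rewrite !mxE liftK.
    by have := H ord0; rewrite !mxE unlift_none in_itv.
  move=> [H1 H2] i; rewrite mxE; case: (unliftP ord0 i) => [j ->|->] /=.
    by have := H1 j; rewrite !mxE.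
  by move: H2; rewrite in_itv.
rewrite product_measure1E//; last first.
  rewrite (_ : mkset _ = \bigcap_(i in [set: 'I_n])
      ((fun x : 'rV[R]_n => x ord0 i : measurableTypeR R) @^-1`
         `[a' ord0 i, b' ord0 i]%classic)); last first.
    by apply/seteqP; split => x /= H i => [_|]; [rewrite /= in_itv; exact: H|
      have := H i I; rewrite /= in_itv].
  apply: fin_bigcap_measurable => // i _; rewrite -[X in measurable X]setTI.
  exact: measurable_coord.
rewrite ih => [|i]; last by rewrite !mxE.
have leb : lebesgue_measure (`[a ord0 ord0, b ord0 ord0]%classic : set R) =
    (b ord0 ord0 - a ord0 ord0)%:E.
  rewrite lebesgue_measure_itv/= lte_fin -EFinB.
  by case: ltgtP (ab ord0) => // ->; rewrite subrr.
rewrite [X in (_ * X)%E](_ : _ = (b ord0 ord0 - a ord0 ord0)%:E)//.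
by rewrite -EFinM big_ord_recl mulrC; under eq_bigr do rewrite !mxE.
Qed.

End lebesgue_rV.

Section domains.
Variables (R : realType) (n : nat).

Definition pderiv (i : 'I_n) (g : 'rV[R]_n -> R) (x : 'rV[R]_n) : R :=
  'D_(delta_mx ord0 i) g x.

Definition C1 (g : 'rV[R]_n -> R) : Prop :=
  continuous g /\
  forall i, (forall x, derivable g x (delta_mx ord0 i)) /\
            continuous (pderiv i g).

Definition C1_holder (a : R) (g : 'rV[R]_n -> R) : Prop :=
  C1 g /\
  forall i, exists L : R, forall x y,
    `|pderiv i g x - pderiv i g y| <= L * `|x - y| `^ a.

Definition lipschitz_fun (g : 'rV[R]_n -> R) : Prop :=
  exists L : R, forall x y, `|g x - g y| <= L * `|x - y|.

End domains.

(* Near each boundary point and up to an orthogonal change of coordinates,    *)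
(* Omega is the set of points lying strictly above the graph of some g of the *)
(* given class; col' i deletes the i-th coordinate.                           *)
Definition boundary_of_class (R : realType) (d : nat)
    (K : ('rV[R]_d.-1 -> R) -> Prop) (Omega : set 'rV[R]_d) : Prop :=
  forall x, (closure Omega `\` interior Omega) x ->
  exists (Q : 'M[R]_d) (i : 'I_d) (g : 'rV[R]_d.-1 -> R) (rho : R),
    [/\ Q *m Q^T = 1%:M, K g, 0 < rho &
        forall y, ball x rho y ->
          (Omega y <-> g (col' i (y *m Q)) < (y *m Q) ord0 i)].

Definition lipschitz_boundary (R : realType) (d : nat) (Omega : set 'rV[R]_d) :=
  boundary_of_class (@lipschitz_fun R d.-1) Omega.

Definition C1_holder_boundary (R : realType) (d : nat) (a : R)
    (Omega : set 'rV[R]_d) :=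
  boundary_of_class (@C1_holder R d.-1 a) Omega.

(* Functions on Omega are represented by functions on R^d, integrated against *)
(* Lebesgue measure restricted to Omega.                                      *)
Definition lebesgue_on (R : realType) (d : nat) (Omega : set 'rV[R]_d)
    (oO : open Omega) : {measure set 'rV[R]_d -> \bar R} :=
  mrestr (lebesgue_rV R d) (open_measurable_rV oO).

Section bv.
Variables (R : realType) (d : nat) (Omega : set 'rV[R]_d) (oO : open Omega).
Local Notation V := ('rV[R]_d -> R).
Local Notation mu := (lebesgue_on oO).

Definition Lnormp (p : R) (f : V) : \bar R := 'N[mu]_(p%:E)[EFin \o f]%E.

(* the space C^1_c(Omega) *)
Definition test_function (psi : V) : Prop :=
  C1 psi /\ exists K, [/\ compact K, K `<=` Omega & forall x, ~ K x -> psi x = 0].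

Definition unit_test_field (phi : 'I_d -> V) : Prop :=
  (forall i, test_function (phi i)) /\
  (forall x, \sum_i (phi i x) ^+ 2 <= 1).

Definition TV (u : V) : \bar R :=
  ereal_sup [set (\int[mu]_x (u x * \sum_i pderiv i (phi i) x))%:E
            | phi in unit_test_field].

Definition BV (u : V) : Prop := u \in Lfun mu 1%:E /\ (TV u < +oo)%E.

(* the space C_0(Omega), for bounded Omega *)
Definition vanishing_function (psi : V) : Prop :=
  continuous psi /\ forall x, ~ Omega x -> psi x = 0.

Definition signed_int (nup nun : {finite_measure set 'rV[R]_d -> \bar R})
    (psi : V) : R :=
  \int[nup]_(x in Omega) psi x - \int[nun]_(x in Omega) psi x.

(* The signed measure nup - nun on Omega is the i-th component D_i u of the   *)
(* distributional gradient. For u in BV(Omega) it exists by the Riesz         *)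
(* representation theorem, and it is uniquely determined.                     *)
Definition is_derivative_measure (u : V) (i : 'I_d)
    (nup nun : {finite_measure set 'rV[R]_d -> \bar R}) : Prop :=
  forall psi, test_function psi ->
    \int[mu]_x (u x * pderiv i psi x) = - signed_int nup nun psi.

(* u_n -> u in L^1(Omega) and D u_n -> D u weakly-* in the dual of C_0(Omega) *)
Definition weak_star_cvg (un : nat -> V) (u : V) : Prop :=
  [/\ forall n, BV (un n), BV u,
      (fun n => Lnormp 1 (un n - u)) @ \oo --> 0%E &
      forall (i : 'I_d)
        (nupn nunn : nat -> {finite_measure set 'rV[R]_d -> \bar R})
        (nup nun : {finite_measure set 'rV[R]_d -> \bar R}),
        (forall n, is_derivative_measure (un n) i (nupn n) (nunn n)) ->
        is_derivative_measure u i nup nun ->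
        forall psi, vanishing_function psi ->
          (fun n => signed_int (nupn n) (nunn n) psi) @ \oo
            --> signed_int nup nun psi].

Definition strict_cvg (un : nat -> V) (u : V) : Prop :=
  [/\ forall n, BV (un n), BV u,
      (fun n => Lnormp 1 (un n - u)) @ \oo --> 0%E &
      (fun n => TV (un n)) @ \oo --> TV u].

Definition Lp_cvg (p : R) (un : nat -> V) (u : V) : Prop :=
  [/\ forall n, un n \in Lfun mu p%:E, u \in Lfun mu p%:E &
      (fun n => Lnormp p (un n - u)) @ \oo --> 0%E].

Definition cluster_point (cv : (nat -> V) -> V -> Prop) (un : nat -> V) (u : V) :=
  exists2 f : nat -> nat, increasing_seq f & cv (un \o f) u.

Definition Uad (ul uu : R) : set V :=
  [set u | BV u /\ {ae mu, forall x, ul <= u x <= uu}].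

End bv.

Section calculus.
Variables (R : realType) (d : nat) (Omega : set 'rV[R]_d) (oO : open Omega).
Variable q : R.
Local Notation V := ('rV[R]_d -> R).
Local Notation mu := (lebesgue_on oO).
Local Notation Lnormp := (Lnormp oO).

Definition Lq : set V := [set f | f \in Lfun mu q%:E].

Definition dual_exponent : R := q / (q - 1).

(* elements of (L^q(Omega))^* *)
Definition dual (l : V -> R) : Prop :=
  (forall a f g, Lq f -> Lq g -> l (a *: f + g) = a * l f + l g) /\
  exists C : R, forall f, Lq f -> (`|l f|%:E <= C%:E * Lnormp q f)%E.

Definition dual_norm (l : V -> R) : \bar R :=
  ereal_sup [set `|l f|%:E | f in [set f | Lq f /\ (Lnormp q f <= 1)%E]].

Definition op_norm (B : V -> V -> R) : \bar R :=
  ereal_sup [set dual_norm (B f) | f in [set f | Lq f /\ (Lnormp q f <= 1)%E]].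

(* bounded linear operators L^q(Omega) -> (L^q(Omega))^* *)
Definition dual_op (B : V -> V -> R) : Prop :=
  [/\ forall f, Lq f -> dual (B f),
      forall a f g h, Lq f -> Lq g -> Lq h ->
        B (a *: f + g) h = a * B f h + B g h &
      (op_norm B < +oo)%E].

(* The remainder of T at u is o(||phi||) for variations phi with u + phi in D.*)
(* Since phi with ||phi|| = 0 is not excluded, T respects a.e. equality on D. *)
Definition has_derivative (Y : zmodType) (nY : Y -> \bar R) (D : set V)
    (T : V -> Y) (u : V) (dT : V -> Y) : Prop :=
  forall e : R, 0 < e -> exists2 delta : R, 0 < delta &
    forall phi, Lq phi -> D (u + phi) -> (Lnormp q phi < delta%:E)%E ->
      (nY (T (u + phi) - T u - dT phi)%R <= e%:E * Lnormp q phi)%E.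

Definition has_gradient (D : set V) (T : V -> R) (u : V) (dT : V -> R) : Prop :=
  dual dT /\ has_derivative (fun y : R => `|y|%:E) D T u dT.

Definition has_hessian (D : set V) (T : V -> V -> R) (u : V)
    (dT : V -> V -> R) : Prop :=
  dual_op dT /\ has_derivative dual_norm D T u dT.

Definition represents (g : V) (l : V -> R) : Prop :=
  g \in Lfun mu dual_exponent%:E /\
  forall f, Lq f -> l f = \int[mu]_x (g x * f x).

Definition lipschitz_gradient (D : set V) (gradj : V -> V) : Prop :=
  exists L : R, forall u v, D u -> D v ->
    (Lnormp dual_exponent (gradj u - gradj v)%R <= L%:E * Lnormp q (u - v)%R)%E.

Definition op_continuous_on (D : set V) (B : V -> V -> V -> R) : Prop :=
  forall u, D u -> forall e : R, 0 < e -> exists2 delta : R, 0 < delta &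
    forall v, D v -> (Lnormp q (v - u)%R < delta%:E)%E ->
      (op_norm (B v - B u)%R <= e%:E)%E.

Definition op_bounded_on (D : set V) (B : V -> V -> V -> R) : Prop :=
  exists M : R, forall u, D u -> (op_norm (B u) <= M%:E)%E.

End calculus.

Section trust_region.
Variables (R : realType) (d : nat) (Omega : set 'rV[R]_d) (oO : open Omega).
Variables (q r ul uu alpha : R).
Local Notation V := ('rV[R]_d -> R).
Local Notation mu := (lebesgue_on oO).
Local Notation Lnormp := (Lnormp oO).
Local Notation TV := (TV oO).
Local Notation Uad := (Uad oO ul uu).
Variables (j : V -> R) (gradj : V -> V).

Definition objective (u : V) : \bar R := ((j u)%:E + alpha%:E * TV u)%E.

Definition stat_model (u v : V) : \bar R :=
  ((\int[mu]_x (gradj u x * (v x - u x)))%R%:E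
   + (q^-1)%:E * (Lnormp q (v - u)%R `^ q) + alpha%:E * TV v)%E.

Definition criticality (u : V) : \bar R :=
  (alpha%:E * TV u - ereal_inf [set stat_model u v | v in Uad])%E.

Definition stationary (u : V) : Prop := Uad u /\ criticality u = 0%E.

(* the model assumption at u, for the smooth part qu of the model *)
Definition model_assumption (kappa : R) (u : V) (qu : V -> R) : Prop :=
  exists (dq : V -> V -> R) (d2q : V -> V -> V -> R),
    [/\ forall v, Lq oO q v -> has_gradient oO q (Lq oO q) qu v (dq v),
        forall v, Lq oO q v -> has_hessian oO q (Lq oO q) dq v (d2q v),
        qu u = j u,
        represents oO q (gradj u) (dq u) &
        (ereal_sup [set op_norm oO q (d2q v) | v in Uad]
          <= (kappa - 1)%:E)%E].

Variable qm : V -> V -> R.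

Definition indicator_Uad (v : V) : \bar R :=
  if `[< Uad v >] then 0%E else +oo%E.

Definition tr_model (u v : V) : \bar R :=
  ((qm u v)%:E + alpha%:E * TV v + indicator_Uad v)%E.

Definition tr_feasible (u : V) (Delta : R) : set V :=
  [set v | Uad v /\ (Lnormp r (v - u)%R <= Delta%:E)%E].

Definition tr_inf (u : V) (Delta : R) : \bar R :=
  ereal_inf [set ((qm u v)%:E + alpha%:E * TV v)%E | v in tr_feasible u Delta].

(* Extended real division: x / 0 is +oo for 0 < x, -oo for x < 0, and 0 / 0   *)
(* is 0.                                                                      *)
Definition tr_ratio (u v : V) : \bar R :=
  (((j u)%:E + alpha%:E * TV u - (j v)%:E - alpha%:E * TV v)
   / (tr_model u u - tr_model u v))%E.

Definition tr_run (Delta_res sigma gamma : R) (u0 : V) (u v : nat -> V)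
    (Delta : nat -> R) : Prop :=
  [/\ u 0%N = u0, Delta 0%N = Delta_res &
      forall k,
      [/\ tr_feasible (u k) (Delta k) (v k),
          (tr_ratio (u k) (v k) < sigma%:E)%E ->
            u k.+1 = u k /\ Delta k.+1 = gamma * Delta k &
          (sigma%:E <= tr_ratio (u k) (v k))%E ->
            u k.+1 = v k /\ Delta k.+1 = Delta_res]].

Definition approximate_steps (u v : nat -> V) (Delta : nat -> R) : Prop :=
  exists eta : R, 0 < eta <= 1 /\ forall k,
    [/\ BV oO (v k), Uad (v k) &
        (eta%:E * (tr_model (u k) (u k) - tr_inf (u k) (Delta k))
          <= tr_model (u k) (u k) - tr_model (u k) (v k))%E].

End trust_region.

(* Main.v *)
(* Fix a feasible w. If at infinitely many iterates the linearized model decrease towards w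
   stays above some dl > 0, then small trust regions are accepted there (the model error is
   O(Delta^b) with b > 1 because q / 2 < r), so the objective drops by a fixed amount
   infinitely often, although it is bounded below. Hence at a cluster point z the limsup of
   alpha TV(u_k) is at most alpha TV(w) + j'(z)(w - z) for every feasible w. The choice
   w = z together with the lower semicontinuity of TV gives strict convergence, and then
   the general w gives the first order condition, which is stationarity.

   Cluster points exist since bounded BV functions with bounded variation are precompact in
   L^1: up to (mesh size) * TV, the L^1 norm on the interior dyadic cells is controlled by
   finitely many cell integrals. The weak-* convergence of the derivatives follows from the
   L^1 convergence, because |Du(theta)| <= TV(u) sup |theta| and the C^1_c functions are
   dense in C_0. *)

(* The variation is given only as a supremum of pairings with divergences, so each bound by TV needs
   an explicit admissible field. A Haar function on a dyadic cell is a limit of derivatives of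
   tensor products of a hat of height at most 1/2 with bumps. At any point at most one cell
   contributes, so a whole family of Haar functions in one direction pairs with u at the cost of
   half the mesh size times TV(u), however many cells there are. These costs telescope over
   successive halvings, which takes the place of smoothing in the proof of L^1 compactness. Cells
   that leave Omega carry no test function; there the L^oo bound and their vanishing total measure
   suffice. The same L^oo bound makes the L^p norms of differences of feasible functions comparable
   up to powers: so a radius in L^r controls a remainder in L^q, and L^1 convergence becomes L^q
   convergence. Functions are not identified when equal a.e., so a norm can vanish on a nonzero
   function; several estimates therefore carry an added positive number. *)
Require Import Defs.
From mathcomp Require Import all_boot all_order all_algebra.
From mathcomp Require Import all_classical all_reals all_analysis.
From mathcomp Require Import measurable_realfun ring lra.

Set Implicit Arguments.
Unset Strict Implicit.
Unset Printing Implicit Defensive.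

Import Order.TTheory GRing.Theory Num.Theory.
Import numFieldNormedType.Exports.

Local Open Scope classical_set_scope.
Local Open Scope ring_scope.

(** * Integrals and L^p seminorms *)

Section integration_lemmas.
Context d (T : measurableType d) (R : realType).
Variable mu : {measure set T -> \bar R}.
Implicit Types (f g h : T -> R) (p q r M : R).

Lemma Rintegral_ae_eq f g : measurable_fun setT f -> measurable_fun setT g ->
  {ae mu, forall x, f x = g x} -> \int[mu]_x f x = \int[mu]_x g x.
Proof.
move=> mf mg fg; rewrite /Rintegral; congr fine.
apply: ae_eq_integral => //; [exact/measurable_EFinP|exact/measurable_EFinP|].
by apply: filterS fg => x -> _.
Qed.

Lemma Rintegral_ae_le f g : mu.-integrable setT (EFin \o f) ->
  mu.-integrable setT (EFin \o g) ->
  {ae mu, forall x, f x <= g x} -> \int[mu]_x f x <= \int[mu]_x g x.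
Proof.
move=> fi gi fg; rewrite -subr_ge0 -RintegralB//.
have mB : measurable_fun setT (fun x => g x - f x).
  apply: measurable_funB; apply/measurable_EFinP.
    by case/integrableP : gi.
  by case/integrableP : fi.
(* Passing to the absolute value turns the a.e. inequality into pointwise nonnegativity. *)
rewrite (@Rintegral_ae_eq _ (fun x => `|g x - f x|))//.
- by apply: Rintegral_ge0.
- exact: measurableT_comp.
- by apply: filterS fg => x fgx; rewrite ger0_norm// subr_ge0.
Qed.

Lemma integrable_ae_le f g : measurable_fun setT f ->
  mu.-integrable setT (EFin \o g) ->
  {ae mu, forall x, `|f x| <= g x} -> mu.-integrable setT (EFin \o f).
Proof.
move=> mf gi fg; apply/integrableP; split; first exact/measurable_EFinP.
have mg : measurable_fun setT g by apply/measurable_EFinP; case/integrableP : gi.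
case/integrableP : gi => _; apply: le_lt_trans.
apply: ae_ge0_le_integral => //.
- by apply/measurable_EFinP; exact: measurableT_comp.
- by apply/measurable_EFinP; exact: measurableT_comp.
- apply: filterS fg => x fgx _ /=; rewrite lee_fin.
  exact: le_trans (ler_norm _).
Qed.

Lemma integrableT_abs f : mu.-integrable setT (EFin \o f) ->
  mu.-integrable setT (EFin \o (fun x => `|f x|)).
Proof.
move=> /integrable_abse; apply: eq_integrable => //.
Qed.

Lemma integrableT_mulr f g M : measurable_fun setT g ->
  {ae mu, forall x, `|g x| <= M} ->
  mu.-integrable setT (EFin \o f) ->
  mu.-integrable setT (EFin \o (fun x => f x * g x)).
Proof.
move=> mg gM fi.
have mf : measurable_fun setT f by apply/measurable_EFinP; case/integrableP : fi.
apply: (@integrable_ae_le _ (fun x => `|f x| * M)).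
- exact: measurable_funM.
- have := @integrableZr _ _ _ mu setT measurableT M _ (integrableT_abs fi).
  exact: eq_integrable.
- by apply: filterS gM => x gx; rewrite normrM ler_wpM2l.
Qed.

Hypothesis muT : (mu setT < +oo)%E.

Lemma integrableT_cst M : mu.-integrable setT (EFin \o cst M).
Proof.
apply/integrableP; split; first exact/measurable_EFinP.
by rewrite /= integral_cst// lte_mul_pinfty.
Qed.

Lemma integrable_ae_bounded f M : measurable_fun setT f ->
  {ae mu, forall x, `|f x| <= M} -> mu.-integrable setT (EFin \o f).
Proof. by move=> mf; apply: integrable_ae_le => //; exact: integrableT_cst. Qed.

End integration_lemmas.

Section Lp_norm.
Context d (T : measurableType d) (R : realType).
Variable mu : {measure set T -> \bar R}.
Implicit Types (f g h : T -> R) (p q r M : R).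

(** [fine] sends +oo to 0, so this is the norm only on [Lfun]; [nrmE] is the way back to the
    extended real norm. *)
Definition nrm p f : R := fine ('N[mu]_p%:E[EFin \o f])%E.

Lemma LfunP_meas p f : f \in Lfun mu p%:E -> measurable_fun setT f.
Proof. by rewrite inE => /andP[]; rewrite inE. Qed.

Lemma nrm_ge0 p f : 0 <= nrm p f.
Proof. by rewrite fine_ge0// Lnorm_ge0. Qed.

Lemma nrmE p f : f \in Lfun mu p%:E -> 'N[mu]_p%:E[EFin \o f]%E = (nrm p f)%:E.
Proof.
rewrite inE => /andP[_]; rewrite inE/= => fin.
by rewrite /nrm fineK// ge0_fin_numE// Lnorm_ge0.
Qed.

Lemma LfunI p f : measurable_fun setT f -> ('N[mu]_p%:E[EFin \o f] < +oo)%E ->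
  f \in Lfun mu p%:E.
Proof. by move=> mf Nf; rewrite inE; apply/andP; split; rewrite inE. Qed.

Lemma LfunI_integrable p f : 1 <= p -> measurable_fun setT f ->
  mu.-integrable setT (EFin \o (fun x => `|f x| `^ p)) -> f \in Lfun mu p%:E.
Proof.
move=> p1 mf /integrableP[_ fi]; apply: LfunI => //.
rewrite unlock poweR_lty//; apply: le_lt_trans fi.
under [leRHS]eq_integral => x _ do rewrite /= ger0_norm ?powR_ge0//.
exact: lexx.
Qed.

Lemma LfunD p f g : 1 <= p -> f \in Lfun mu p%:E -> g \in Lfun mu p%:E ->
  f + g \in Lfun mu p%:E.
Proof.
by move=> p1 Lf Lg; have p1' : (1 <= p%:E)%E by []; apply: (Lfun_addr_closed mu p1').2.
Qed.

Lemma LfunZ p a f : 1 <= p -> f \in Lfun mu p%:E -> a *: f \in Lfun mu p%:E.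
Proof.
move=> p1 Lf; rewrite (_ : a *: f = a \o* f); first exact: Lfun_scale.
by apply/funext => x /=; rewrite mulrC.
Qed.

Lemma LfunN p f : 1 <= p -> f \in Lfun mu p%:E -> - f \in Lfun mu p%:E.
Proof. by move=> p1 Lf; rewrite -scaleN1r; exact: LfunZ. Qed.

Lemma LfunB p f g : 1 <= p -> f \in Lfun mu p%:E -> g \in Lfun mu p%:E ->
  f - g \in Lfun mu p%:E.
Proof. by move=> p1 Lf Lg; apply: LfunD => //; exact: LfunN. Qed.



Lemma nrm_powR p f : 1 <= p -> f \in Lfun mu p%:E ->
  nrm p f `^ p = \int[mu]_x (`|f x| `^ p).
Proof.
move=> p1 Lf; have p0 : p != 0 by rewrite gt_eqF// (lt_le_trans ltr01).
have := powR_Lnorm mu (EFin \o f) p0.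
by rewrite nrmE// => /(congr1 fine); exact.
Qed.

Lemma nrm1 f : nrm 1 f = \int[mu]_x `|f x|.
Proof. by rewrite /nrm Lnorm1. Qed.

Lemma nrmZ p a f : 1 <= p -> f \in Lfun mu p%:E ->
  nrm p (a *: f) = `|a| * nrm p f.
Proof.
move=> p1 Lf; have p1' : (1 <= p%:E)%E by [].
have := LnormZ (Lfun_Sub p1' Lf) a.
move=> /(congr1 fine); rewrite /nrm/= => -> .
by rewrite fineM// nrmE.
Qed.

Lemma integrable_hoelder p q f g : 0 < p -> 0 < q -> p^-1 + q^-1 = 1 ->
  f \in Lfun mu p%:E -> g \in Lfun mu q%:E ->
  mu.-integrable setT (EFin \o (fun x => f x * g x)).
Proof.
move=> p0 q0 pq Lf Lg; apply/integrableP; split.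
  apply/measurable_EFinP; apply: measurable_funM; first exact: LfunP_meas Lf.
  exact: LfunP_meas Lg.
have := hoelder mu (LfunP_meas Lf) (LfunP_meas Lg) p0 q0 pq.
rewrite Lnorm1 !nrmE// -EFinM => /le_lt_trans; apply; exact: ltry.
Qed.

Lemma nrm_hoelder p q f g : 0 < p -> 0 < q -> p^-1 + q^-1 = 1 ->
  f \in Lfun mu p%:E -> g \in Lfun mu q%:E ->
  `|\int[mu]_x (f x * g x)| <= nrm p f * nrm q g.
Proof.
move=> p0 q0 pq Lf Lg.
have fgi := integrable_hoelder p0 q0 pq Lf Lg.
apply: le_trans (le_normr_Rintegral measurableT fgi) _.
rewrite -lee_fin EFinM -!nrmE//.
have := hoelder mu (LfunP_meas Lf) (LfunP_meas Lg) p0 q0 pq.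
rewrite Lnorm1; apply: le_trans.
rewrite /Rintegral fineK//.
by case/integrableP : fgi => mfg fin; rewrite ge0_fin_numE ?integral_ge0.
Qed.

Lemma ae_bounded_ge0 f M : {ae mu, forall x, `|f x| <= M} ->
  {ae mu, forall x, `|f x| <= Num.max M 0}.
Proof. by apply: filterS => x; rewrite le_max => ->. Qed.

Lemma integrable_powR_bounded p f M : 0 <= p -> (mu setT < +oo)%E ->
  measurable_fun setT f -> {ae mu, forall x, `|f x| <= M} ->
  mu.-integrable setT (EFin \o (fun x => `|f x| `^ p)).
Proof.
move=> p0 muT mf /ae_bounded_ge0 fM.
apply: (@integrable_ae_bounded _ _ _ _ muT _ (Num.max M 0 `^ p)).
  by apply: (measurableT_comp (measurable_powR _)) => //; exact: measurableT_comp.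
apply: filterS fM => x fx; rewrite ger0_norm ?powR_ge0//.
by rewrite ge0_ler_powR// nnegrE// (le_trans _ fx).
Qed.

Lemma Lfun_ae_bounded p f M : 1 <= p -> (mu setT < +oo)%E ->
  measurable_fun setT f -> {ae mu, forall x, `|f x| <= M} -> f \in Lfun mu p%:E.
Proof.
move=> p1 muT mf fM; apply: LfunI_integrable => //.
by apply: (@integrable_powR_bounded _ _ M) => //; rewrite (le_trans ler01).
Qed.

(** Pointwise, |f|^q is at most M^(q - r) |f|^r. *)
Lemma nrm_interpolation r q f M : 1 <= r -> r <= q -> (mu setT < +oo)%E -> 0 <= M ->
  measurable_fun setT f -> {ae mu, forall x, `|f x| <= M} ->
  nrm q f `^ q <= M `^ (q - r) * nrm r f `^ r.
Proof.
move=> r1 rq muT M0 mf fM; have q1 : 1 <= q by exact: le_trans rq.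
rewrite !nrm_powR//; [|exact: Lfun_ae_bounded fM..].
have pi p : 1 <= p -> mu.-integrable setT (EFin \o (fun x => `|f x| `^ p)).
  by move=> p1; apply: integrable_powR_bounded fM => //; rewrite (le_trans ler01).
rewrite -RintegralZl//; last exact: pi.
apply: Rintegral_ae_le; first exact: pi.
  have := @integrableZl _ _ _ mu setT measurableT (M `^ (q - r)) _ (pi _ r1).
  exact: eq_integrable.
apply: filterS fM => x fx.
have [->|f0] := eqVneq (f x) 0.
  by rewrite normr0 !powR0 ?mulr0// gt_eqF// (lt_le_trans ltr01).
have f0' : `|f x| != 0 by rewrite normr_eq0.
rewrite -[in leLHS](subrK r q) [leLHS]powRD ?f0' ?implybT//.
by rewrite ler_wpM2r ?powR_ge0// ge0_ler_powR// ?nnegrE// subr_ge0.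
Qed.

(** Where |f| <= t the integrand is at most t^q; elsewhere |f|^(q - r) <= t^(q - r) since the
    exponent is nonpositive. With t the trust-region radius both terms are of order t^q. *)
Lemma nrm_split r q t f M : 1 <= q -> q <= r -> (mu setT < +oo)%E -> 0 < t ->
  measurable_fun setT f -> {ae mu, forall x, `|f x| <= M} ->
  nrm q f `^ q <= t `^ q * fine (mu setT) + t `^ (q - r) * nrm r f `^ r.
Proof.
move=> q1 qr muT t0 mf fM; have r1 : 1 <= r by exact: le_trans qr.
rewrite !nrm_powR//; [|exact: Lfun_ae_bounded fM..].
have pi p : 1 <= p -> mu.-integrable setT (EFin \o (fun x => `|f x| `^ p)).
  by move=> p1; apply: integrable_powR_bounded fM => //; rewrite (le_trans ler01).
rewrite -RintegralZl//; last exact: pi.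
rewrite -(Rintegral_cst mu measurableT).
have i1 : mu.-integrable setT (EFin \o cst (t `^ q)) by exact: integrableT_cst.
have i2 : mu.-integrable setT (EFin \o (fun x => t `^ (q - r) * `|f x| `^ r)).
  have := @integrableZl _ _ _ mu setT measurableT (t `^ (q - r)) _ (pi _ r1).
  exact: eq_integrable.
rewrite -RintegralD//.
apply: le_Rintegral => //; first exact: pi.
  have := integrableD measurableT i1 i2; exact: eq_integrable.
move=> x _.
have [ft|/ltW tf] := leP `|f x| t.
  apply: ler_wpDr; first by rewrite mulr_ge0 ?powR_ge0.
  by rewrite ge0_ler_powR// ?nnegrE ?(ltW t0)// (le_trans ler01).
apply: ler_wpDl; first exact: powR_ge0.
have f0 : 0 < `|f x| by exact: lt_le_trans tf.
rewrite -[in leLHS](subrK r q) [leLHS]powRD ?(gt_eqF f0) ?implybT//.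
rewrite ler_wpM2r ?powR_ge0//.
rewrite -(opprB r q) !powRN lef_pV2 ?posrE ?powR_gt0//.
by rewrite ge0_ler_powR// ?nnegrE ?(ltW t0) ?(ltW f0)// subr_ge0.
Qed.

End Lp_norm.

(** * Taylor estimates along segments *)

Section real_derivative.
Variable R : realType.
Implicit Types (f : R -> R) (x : R).

Lemma is_derive_eps f x (df : R) :
  (forall e, 0 < e -> exists2 dl : R, 0 < dl &
     forall t, `|t| < dl -> `|f (x + t) - f x - t * df| <= e * `|t|) ->
  is_derive x 1 f df.
Proof.
move=> H.
have C : h^-1 *: ((f \o shift x) (h *: (1 : R)) - f x) @[h --> 0^'] --> df.
  apply/cvgrPdist_le => e e0; have [dl dl0 Hd] := H _ e0.
  near=> t.
  have t0 : t != 0 by near: t; exact: nbhs_dnbhs_neq.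
  have td : `|t| < dl.
    near: t; apply: cvg_within; apply/nbhs_normP; exists dl => //= y /=.
    by rewrite sub0r normrN.
  have := Hd t td.
  rewrite /= /shift/= scaler1 (addrC t) => le1.
  rewrite -(@ler_pM2r _ `|t|) ?normr_gt0// -normrM.
  apply: le_trans le1; rewrite -normrN.
  rewrite le_eqVlt; apply/orP; left; apply/eqP; congr (`|_|).
  by rewrite /GRing.scale/=; field.
by apply: DeriveDef; [apply/cvg_ex; exists df|apply/cvg_lim].
Unshelve. all: by end_near. Qed.

End real_derivative.

Section segment_mean_value.
Variables (R : realType) (d : nat) (Omega : set 'rV[R]_d) (oO : open Omega).
Variable q : R.
Hypothesis q1 : 1 <= q.
Local Notation V := ('rV[R]_d -> R).
Local Notation mu := (lebesgue_on oO).
Local Notation nrm := (nrm mu q).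
Implicit Types (D : set V) (l : V -> R) (f g h u : V).

(** The mean value theorem for t |-> T(u + t h) on [0, 1]. As T is differentiable for variations
    inside D only, the ends of the segment offer a one-sided expansion, which still gives continuity
    there. *)
Lemma segment_MVT D (T : V -> R) (dT : V -> V -> R) u h :
  Lq oO q h -> (forall t, 0 <= t <= 1 -> D (u + t *: h)) ->
  (forall x, D x -> has_derivative oO q (fun y : R => `|y|%:E) D T x (dT x)) ->
  (forall x a, D x -> dT x (a *: h) = a * dT x h) ->
  exists2 c, 0 < c < 1 & T (u + h) - T u = dT (u + c *: h) h.
Proof.
move=> Lh Dh HT Hlin.
pose phi t := T (u + t *: h).
have key t0 : 0 <= t0 <= 1 -> forall e, 0 < e -> exists2 dl : R, 0 < dl &
    forall t, 0 <= t0 + t <= 1 -> `|t| < dl ->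
      `|phi (t0 + t) - phi t0 - t * dT (u + t0 *: h) h| <= e * `|t|.
  move=> t01 e e0.
  have N0 : 0 < nrm h + 1 by rewrite ltr_wpDl ?nrm_ge0.
  have [dl dl0 Hd] := HT _ (Dh _ t01) (e / (nrm h + 1)) (divr_gt0 e0 N0).
  exists (dl / (nrm h + 1)); first exact: divr_gt0.
  move=> t tt td.
  have Eu : u + (t0 + t) *: h = u + t0 *: h + t *: h by rewrite scalerDl addrA.
  have := Hd (t *: h).
  rewrite /Lnormp nrmE; last exact: LfunZ.
  have H1 : ((`|t| * nrm h)%:E < dl%:E)%E.
    rewrite lte_fin (@le_lt_trans _ _ (`|t| * (nrm h + 1)))//.
      by rewrite ler_wpM2l// lerDl.
    by rewrite -ltr_pdivlMr.
  rewrite nrmZ// -Eu => /(_ (LfunZ t q1 Lh) (Dh _ tt) H1).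
  rewrite -EFinM lee_fin Hlin; last exact: Dh.
  move/le_trans; apply; rewrite mulrCA [leRHS]mulrC ler_wpM2l//.
  rewrite -[leRHS]mulr1 -mulrA ler_wpM2l ?(ltW e0)//.
  by rewrite mulrC ler_pdivrMr// mul1r lerDl.
have cts t0 : 0 <= t0 <= 1 -> forall e, 0 < e -> exists2 dl : R, 0 < dl &
    forall t, 0 <= t <= 1 -> `|t - t0| < dl -> `|phi t0 - phi t| <= e.
  move=> t01 e e0; have [dl dl0 Hd] := key _ t01 _ ltr01.
  set A := `|dT (u + t0 *: h) h| + 1.
  have A0 : 0 < A by rewrite ltr_wpDl.
  exists (Num.min dl (e / A)); first by rewrite lt_min dl0 divr_gt0.
  move=> t tt; rewrite lt_min => /andP[td te].
  have := Hd (t - t0); rewrite addrC subrK => /(_ tt td).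
  rewrite mul1r => le1; rewrite distrC.
  rewrite -(subrK ((t - t0) * dT (u + t0 *: h) h) (phi t - phi t0)).
  apply: le_trans (ler_normD _ _) _.
  apply: le_trans (lerD le1 (lexx _)) _.
  rewrite normrM -{1}[`|t - t0|]mulr1 -mulrDr [1 + _]addrC -/A.
  by rewrite -ler_pdivlMr// ltW.
have [|||c c01] := @MVT R phi (fun t => dT (u + t *: h) h) 0 1.
- exact: ltr01.
- move=> t; rewrite in_itv/= => /andP[t0 t1].
  apply: is_derive_eps => e e0.
  have [|dl dl0 Hd] := key t _ _ e0; first by rewrite !ltW.
  exists (Num.min dl (Num.min t (1 - t))).
    by rewrite !lt_min dl0 t0 subr_gt0.
  move=> s; rewrite !lt_min => /and3P[sd st s1]; apply: Hd => //.
  move: st s1; rewrite !ltr_norml => /andP[? ?] /andP[? ?].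
  by apply/andP; split; lra.
- apply/continuous_within_itvP; first exact: ltr01.
  split.
  + move=> t; rewrite in_itv/= => /andP[t0 t1].
    apply/cvgrPdist_le => e e0.
    have [|dl dl0 Hd] := cts t _ _ e0; first by rewrite !ltW.
    near=> s; apply: Hd.
      by apply/andP; split; apply: ltW; near: s; [exact: lt_nbhsr|exact: lt_nbhsl].
    near: s; apply/nbhs_normP; exists dl => //= y /=.
    by rewrite distrC.
  + apply/cvgrPdist_le => e e0.
    have [|dl dl0 Hd] := cts 0 _ _ e0; first by rewrite lexx ler01.
    near=> s; apply: Hd.
      by apply/andP; split; near: s; [exact: nbhs_right_ge|exact: nbhs_right_le].
    rewrite subr0; near: s.
    exists dl => //= y /=; rewrite sub0r normrN => + _; exact.
  + apply/cvgrPdist_le => e e0.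
    have [|dl dl0 Hd] := cts 1 _ _ e0; first by rewrite lexx ler01.
    near=> s; apply: Hd.
      by apply/andP; split; near: s; [exact: nbhs_left_ge|exact: nbhs_left_le].
    near: s.
    by exists dl => //= y /=; rewrite distrC => + _; exact.
- rewrite subr0 mulr1 /phi scale1r scale0r addr0 => ->.
  by exists c => //; move: c01; rewrite in_itv.
Unshelve. all: by end_near. Qed.

Lemma dualZ l a f : dual oO q l -> Lq oO q f -> l (a *: f) = a * l f.
Proof.
move=> [lin _] Lf.
have L0 : Lq oO q 0.
  have := LfunZ 0 q1 Lf; by rewrite scale0r.
have l0 : l 0 = 0.
  have := lin 1 0 0 L0 L0; rewrite scaler0 addr0 mul1r => /eqP.
  by rewrite -subr_eq0 opprD addrA subrr sub0r oppr_eq0 => /eqP.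
by have := lin a f 0 Lf L0; rewrite !addr0 l0 addr0.
Qed.

Lemma dualD l f g : dual oO q l -> Lq oO q f -> Lq oO q g -> l (f + g) = l f + l g.
Proof. by move=> [lin _] Lf Lg; have := lin 1 f g Lf Lg; rewrite scale1r mul1r. Qed.

Lemma dual_bound l : dual oO q l ->
  exists2 C, 0 <= C & forall f, Lq oO q f -> `|l f| <= C * nrm f.
Proof.
move=> [_ [C HC]]; exists (Num.max C 0); first by rewrite le_max lexx orbT.
move=> f Lf; have := HC f Lf; rewrite /Lnormp nrmE// -EFinM lee_fin.
move/le_trans; apply; apply: ler_wpM2r; first exact: nrm_ge0.
by rewrite le_max lexx.
Qed.

(* Scaling by [nrm f + e] instead of [nrm f] covers functions of norm zero. *)
Lemma dual_norm_bound l K f e : (forall a, l (a *: f) = a * l f) ->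
  Lq oO q f -> 0 < e -> (dual_norm oO q l <= K%:E)%E ->
  `|l f| <= K * (nrm f + e).
Proof.
move=> lin Lf e0 lK.
have N0 : 0 < nrm f + e by rewrite ltr_wpDl ?nrm_ge0.
rewrite -ler_pdivrMr// -lee_fin; apply: le_trans lK.
apply: ereal_sup_ubound; exists ((nrm f + e)^-1 *: f).
  split; first exact: LfunZ.
  rewrite /Lnormp nrmE; last exact: LfunZ.
  rewrite nrmZ// lee_fin ger0_norm; last by rewrite invr_ge0 ltW.
  by rewrite mulrC ler_pdivrMr// mul1r lerDl ltW.
by rewrite lin normrM (@ger0_norm _ (_^-1)) ?invr_ge0 1?ltW// mulrC.
Qed.

Lemma op_norm_bound B K f g e : dual_op oO q B -> Lq oO q f -> Lq oO q g -> 0 < e ->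
  (op_norm oO q B <= K%:E)%E -> `|B f g| <= K * (nrm f + e) * (nrm g + e).
Proof.
move=> [Bd Blin _] Lf Lg e0 BK.
have N0 : 0 < nrm f + e by rewrite ltr_wpDl ?nrm_ge0.
have L0 : Lq oO q 0.
  have := LfunZ 0 q1 Lf; by rewrite scale0r.
have B0 : B 0 g = 0.
  have := Blin 1 0 0 g L0 L0 Lg; rewrite scaler0 addr0 mul1r => /eqP.
  by rewrite -subr_eq0 opprD addrA subrr sub0r oppr_eq0 => /eqP.
set f' := (nrm f + e)^-1 *: f.
have Lf' : Lq oO q f' by exact: LfunZ.
have Bf' : B f' g = (nrm f + e)^-1 * B f g.
  by have := Blin (nrm f + e)^-1 f 0 g Lf L0 Lg; rewrite addr0 B0 addr0.
have : `|B f' g| <= K * (nrm g + e).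
  apply: dual_norm_bound => //.
    by move=> a; apply: dualZ => //; exact: Bd.
  apply: le_trans BK; apply: ereal_sup_ubound; exists f' => //.
  split => //.
  rewrite /Lnormp nrmE; last exact: LfunZ.
  rewrite nrmZ// lee_fin ger0_norm; last by rewrite invr_ge0 ltW.
  by rewrite mulrC ler_pdivrMr// mul1r lerDl ltW.
rewrite Bf' normrM (@ger0_norm _ (_^-1)); last by rewrite invr_ge0 ltW.
by rewrite mulrC ler_pdivrMr// mulrAC.
Qed.

(** Two mean value steps, the second for x |-> dT x h along c h, turn the remainder into a Hessian
    value at (c h, h), evaluated at a point of the segment, where the bound K applies. *)
Lemma taylor_hessian D (T : V -> R) dT d2T u h K :
  Lq oO q h -> (forall t, 0 <= t <= 1 -> D (u + t *: h)) ->
  (forall x, D x -> Lq oO q x) -> 0 <= K ->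
  (forall x, Lq oO q x -> has_gradient oO q (Lq oO q) T x (dT x)) ->
  (forall x, Lq oO q x -> has_hessian oO q (Lq oO q) dT x (d2T x)) ->
  (forall x, D x -> (op_norm oO q (d2T x) <= K%:E)%E) ->
  `|T (u + h) - T u - dT u h| <= K * nrm h ^+ 2.
Proof.
move=> Lh Dh DL K0 HT H2T HK.
have Du : Lq oO q u.
  by have := Dh 0; rewrite scale0r addr0 => /(_ _)/DL; apply; rewrite lexx ler01.
have Lseg t : Lq oO q (u + t *: h) by apply: LfunD => //; exact: LfunZ.
have [c /andP[c0 c1] ->] := @segment_MVT (Lq oO q) T dT u h Lh
  (fun t _ => Lseg t) (fun x Dx => (HT x Dx).2)
  (fun x a Dx => dualZ a (HT x Dx).1 Lh).
have [||||c' /andP[c'0 c'1]] := @segment_MVT (Lq oO q) (fun x => dT x h)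
   (fun x g => d2T x g h) u (c *: h).
- exact: LfunZ.
- by move=> t _; rewrite scalerA; exact: Lseg.
- move=> x Lx e e0.
  have N0 : 0 < nrm h + 1 by rewrite ltr_wpDl ?nrm_ge0.
  have [dl dl0 Hd] := (H2T x Lx).2 (e / (nrm h + 1)) (divr_gt0 e0 N0).
  exists dl => // phi Lphi Dphi phid.
  have := Hd phi Lphi Dphi phid.
  rewrite /Lnormp nrmE// -!EFinM.
  have Lxp : Lq oO q (x + phi) by [].
  have [Bd _ _] := (H2T x Lx).1.
  rewrite lee_fin => Hn.
  have Hl a : (dT (x + phi) - dT x - d2T x phi) (a *: h) =
      a * (dT (x + phi) - dT x - d2T x phi) h.
    rewrite /GRing.add/GRing.opp/=.
    rewrite (dualZ _ (HT _ Lxp).1 Lh) (dualZ _ (HT _ Lx).1 Lh) (dualZ _ (Bd _ Lphi) Lh).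
    by rewrite !mulrDr !mulrN.
  apply: le_trans (dual_norm_bound Hl Lh ltr01 Hn) _.
  by rewrite mulrAC divfK ?gt_eqF.
- move=> x a Lx; have [Bd Blin _] := (H2T x Lx).1.
  have L0 : Lq oO q 0.
    have := LfunZ 0 q1 Lh; by rewrite scale0r.
  have B0 : d2T x 0 h = 0.
    have := Blin 1 0 0 h L0 L0 Lh; rewrite scaler0 addr0 mul1r => /eqP.
    by rewrite -subr_eq0 opprD addrA subrr sub0r oppr_eq0 => /eqP.
  have := Blin a (c *: h) 0 h (LfunZ _ q1 Lh) L0 Lh.
  by rewrite !addr0 B0 addr0.
move=> E; rewrite E.
have Dc : D (u + c' *: (c *: h)).
  by rewrite scalerA; apply: Dh; rewrite mulr_ge0 ?(ltW c0) ?(ltW c'0)//= mulr_ile1 ?ltW.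
have bnd e : 0 < e -> `|d2T (u + c' *: (c *: h)) (c *: h) h| <=
    K * (nrm (c *: h) + e) * (nrm h + e).
  by move=> e0; apply: op_norm_bound => //; [exact: (H2T _ (DL _ Dc)).1|exact: LfunZ|exact: HK].
rewrite nrmZ// in bnd.
have cN : `|c| * nrm h <= nrm h.
  by rewrite ger0_norm ?(ltW c0)// ler_piMl ?nrm_ge0// ltW.
have bnd2 e : 0 < e -> `|d2T (u + c' *: (c *: h)) (c *: h) h| <=
    K * (nrm h + e) ^+ 2.
  move=> e0; apply: le_trans (bnd _ e0) _; rewrite expr2 mulrA.
  rewrite ler_wpM2r// ?addr_ge0 ?nrm_ge0 ?(ltW e0)//.
  by rewrite ler_wpM2l// lerD2r.
apply/ler_addgt0Pr => e e0.
(* For e' <= 1 the excess K ((N + e')^2 - N^2), with N the norm of h, is at most K e' (2 N + 1),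
   hence at most e. *)
pose e' := Num.min 1 (e / (K * (2 * nrm h + 1) + 1)).
have P0 : 0 < K * (2 * nrm h + 1) + 1.
  by rewrite ltr_wpDl// mulr_ge0// addr_ge0// mulr_ge0// nrm_ge0.
have e'0 : 0 < e' by rewrite lt_min ltr01 divr_gt0.
apply: le_trans (bnd2 _ e'0) _.
have e'1 : e' <= 1 by rewrite /e' ge_min lexx.
have e'2 : e' * (K * (2 * nrm h + 1) + 1) <= e.
  by rewrite -ler_pdivlMr// /e' ge_min lexx orbT.
have N0 : 0 <= nrm h by exact: nrm_ge0.
have : K * (e' * e') <= K * e' by rewrite ler_wpM2l// ler_piMl// ltW.
by rewrite sqrrD mulr2n; lra.
Qed.

End segment_mean_value.

(** * Total variation and the admissible set *)

Section test_functions.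
Variables (R : realType) (n : nat).
Local Notation V := ('rV[R]_n -> R).

Lemma continuous_measurable_rV (f : V) : continuous f -> measurable_fun setT f.
Proof.
move=> cf.
apply: (measurability (@RGenOpens.G R)); first exact: RGenOpens.measurableE.
move=> _ [_ [a [b ->]] <-]; rewrite setTI; apply: open_measurable_rV.
by apply: open_comp; [move=> x _; exact: cf|exact: interval_open].
Qed.

Lemma continuous_bounded_on (f : V) (K : set 'rV[R]_n) : continuous f -> compact K ->
  exists M, forall x, K x -> `|f x| <= M.
Proof.
move=> cf cK.
have : compact (f @` K).
  by apply: continuous_compact => //; exact: continuous_subspaceT.
move=> /compact_bounded [N [_ HN]]; exists (N + 1) => x Kx.
by apply: (HN (N + 1)); [rewrite ltrDl|exists x].
Qed.

Lemma is_derive_zero_off (f : V) (K : set 'rV[R]_n) (v x : 'rV[R]_n) : closed K ->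
  (forall y, ~ K y -> f y = 0) -> ~ K x -> 'D_v f x = 0.
Proof.
move=> clK f0 Kx; apply/cvg_lim => //.
have nK : \forall y \near x, ~ K y.
  by apply: open_nbhs_nbhs; split => //; exact: closed_openC.
have nK' : \forall h \near (0 : R), ~ K (h *: v + x).
  have : (fun h : R => h *: v + x) @ (0 : R) --> x.
    rewrite -[X in _ --> X]add0r -(scale0r v).
    by apply: cvgD; [apply: cvgZr_tmp|exact: cvg_cst].
  by move=> /(_ _ nK).
apply: (@cvg_trans _ (cst 0 @ (0 : R)^')); last exact: cvg_cst.
apply: near_eq_cvg; apply: cvg_within.
near=> h; rewrite /= /shift/= !f0//; first by rewrite subr0 scaler0.
by near: h.
Unshelve. all: by end_near. Qed.

Lemma C1_pderiv_measurable (f : V) i : C1 f -> measurable_fun setT (pderiv i f).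
Proof. by move=> [_ /(_ i) [_ c]]; exact: continuous_measurable_rV. Qed.

Lemma C1_compact_pderiv_bounded (f : V) (K : set 'rV[R]_n) i : C1 f -> compact K ->
  (forall y, ~ K y -> f y = 0) -> exists M, forall x, `|pderiv i f x| <= M.
Proof.
move=> [cf /(_ i) [df cdf]] cK f0.
have [M HM] := continuous_bounded_on cdf cK.
exists (Num.max M 0) => x; have [Kx|Kx] := pselect (K x).
  by rewrite le_max HM.
rewrite /pderiv (is_derive_zero_off _ _ f0)//; first by rewrite normr0 le_max lexx orbT.
apply: compact_closed => //; exact: norm_hausdorff.
Qed.

Lemma C1N (f : V) : C1 f -> C1 (fun x => - f x).
Proof.
move=> [cf Hf]; split; first by move=> x; exact: (cvgN (cf x)).
move=> i; have [df cdf] := Hf i; split.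
  by move=> x; apply: derivableN; exact: df.
rewrite (_ : pderiv i _ = fun x => - pderiv i f x).
  by move=> x; exact: (cvgN (cdf x)).
by apply/funext => x; rewrite /pderiv deriveN.
Qed.

Lemma pderivN (f : V) i x : C1 f -> pderiv i (fun x => - f x) x = - pderiv i f x.
Proof. by move=> [_ /(_ i) [df _]]; rewrite /pderiv deriveN. Qed.

End test_functions.

Section total_variation.
Variables (R : realType) (d : nat) (Omega : set 'rV[R]_d) (oO : open Omega).
Local Notation V := ('rV[R]_d -> R).
Local Notation mu := (lebesgue_on oO).
Implicit Types (u v : V) (phi : 'I_d -> V).

Definition divergence phi : V := fun x => \sum_i pderiv i (phi i) x.

(** The variation on [BV] only, since +oo becomes 0; for functions not yet known to be in BV the
    statements keep [TV]. *)
Definition tv u : R := fine (TV oO u).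

Lemma unit_test_field_div phi : unit_test_field Omega phi ->
  measurable_fun setT (divergence phi) /\
  exists M, forall x, `|divergence phi x| <= M.
Proof.
move=> [Hphi _]; split.
  by apply: measurable_sum => i; apply: C1_pderiv_measurable; case: (Hphi i).
have HM i : exists M, forall x, `|pderiv i (phi i) x| <= M.
  case: (Hphi i) => [C [K [cK _ K0]]].
  exact: C1_compact_pderiv_bounded K0.
have [M MP] := choice HM.
exists (\sum_i M i) => x; apply: le_trans (ler_norm_sum _ _ _) _.
by apply: ler_sum => i _; exact: MP.
Qed.

Lemma unit_test_fieldN phi : unit_test_field Omega phi ->
  unit_test_field Omega (fun i x => - phi i x).
Proof.
move=> [Hphi H1]; split; last by move=> x; under eq_bigr do rewrite sqrrN.
move=> i; have [C [K [cK KO K0]]] := Hphi i; split; first exact: C1N.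
by exists K; split => // x /K0 ->; rewrite oppr0.
Qed.

Lemma divergenceN phi x : unit_test_field Omega phi ->
  divergence (fun i x => - phi i x) x = - divergence phi x.
Proof.
move=> [Hphi _]; rewrite /divergence -sumrN; apply: eq_bigr => i _.
by rewrite pderivN//; case: (Hphi i).
Qed.

Lemma integrable_pairing u phi : u \in Lfun mu 1%:E -> unit_test_field Omega phi ->
  mu.-integrable setT (EFin \o (fun x => u x * divergence phi x)).
Proof.
move=> Lu /unit_test_field_div [mphi [M HM]].
apply: (@integrableT_mulr _ _ _ _ _ _ M) => //; first exact: aeW.
exact/Lfun1_integrable.
Qed.

Lemma unit_test_field0 : unit_test_field Omega (fun=> (fun=> 0)).
Proof.
split; last by move=> x; rewrite big1 ?ler01// => i _; rewrite expr0n.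
move=> i; split; last by exists set0; split => //; exact: compact0.
split; first exact: cst_continuous.
move=> j; split; first by move=> x; exact: derivable_cst.
rewrite (_ : pderiv j _ = fun=> 0); first exact: cst_continuous.
by apply/funext => x; rewrite /pderiv derive_cst.
Qed.

Lemma TV_ge0 u : (0 <= TV oO u)%E.
Proof.
apply: ereal_sup_ubound; exists (fun=> (fun=> 0)); first exact: unit_test_field0.
congr EFin.
under eq_Rintegral => x _.
  rewrite (_ : \sum_i _ = 0) ?mulr0; last first.
    by rewrite big1// => i _; rewrite /pderiv derive_cst.
  over.
by rewrite Rintegral_cst//= mul0r.
Qed.

Lemma TVE u : BV oO u -> TV oO u = (tv u)%:E.
Proof. by move=> [_ fin]; rewrite /tv fineK// ge0_fin_numE// TV_ge0. Qed.

Lemma tv_ge0 u : 0 <= tv u.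
Proof. by rewrite fine_ge0// TV_ge0. Qed.

Lemma TV_le u M : (forall phi, unit_test_field Omega phi ->
  \int[mu]_x (u x * divergence phi x) <= M) -> (TV oO u <= M%:E)%E.
Proof. by move=> H; apply: ge_ereal_sup => _ [phi Hphi <-]; rewrite lee_fin; exact: H. Qed.

Lemma tv_le u M : (TV oO u <= M%:E)%E -> tv u <= M.
Proof.
move=> H; rewrite -lee_fin /tv fineK//.
by rewrite ge0_fin_numE ?TV_ge0// (le_lt_trans H)// ltry.
Qed.

Lemma pairing_le_tv u phi : BV oO u -> unit_test_field Omega phi ->
  \int[mu]_x (u x * divergence phi x) <= tv u.
Proof.
move=> Bu Hphi; rewrite -lee_fin -TVE//.
by apply: ereal_sup_ubound; exists phi.
Qed.

Lemma norm_pairing_le_tv u phi : BV oO u -> unit_test_field Omega phi ->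
  `|\int[mu]_x (u x * divergence phi x)| <= tv u.
Proof.
move=> Bu Hphi; rewrite ler_norml pairing_le_tv// andbT lerNl.
have := pairing_le_tv Bu (unit_test_fieldN Hphi).
under eq_Rintegral => x _ do rewrite divergenceN// mulrN -mulN1r.
by rewrite RintegralZl ?mulN1r//; exact: integrable_pairing Bu.1 Hphi.
Qed.

Lemma TV_linear u v a b : BV oO u -> BV oO v ->
  (TV oO (a *: u + b *: v)%R <= (`|a| * tv u + `|b| * tv v)%:E)%E.
Proof.
move=> Bu Bv; apply: TV_le => phi Hphi.
have iu := integrable_pairing Bu.1 Hphi.
have iv := integrable_pairing Bv.1 Hphi.
rewrite (_ : (fun x => _ * _) = fun x => a * (u x * divergence phi x) +
    b * (v x * divergence phi x)); last first.
  by apply/funext => x; rewrite !mulrA -mulrDl.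
have iau : mu.-integrable setT (EFin \o (fun x => a * (u x * divergence phi x))).
  have := @integrableZl _ _ _ mu setT measurableT a _ iu; exact: eq_integrable.
have ibv : mu.-integrable setT (EFin \o (fun x => b * (v x * divergence phi x))).
  have := @integrableZl _ _ _ mu setT measurableT b _ iv; exact: eq_integrable.
rewrite RintegralD// !RintegralZl//.
by apply: lerD; apply: le_trans (ler_norm _) _; rewrite normrM ler_wpM2l//;
  exact: norm_pairing_le_tv.
Qed.

Lemma BV_linear u v a b : BV oO u -> BV oO v -> BV oO (a *: u + b *: v).
Proof.
move=> Bu Bv; split; last exact: le_lt_trans (TV_linear a b Bu Bv) (ltry _).
have l11 : 1 <= 1 :> R by [].
by apply: LfunD => //; apply: LfunZ => //; [exact: Bu.1|exact: Bv.1].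
Qed.

(** For a fixed field the divergence is bounded, so the pairing is continuous in L^1, and a supremum
    of continuous functionals is lower semicontinuous. The conclusion on [TV] also yields that w has
    bounded variation. *)
Lemma TV_lsc w M : w \in Lfun mu 1%:E ->
  (forall e, 0 < e -> exists u, [/\ BV oO u, nrm mu 1 (u - w) < e & tv u <= M]) ->
  (TV oO w <= M%:E)%E.
Proof.
move=> Lw H; apply: TV_le => phi Hphi.
have [mphi [C HC]] := unit_test_field_div Hphi.
apply/ler_addgt0Pr => e e0.
have C0 : 0 <= C by exact: le_trans (HC 0).
have [u [Bu uw uM]] := H (e / (C + 1)) (divr_gt0 e0 (ltr_wpDl C0 ltr01)).
have iu := integrable_pairing Bu.1 Hphi.
have iw := integrable_pairing Lw Hphi.
rewrite -(subrK (\int[mu]_x (u x * divergence phi x)) (\int[mu]_x (w x * _))) addrC.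
apply: lerD; first by apply: le_trans uM; exact: pairing_le_tv.
rewrite -RintegralB//.
have l11 : 1 <= 1 :> R by [].
have Luw : u - w \in Lfun mu 1%:E by apply: LfunB => //; exact: Bu.1.
have /Lfun1_integrable iuw := Luw.
have iuwC : mu.-integrable setT (EFin \o (fun x => `|(u - w) x| * C)).
  have := @integrableZr _ _ _ mu setT measurableT C _ (integrableT_abs iuw).
  exact: eq_integrable.
have iB : mu.-integrable setT (EFin \o (fun x => w x * divergence phi x - u x * divergence phi x)).
  have := @integrableB _ _ _ mu setT measurableT _ _ iw iu; exact: eq_integrable.
apply: (@le_trans _ _ (\int[mu]_x (`|(u - w) x| * C))).
  apply: le_Rintegral => // x _; rewrite -mulrBl; apply: le_trans (ler_norm _) _.
  by rewrite normrM distrC ler_wpM2l.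
rewrite RintegralZr//; last exact: integrableT_abs.
rewrite -nrm1.
apply: (@le_trans _ _ (nrm mu 1 (u - w) * (C + 1))).
  by rewrite ler_wpM2l ?nrm_ge0// lerDl.
by rewrite -ler_pdivlMr ?ltr_wpDl// ltW.
Qed.

End total_variation.

Section admissible_set.
Variables (R : realType) (d : nat) (Omega : set 'rV[R]_d) (oO : open Omega).
Local Notation V := ('rV[R]_d -> R).
Local Notation mu := (lebesgue_on oO).
Hypothesis muT : (mu setT < +oo)%E.
Variables (ul uu : R).
Local Notation Uad := (Uad oO ul uu).
Implicit Types (u v : V).

Lemma Uad_measurable u : Uad u -> measurable_fun setT u.
Proof. by move=> [[Lu _] _]; exact: LfunP_meas Lu. Qed.

Lemma Uad_norm_bound u : Uad u -> {ae mu, forall x, `|u x| <= `|ul| + `|uu|}.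
Proof.
move=> [_]; apply: filterS => x /andP[lx xu].
have := ler_norm uu; have := ler_norm (- ul); rewrite normrN => h1 h2.
by rewrite ler_norml; apply/andP; split; have := normr_ge0 ul; have := normr_ge0 uu; lra.
Qed.

Lemma UadB_bound u v : Uad u -> Uad v -> {ae mu, forall x, `|(v - u) x| <= uu - ul}.
Proof.
move=> [_ Hu] [_ Hv]; apply: filterS2 Hu Hv => x /andP[? ?] /andP[? ?].
have -> : (v - u) x = v x - u x by [].
by rewrite ler_norml; apply/andP; split; lra.
Qed.

Lemma Uad_Lfun p u : 1 <= p -> Uad u -> u \in Lfun mu p%:E.
Proof.
move=> p1 Uu.
exact: (Lfun_ae_bounded p1 muT (Uad_measurable Uu) (Uad_norm_bound Uu)).
Qed.

Lemma Uad_segment u v t : Uad u -> Uad v -> 0 <= t <= 1 -> Uad (u + t *: (v - u)).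
Proof.
move=> [Bu Hu] [Bv Hv] /andP[t0 t1].
rewrite (_ : u + _ = (1 - t) *: u + t *: v); last first.
  by rewrite scalerBr scalerBl scale1r -addrA [- _ + _]addrC.
split; first exact: BV_linear.
apply: filterS2 Hu Hv => x /andP[? ?] /andP[? ?].
have -> : ((1 - t) *: u + t *: v) x = (1 - t) * u x + t * v x by [].
have t1' : 0 <= 1 - t by lra.
by apply/andP; split; nra.
Qed.

Lemma tv_segment u v t : Uad u -> Uad v -> 0 <= t <= 1 ->
  tv oO (u + t *: (v - u)) <= (1 - t) * tv oO u + t * tv oO v.
Proof.
move=> [Bu Hu] [Bv Hv] /andP[t0 t1].
rewrite (_ : u + _ = (1 - t) *: u + t *: v); last first.
  by rewrite scalerBr scalerBl scale1r -addrA [- _ + _]addrC.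
have t1' : 0 <= 1 - t by lra.
apply: tv_le; have := TV_linear (1 - t) t Bu Bv.
by rewrite !ger0_norm.
Qed.

End admissible_set.

(** * First and second order bounds on the admissible set *)

Lemma powR_root_le (R : realType) (p x A : R) :
  0 < p -> 0 <= x -> x `^ p <= A -> x <= A `^ p^-1.
Proof.
move=> p0 x0 h; have pN0 : p != 0 by rewrite gt_eqF.
rewrite -[leLHS]powRr1// -(mulfV pN0) powRrM.
by rewrite ge0_ler_powR ?nnegrE ?powR_ge0 ?invr_ge0 ?(ltW p0)// (le_trans _ h) ?powR_ge0.
Qed.

Lemma dual_exponent_conj (R : realType) (q : R) : 1 < q ->
  [/\ 1 <= dual_exponent q, 0 < dual_exponent q & (dual_exponent q)^-1 + q^-1 = 1].
Proof.
move=> q1; rewrite /dual_exponent.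
have q0 : 0 < q by exact: lt_trans q1.
have q10 : 0 < q - 1 by rewrite subr_gt0.
have h : 1 <= q / (q - 1) by rewrite ler_pdivlMr// mul1r; lra.
split => //; first exact: lt_le_trans h.
by field; rewrite !gt_eqF.
Qed.

Section first_and_second_order_bounds.
Variables (R : realType) (d : nat) (Omega : set 'rV[R]_d) (oO : open Omega).
Local Notation V := ('rV[R]_d -> R).
Local Notation mu := (lebesgue_on oO).
Hypothesis muT : (mu setT < +oo)%E.
Variables (q ul uu : R).
Hypothesis q1 : 1 < q.
Local Notation Uad := (Uad oO ul uu).
Local Notation nrm := (nrm mu).
Local Notation q' := (dual_exponent q).
Variables (j : V -> R) (dj : V -> V -> R) (gradj : V -> V).
Hypothesis hdj : forall u, Uad u -> has_gradient oO q Uad j u (dj u).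
Hypothesis hgradj : forall u, Uad u -> represents oO q (gradj u) (dj u).
Hypothesis hgradjL : lipschitz_gradient oO q Uad gradj.
Implicit Types (u v w h : V).

Let q1' : 1 <= q. Proof. exact: ltW. Qed.
Let q0 : 0 < q. Proof. exact: lt_trans q1. Qed.

Lemma UadB_Lq p u v : 1 <= p -> Uad u -> Uad v -> v - u \in Lfun mu p%:E.
Proof.
move=> p1 Uu Uv; apply: LfunB => //; first exact: (Uad_Lfun muT p1 Uv).
exact: (Uad_Lfun muT p1 Uu).
Qed.

Lemma UadB_measurable u v : Uad u -> Uad v -> measurable_fun setT (v - u).
Proof. by move=> Uu Uv; exact: LfunP_meas (UadB_Lq (lexx 1) Uu Uv). Qed.

(** Hoelder's inequality carries the Lipschitz bound from the representatives in the dual exponent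
    over to the functionals. *)
Lemma gradient_lipschitz : exists2 L, 0 <= L & forall u x h, Uad u -> Uad x ->
  Lq oO q h -> `|dj x h - dj u h| <= L * nrm q (x - u) * nrm q h.
Proof.
have [q'1 q'0 qq] := dual_exponent_conj q1.
have [L HL] := hgradjL; exists (Num.max L 0); first by rewrite le_max lexx orbT.
move=> u x h Uu Ux Lh.
have [Lgu Egu] := hgradj Uu; have [Lgx Egx] := hgradj Ux.
have Lg : gradj x - gradj u \in Lfun mu q'%:E by exact: LfunB.
rewrite Egu// Egx// -RintegralB//; last 2 first.
- exact: integrable_hoelder Lgx Lh.
- exact: integrable_hoelder Lgu Lh.
under eq_Rintegral => y _ do rewrite -mulrBl.
apply: le_trans (nrm_hoelder q'0 q0 qq Lg Lh) _.
apply: ler_wpM2r; first exact: nrm_ge0.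
have := HL x u Ux Uu; rewrite /Lnormp !nrmE//; last exact: UadB_Lq.
rewrite lee_fin => /le_trans; apply; apply: ler_wpM2r; first exact: nrm_ge0.
by rewrite le_max lexx.
Qed.

Lemma objective_taylor : exists2 L, 0 <= L & forall u v, Uad u -> Uad v ->
  `|j v - j u - dj u (v - u)| <= L * nrm q (v - u) ^+ 2.
Proof.
have [L L0 HL] := gradient_lipschitz; exists L => // u v Uu Uv.
have Lh : Lq oO q (v - u) by exact: UadB_Lq.
have [c /andP[c0 c1]] := @segment_MVT _ _ _ oO q q1' Uad j dj u (v - u) Lh
  (fun t => Uad_segment Uu Uv) (fun x Ux => (hdj Ux).2)
  (fun x a Ux => dualZ q1' a (hdj Ux).1 Lh).
have -> : u + (v - u) = v by rewrite addrC subrK.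
move=> ->.
have Uc : Uad (u + c *: (v - u)) by apply: Uad_segment; rewrite ?ltW.
apply: le_trans (HL _ _ _ Uu Uc Lh) _.
rewrite expr2 mulrA ler_wpM2r ?nrm_ge0// ler_wpM2l//.
have -> : u + c *: (v - u) - u = c *: (v - u) by rewrite addrAC subrr add0r.
by rewrite nrmZ// ger0_norm ?(ltW c0)// ler_piMl ?nrm_ge0 ?(ltW c1).
Qed.

(** The derivatives of the model and of j at u are represented by the same [gradj u], so they agree
    on L^q and the expansion can be stated with [dj u]. The segment from u to v stays in the
    admissible set, where the Hessian bound holds. *)
Lemma model_taylor kappa u v (qu : V -> R) : 1 <= kappa -> Uad u -> Uad v ->
  model_assumption oO q ul uu j gradj kappa u qu ->
  qu u = j u /\
  `|qu v - j u - dj u (v - u)| <= (kappa - 1) * nrm q (v - u) ^+ 2.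
Proof.
move=> k1 Uu Uv [dq [d2q [H1 H2 Eu Hrep HK]]]; split => //.
have Lh : Lq oO q (v - u) by exact: UadB_Lq.
have -> : dj u (v - u) = dq u (v - u) by rewrite Hrep.2// (hgradj Uu).2.
have := @taylor_hessian _ _ _ oO q q1' Uad qu dq d2q u (v - u) (kappa - 1) Lh
  (fun t => Uad_segment Uu Uv) (fun x => Uad_Lfun muT q1').
rewrite [u + _]addrC subrK Eu; apply => //; first by rewrite subr_ge0.
move=> x Ux; apply: le_trans HK.
by apply: ereal_sup_ubound; exists x.
Qed.

(** The L^oo bound controls the L^1 norm, and interpolation from exponent 1 gives the others. The
    added 1 makes B a legitimate divisor. *)
Lemma nrm_bounded p : 1 <= p -> exists2 B, 0 < B & forall u v, Uad u -> Uad v ->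
  nrm p (v - u) <= B.
Proof.
move=> p1; have p0 : 0 < p by exact: lt_le_trans p1.
exists ((`|uu - ul| `^ (p - 1) * (`|uu - ul| * fine (mu setT))) `^ p^-1 + 1).
  by rewrite ltr_wpDl ?powR_ge0.
move=> u v Uu Uv; have mB := UadB_measurable Uu Uv.
have fB : {ae mu, forall x, `|(v - u) x| <= `|uu - ul|}.
  by apply: filterS (UadB_bound Uu Uv) => x /le_trans; apply; exact: ler_norm.
have l11 : 1 <= 1 :> R by [].
have := nrm_interpolation l11 p1 muT (normr_ge0 _) mB fB.
rewrite (powRr1 (nrm_ge0 _ _ _)).
have N1 : nrm 1 (v - u) <= `|uu - ul| * fine (mu setT).
  rewrite nrm1 -(Rintegral_cst mu measurableT).
  apply: Rintegral_ae_le => //; last exact: integrableT_cst.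
  by apply: integrableT_abs; apply/Lfun1_integrable; exact: UadB_Lq.
move=> /le_trans /(_ (ler_wpM2l (powR_ge0 _ _) N1)) h.
by apply: ler_wpDr => //; exact: powR_root_le p0 (nrm_ge0 _ _ _) h.
Qed.

(* For r < q the factor |h|^(q - r) is absorbed in the L^oo bound, which leaves the exponent
   2 r / q; this is where q / 2 < r is needed. *)
Lemma nrm_q_le_radius r : 1 <= r -> q / 2 < r ->
  exists C b, [/\ 0 <= C, 1 < b & forall u v (D : R), Uad u -> Uad v -> 0 < D ->
    nrm r (v - u) <= D -> nrm q (v - u) ^+ 2 <= C * D `^ b].
Proof.
move=> r1 rq.
have sq (x A B e : R) : 0 <= x -> 0 <= A -> 0 < B -> x `^ q <= A * B `^ e ->
    x ^+ 2 <= A `^ (2 / q) * B `^ (e * (2 / q)).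
  move=> x0 A0 B0 h.
  have -> : x ^+ 2 = (x `^ q) `^ (2 / q).
    by rewrite -powRrM mulrC divfK ?gt_eqF// powR_mulrn.
  apply: le_trans (ge0_ler_powR _ _ _ h) _; rewrite ?nnegrE ?powR_ge0 ?divr_ge0 ?(ltW q0)//.
    by rewrite mulr_ge0 ?powR_ge0.
  by rewrite powRM ?powR_ge0// -powRrM.
have [rleq|qr] := leP r q.
- exists ((`|uu - ul| `^ (q - r)) `^ (2 / q)), (r * (2 / q)).
  split; first exact: powR_ge0.
    by rewrite mulrA ltr_pdivlMr// mul1r -ltr_pdivrMr.
  move=> u v D Uu Uv D0 hD.
  apply: sq; rewrite ?nrm_ge0 ?powR_ge0//.
  apply: (@le_trans _ _ (`|uu - ul| `^ (q - r) * nrm r (v - u) `^ r)).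
    apply: nrm_interpolation => //; first exact: UadB_measurable.
    by apply: filterS (UadB_bound Uu Uv) => x /le_trans; apply; exact: ler_norm.
  rewrite ler_wpM2l ?powR_ge0// ge0_ler_powR// ?nnegrE ?nrm_ge0 ?(ltW D0)//.
  exact: le_trans r1.
(* For q < r, splitting at height D bounds the q-th power of the norm by a multiple of D^q, so the
   exponent is 2. *)
- exists ((fine (mu setT) + 1) `^ (2 / q)), (q * (2 / q)).
  have A0 : 0 <= fine (mu setT) + 1 by rewrite addr_ge0// fine_ge0.
  split; first exact: powR_ge0.
    by rewrite mulrC divfK ?gt_eqF// ltr1n.
  move=> u v D Uu Uv D0 hD.
  apply: sq; rewrite ?nrm_ge0//.
  have := nrm_split q1' (ltW qr) muT D0 (UadB_measurable Uu Uv) (UadB_bound Uu Uv).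
  move/le_trans; apply; rewrite mulrDl mul1r mulrC lerD2l.
  rewrite -[X in _ <= _ `^ X](subrK r q) [leRHS]powRD ?(gt_eqF D0) ?implybT//.
  rewrite ler_wpM2l ?powR_ge0//.
  rewrite ge0_ler_powR// ?nnegrE ?nrm_ge0 ?(ltW D0)//.
  exact: le_trans r1.
Qed.

End first_and_second_order_bounds.

(** * The trust-region run *)

Lemma increasing_seq_id_le (f : nat -> nat) n : increasing_seq f -> (n <= f n)%N.
Proof.
move=> hf; elim: n => // n ih; apply: leq_ltn_trans ih _.
have : (f n.+1 <= f n)%N = (n.+1 <= n)%N := hf n.+1 n.
by rewrite ltnn [in X in _ -> X]ltnNge => ->.
Qed.

Section trust_region_run.
Variables (R : realType) (d : nat) (Omega : set 'rV[R]_d) (oO : open Omega).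
Local Notation V := ('rV[R]_d -> R).
Local Notation mu := (lebesgue_on oO).
Hypothesis muT : (mu setT < +oo)%E.
Variables (q r ul uu alpha : R).
Hypotheses (q1 : 1 < q) (r1 : 1 <= r) (rq : q / 2 < r) (halpha : 0 < alpha).
Local Notation Uad := (Uad oO ul uu).
Local Notation nrm := (nrm mu).
Local Notation tv := (tv oO).
Variables (j : V -> R) (dj : V -> V -> R) (gradj : V -> V).
Hypothesis hdj : forall u, Uad u -> has_gradient oO q Uad j u (dj u).
Hypothesis hgradj : forall u, Uad u -> represents oO q (gradj u) (dj u).
Hypothesis hgradjL : lipschitz_gradient oO q Uad gradj.
Hypothesis hjb : exists m : R, forall u, Uad u -> m <= j u.
Variable (qm : V -> V -> R).
Variables (kappa : R) (hkappa : 1 <= kappa).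
Variables (Delta_res sigma gamma : R) (hDelta : 0 < Delta_res)
  (hsigma : 0 < sigma < 1) (hgamma : 0 < gamma < 1).
Variables (u0 : V) (hu0 : Uad u0) (u v : nat -> V) (Delta : nat -> R).
Hypothesis hrun : tr_run oO r ul uu alpha j qm Delta_res sigma gamma u0 u v Delta.
Variable eta : R.
Hypothesis eta01 : 0 < eta <= 1.
Hypothesis hsteps : forall k,
    [/\ BV oO (v k), Uad (v k) &
        (eta%:E * (tr_model oO ul uu alpha qm (u k) (u k) -
                   tr_inf oO r ul uu alpha qm (u k) (Delta k))
          <= tr_model oO ul uu alpha qm (u k) (u k)
             - tr_model oO ul uu alpha qm (u k) (v k))%E].
Hypothesis hmodel : forall k, model_assumption oO q ul uu j gradj kappa (u k) (qm (u k)).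

Let q1' : 1 <= q. Proof. exact: ltW. Qed.

Definition real_objective (w : V) : R := j w + alpha * tv w.
Local Notation J := real_objective.

Definition real_model (w w' : V) : R := qm w w' + alpha * tv w'.

Lemma objectiveE w : Uad w -> objective oO alpha j w = (J w)%:E.
Proof. by move=> [Bw _]; rewrite /objective (TVE Bw). Qed.

Lemma tr_modelE w w' : Uad w' -> tr_model oO ul uu alpha qm w w' = (real_model w w')%:E.
Proof.
move=> Uw; rewrite /tr_model /indicator_Uad asboolT// (TVE Uw.1).
by rewrite adde0.
Qed.

Lemma Uad_iterate k : Uad (u k) /\ 0 < Delta k.
Proof.
have [uE DE st] := hrun.
elim: k => [|k [Uk Dk]]; first by rewrite uE DE.
have [[Uv _] rej acc] := st k.
have [lt|ge] := ltP (tr_ratio oO ul uu alpha j qm (u k) (v k)) sigma%:E.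
  have [-> ->] := rej lt; split => //; rewrite mulr_gt0//.
  by case/andP : hgamma.
by have [-> ->] := acc ge.
Qed.

Let Uu k : Uad (u k). Proof. exact: (Uad_iterate k).1. Qed.
Let D0 k : 0 < Delta k. Proof. exact: (Uad_iterate k).2. Qed.
Let Uv k : Uad (v k). Proof. by have [] := hsteps k. Qed.

Definition predicted_reduction k : R := real_model (u k) (u k) - real_model (u k) (v k).
Local Notation pred := predicted_reduction.

(** Any competitor in the trust region bounds the infimum from above; this is the only way in which
    the quality of the approximate step enters. *)
Lemma predicted_reduction_ge k w : tr_feasible oO r ul uu (u k) (Delta k) w ->
  eta * (real_model (u k) (u k) - real_model (u k) w) <= pred k.
Proof.
move=> fw; have [_ _] := hsteps k.
rewrite !tr_modelE// => h; rewrite -lee_fin; apply: le_trans h.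
case/andP : eta01 => e0 _.
rewrite EFinM EFinB; apply: lee_wpmul2l; first by rewrite lee_fin ltW.
apply: leeB => //; apply: ereal_inf_lbound; exists w => //.
by rewrite (TVE fw.1.1).
Qed.

Lemma tr_feasible_self k : tr_feasible oO r ul uu (u k) (Delta k) (u k).
Proof.
split => //; rewrite subrr /Lnormp.
have -> : (EFin \o (0 : V)) = cst 0%E by [].
rewrite Lnorm0 ?lee_fin ?ltW//.
by rewrite eqe gt_eqF// (lt_le_trans ltr01).
Qed.

Lemma predicted_reduction_ge0 k : 0 <= pred k.
Proof. by have := predicted_reduction_ge (tr_feasible_self k); rewrite subrr mulr0. Qed.

(** When the predicted reduction is 0 the extended ratio is +oo, 0 or -oo according to the sign of
    the actual reduction. Acceptance then still excludes an increase, while a rejected step may have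
    both reductions zero, which the strict inequality does not cover: hence the extra
    alternative. *)
Lemma tr_step k :
  [/\ u k.+1 = u k, Delta k.+1 = gamma * Delta k &
      J (u k) - J (v k) < sigma * pred k \/ pred k = 0] \/
  [/\ u k.+1 = v k, Delta k.+1 = Delta_res &
      sigma * pred k <= J (u k) - J (v k)].
Proof.
have [_ _ /(_ k) [[_ _] rej acc]] := hrun.
have p0 := predicted_reduction_ge0 k.
have E : tr_ratio oO ul uu alpha j qm (u k) (v k) =
    ((J (u k) - J (v k))%:E / (pred k)%:E)%E.
  rewrite /tr_ratio !tr_modelE// (TVE (Uu k).1) (TVE (Uv k).1) -!EFinM -!EFinD.
  by congr (_%:E / _)%E; rewrite /real_objective; ring.
have [pk0|pkN0] := eqVneq (pred k) 0.
  have [lt|ge] := ltP (tr_ratio oO ul uu alpha j qm (u k) (v k)) sigma%:E.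
    by left; have [-> ->] := rej lt; split => //; right.
  right; have [-> ->] := acc ge; split => //; rewrite pk0 mulr0.
  move: ge; rewrite E pk0 inve0.
  have [//|neg] := leP 0 (J (u k) - J (v k)).
  by rewrite mulry ltr0_sg// mulN1e.
have pk : 0 < pred k by rewrite lt_def pkN0.
have E' : tr_ratio oO ul uu alpha j qm (u k) (v k) = ((J (u k) - J (v k)) / pred k)%:E.
  by rewrite E inver (negbTE pkN0) -EFinM.
have [lt|ge] := ltP (tr_ratio oO ul uu alpha j qm (u k) (v k)) sigma%:E.
  left; have [-> ->] := rej lt; split => //; left.
  by move: lt; rewrite E' lte_fin ltr_pdivrMr.
right; have [-> ->] := acc ge; split => //.
by move: ge; rewrite E' lee_fin ler_pdivlMr.
Qed.

Lemma objective_nonincreasing k l : (k <= l)%N -> J (u l) <= J (u k).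
Proof.
move=> /subnK <-; elim: (l - k)%N => [//|i ih].
rewrite addSn; apply: le_trans ih.
have [[-> _ _]//|[-> _ h]] := tr_step (i + k).
rewrite -subr_ge0; apply: le_trans h; rewrite mulr_ge0 ?predicted_reduction_ge0//.
by case/andP : hsigma => /ltW.
Qed.

Lemma objective_lower_bound : exists m, forall w, Uad w -> m <= J w.
Proof.
have [m Hm] := hjb; exists m => w Uw.
by rewrite ler_wpDr ?Hm// mulr_ge0 ?tv_ge0// ltW.
Qed.

(** Decrease from w to w' of the functional linearized in j only. That it is nonpositive for all
    feasible w' is the first order condition at w. *)
Definition linear_decrease w w' : R := alpha * tv w - alpha * tv w' - dj w (w' - w).

(** By convexity TV gains at least a proportional share along the segment, and the smooth part
    departs from its linearization by O(t^2), uniformly because feasible functions are at bounded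
    L^q distance. *)
Lemma model_decrease_segment : exists2 C, 0 < C & forall k w t, Uad w -> 0 <= t <= 1 ->
  t * linear_decrease (u k) w - C * t ^+ 2 <=
  real_model (u k) (u k) - real_model (u k) (u k + t *: (w - u k)).
Proof.
have [B B0 HB] := @nrm_bounded _ _ _ oO muT ul uu q q1'.
exists ((kappa - 1) * B ^+ 2 + 1).
  by rewrite ltr_wpDl// mulr_ge0 ?subr_ge0 ?exprn_ge0// ltW.
move=> k w t Uw t01; have [t0 t1] := andP t01.
have Ut := Uad_segment (Uu k) Uw t01.
have Lh : Lq oO q (w - u k) by exact: (UadB_Lq muT q1' (Uu k) Uw).
have [Eq T] := model_taylor muT q1 hgradj hkappa (Uu k) Ut (hmodel k).
have htv := tv_segment (Uu k) Uw t01.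
rewrite /real_model /linear_decrease Eq.
have Es : u k + t *: (w - u k) - u k = t *: (w - u k) by rewrite addrAC subrr add0r.
move: T; rewrite Es (dualZ q1' t (hdj (Uu k)).1 Lh) nrmZ//.
rewrite (ger0_norm t0) => T.
have N : (t * nrm q (w - u k)) ^+ 2 <= B ^+ 2 * t ^+ 2.
  rewrite exprMn mulrC ler_wpM2r ?exprn_ge0//.
  by rewrite ler_sqr ?nnegrE ?nrm_ge0 ?(ltW B0)//; exact: HB.
have K : (kappa - 1) * (t * nrm q (w - u k)) ^+ 2 <= (kappa - 1) * (B ^+ 2 * t ^+ 2).
  by rewrite ler_wpM2l// subr_ge0.
have := ler_norm (qm (u k) (u k + t *: (w - u k)) - j (u k) - t * dj (u k) (w - u k)).
have A : alpha * tv (u k + t *: (w - u k)) <=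
    alpha * ((1 - t) * tv (u k) + t * tv w) by rewrite ler_wpM2l// ltW.
have t2 : 0 <= t ^+ 2 by rewrite exprn_ge0.
by move: N K T A; rewrite !mulrDl mul1r; lra.
Qed.

(** Model and objective share their value and derivative at [u k] and their TV term, so the gap is a
    difference of two second order remainders, each bounded by the squared L^q length of the
    step. *)
Lemma model_objective_gap : exists C b, [/\ 0 <= C, 1 < b &
  forall k, `|(J (u k) - J (v k)) - pred k| <= C * Delta k `^ b].
Proof.
have [L L0 HL] := objective_taylor muT q1 hdj hgradj hgradjL.
have [C [b [C0 b1 HC]]] := @nrm_q_le_radius _ _ _ oO muT q ul uu q1 r r1 rq.
exists ((L + (kappa - 1)) * C), b; split => //.
  by rewrite mulr_ge0// addr_ge0// subr_ge0.
move=> k; have [Eq T] := model_taylor muT q1 hgradj hkappa (Uu k) (Uv k) (hmodel k).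
have T' := HL _ _ (Uu k) (Uv k).
have [_ _ /(_ k) [[_ rad] _ _]] := hrun.
have N := HC _ _ _ (Uu k) (Uv k) (D0 k).
move: rad; rewrite /Lnormp nrmE; last exact: (UadB_Lq muT r1 (Uu k) (Uv k)).
rewrite lee_fin => /N {}N.
have E : (J (u k) - J (v k)) - pred k =
   (qm (u k) (v k) - j (u k) - dj (u k) (v k - u k))
   - (j (v k) - j (u k) - dj (u k) (v k - u k)).
  by rewrite /predicted_reduction /real_objective /real_model Eq; ring.
rewrite E; apply: le_trans (ler_normB _ _) _.
apply: le_trans (lerD T T') _.
rewrite -mulrDl -mulrA [kappa - 1 + L]addrC ler_wpM2l//.
by rewrite addr_ge0// subr_ge0.
Qed.

(* Where a feasible direction of linearized decrease dl exists, the predicted reduction is at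
   least proportional to the radius, while it differs from the actual one by O(Delta^b) with
   1 < b: small radii are accepted. As every acceptance resets the radius to Delta_res, it
   stays bounded below at such iterates and each acceptance gains a fixed amount. *)
Lemma uniform_decrease w dl : Uad w -> 0 < dl -> exists2 k0, 0 < k0 &
  forall k, dl <= linear_decrease (u k) w -> exists k', J (u k') <= J (u k) - k0.
Proof.
move=> Uw dl0.
have [e0 _] := andP eta01; have [s0 s1] := andP hsigma; have [g0 g1] := andP hgamma.
have [C C0 HC] := model_decrease_segment.
have [K [b [K0 b1 HK]]] := model_objective_gap.
have [B B0 HB] := @nrm_bounded _ _ _ oO muT ul uu r r1.
(* Up to this fraction the quadratic loss C t^2 eats at most half of the linear gain t dl. *)
pose t0 := Num.min 1 (dl / (2 * C)).
have t00 : 0 < t0 by rewrite lt_min ltr01 divr_gt0// mulr_gt0.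
(* The competitor is u k + t (w - u k). Since |w - u k| <= B in L^r, the choice t <= D / B keeps it
   within radius D. D may be smaller than the current radius, which later allows one D for all such
   iterates. *)
have pred_ge k D : dl <= linear_decrease (u k) w -> 0 <= D <= Delta k ->
    eta * (dl / 2) * Num.min t0 (D / B) <= pred k.
  move=> good /andP[D0' DD]; set t := Num.min t0 (D / B).
  have tp : 0 <= t by rewrite le_min (ltW t00) divr_ge0 ?(ltW B0).
  have t1 : t <= 1 by rewrite /t /t0 !ge_min lexx.
  have tC : t * (2 * C) <= dl.
    by rewrite -ler_pdivlMr ?mulr_gt0// /t /t0 !ge_min lexx orbT.
  have tD : t * B <= D by rewrite -ler_pdivlMr// /t ge_min lexx orbT.
  have t01 : 0 <= t <= 1 by rewrite tp.
  have Ut := Uad_segment (Uu k) Uw t01.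
  have Lh : w - u k \in Lfun mu r%:E by exact: (UadB_Lq muT r1 (Uu k) Uw).
  have Es : u k + t *: (w - u k) - u k = t *: (w - u k) by rewrite addrAC subrr add0r.
  apply: (@le_trans _ _ (eta * (real_model (u k) (u k) - real_model (u k) (u k + t *: (w - u k))))).
    rewrite -mulrA ler_wpM2l ?(ltW e0)//; apply: le_trans (HC k w t Uw t01).
    have : t * dl <= t * linear_decrease (u k) w by rewrite ler_wpM2l.
    have : t * (t * (2 * C)) <= t * dl by rewrite ler_wpM2l.
    by rewrite expr2; lra.
  apply: predicted_reduction_ge; split => //.
  rewrite Es /Lnormp nrmE; last exact: LfunZ.
  rewrite nrmZ// ger0_norm// lee_fin; apply: le_trans DD; apply: le_trans tD.
  by rewrite ler_wpM2l//; exact: HB.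
pose c := (1 - sigma) * (eta * (dl / 2)) / B.
have c0 : 0 < c by rewrite divr_gt0// !mulr_gt0 ?subr_gt0// divr_gt0.
(* Below t0 B the minimum in [pred_ge] is D / B, so c D bounds (1 - sigma) times the predicted
   reduction from below; below the second term, K D^b <= c D. Together they force acceptance. K + 1
   guards against K = 0. *)
pose Db := Num.min (t0 * B) ((c / (K + 1)) `^ (b - 1)^-1).
have K1 : 0 < K + 1 by rewrite ltr_wpDl.
have Db0 : 0 < Db by rewrite lt_min mulr_gt0// powR_gt0// divr_gt0.
have rejected k : dl <= linear_decrease (u k) w -> u k.+1 = u k ->
    Delta k.+1 = gamma * Delta k ->
    J (u k) - J (v k) < sigma * pred k \/ pred k = 0 -> Db < Delta k.
  move=> good _ _; have [//|DDb] := ltP Db (Delta k).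
  have P := @pred_ge k (Delta k) good.
  have PD : eta * (dl / 2) * (Delta k / B) <= pred k.
    have := P; rewrite (ltW (D0 k)) lexx => /(_ isT).
    by rewrite min_r// ler_pdivrMr//; apply: le_trans DDb _; rewrite /Db ge_min lexx.
  have pk : 0 < pred k by apply: lt_le_trans PD; rewrite !mulr_gt0 ?invr_gt0.
  have Dpow : K * Delta k `^ b <= c * Delta k.
    have -> : Delta k `^ b = Delta k `^ (b - 1) * Delta k.
      have -> : Delta k `^ b = Delta k `^ (b - 1 + 1) by rewrite subrK.
      by rewrite powRD ?(gt_eqF (D0 k)) ?implybT// (powRr1 (ltW (D0 k))).
    rewrite mulrA ler_wpM2r ?(ltW (D0 k))//.
    have bb : 0 < b - 1 by rewrite subr_gt0.
    have : Delta k `^ (b - 1) <= c / (K + 1).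
      have -> : c / (K + 1) = ((c / (K + 1)) `^ (b - 1)^-1) `^ (b - 1).
        by rewrite -powRrM mulVf ?gt_eqF// powRr1// divr_ge0 ?(ltW c0) ?(ltW K1).
      rewrite ge0_ler_powR ?nnegrE ?powR_ge0 ?(ltW bb) ?(ltW (D0 k))//.
      by apply: le_trans DDb _; rewrite /Db ge_min lexx orbT.
    rewrite ler_pdivlMr// mulrDr mulr1 mulrC => h.
    by apply: le_trans h; rewrite lerDl powR_ge0.
  have H := HK k.
  have cD : c * Delta k <= (1 - sigma) * pred k.
    rewrite /c -!mulrA ler_wpM2l ?subr_ge0 ?(ltW s1)//.
    by rewrite [B^-1 * _]mulrC !mulrA; move: PD; rewrite !mulrA.
  have : sigma * pred k <= J (u k) - J (v k).
    have := ler_norm (- (J (u k) - J (v k) - pred k)); rewrite normrN.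
    by move: H Dpow cD; lra.
  by move=> h [|pk0]; [rewrite ltNge h|rewrite pk0 ltxx in pk].
(* A radius is either the reset value or gamma times a rejected radius. The rejection happened at
   the same iterate, so the rejected radius exceeded Db. *)
pose Dlow := Num.min Delta_res (gamma * Db).
have Dlow0 : 0 < Dlow by rewrite lt_min hDelta mulr_gt0.
have low k : dl <= linear_decrease (u k) w -> Dlow <= Delta k.
  case: k => [|k] good.
    by have [_ -> _] := hrun; rewrite /Dlow ge_min lexx.
  have [[E1 E2 E3]|[_ -> _]] := tr_step k; last by rewrite /Dlow ge_min lexx.
  rewrite E1 in good; have := rejected _ good E1 E2 E3.
  rewrite E2 => /ltW h; rewrite /Dlow ge_min; apply/orP; right.
  by rewrite ler_wpM2l// ltW.
exists (sigma * (eta * (dl / 2) * Num.min t0 (Dlow / B))).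
  by rewrite !mulr_gt0// ?divr_gt0// lt_min t00 divr_gt0.
move=> k good.
have [N HN] : exists N, gamma ^+ N * Delta k < Dlow.
  have gN : `|gamma| < 1 by rewrite ger0_norm// ltW.
  have /cvgrPdist_lt /(_ (Dlow / Delta k)) := cvg_expr gN.
  rewrite divr_gt0// => /(_ isT) [N _ HN]; exists N.
  have := HN N (leqnn N); rewrite /= sub0r normrN ger0_norm ?exprn_ge0 ?(ltW g0)//.
  by rewrite ltr_pdivlMr.
(* Rejections keep the iterate, and with it the lower bound Dlow, while the radius shrinks
   geometrically; so an acceptance must follow. *)
have [i [Ei [Ea _ Eb]]] : exists i, u (k + i)%N = u k /\
    [/\ u (k + i).+1 = v (k + i)%N, Delta (k + i).+1 = Delta_res &
      sigma * pred (k + i) <= J (u (k + i)%N) - J (v (k + i)%N)].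
  apply: contrapT => none.
  have all i : u (k + i)%N = u k /\ Delta (k + i)%N = gamma ^+ i * Delta k.
    elim: i => [|i [ih1 ih2]]; first by rewrite addn0 expr0 mul1r.
    have [[E1 E2 _]|acc] := tr_step (k + i); last by exfalso; apply: none; exists i.
    by rewrite addnS E1 E2 ih1 ih2 exprS mulrA.
  have [E1 E2] := all N; have := low (k + N)%N; rewrite E1 => /(_ good).
  by rewrite E2 leNgt HN.
exists (k + i).+1; rewrite Ea -Ei lerBrDl -lerBrDr.
have Dl := low (k + i)%N; rewrite Ei in Dl.
have P := @pred_ge (k + i)%N Dlow; rewrite Ei in P.
have := P good; rewrite (ltW Dlow0) Dl// => /(_ isT) PP.
rewrite Ei in Eb *; apply: le_trans _ Eb.
by rewrite ler_wpM2l// ltW.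
Qed.

(** Once an objective value is within k0 of the infimum of all values, no later iterate can be
    followed by a drop of k0. *)
Lemma linear_decrease_vanishes w dl : Uad w -> 0 < dl ->
  exists N, forall k, (N <= k)%N -> linear_decrease (u k) w < dl.
Proof.
move=> Uw dl0; have [k0 k00 Hk] := uniform_decrease Uw dl0.
have [m Hm] := objective_lower_bound.
pose A := [set J (u k) | k in [set: nat]].
have hA : has_inf A.
  by split; [exists (J (u 0%N)); exists 0%N|exists m => _ [k _ <-]; exact: Hm].
have [_ [N _ <-] HN] := @inf_adherent _ A k0 k00 hA.
exists N => k Nk; rewrite ltNge; apply/negP => /Hk [k' Hk'].
have : inf A <= J (u k') by apply: ge_inf; [case: hA|exists k'].
have := objective_nonincreasing Nk.
by move: Hk' HN; lra.
Qed.

Section cluster_point.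
Variables (w : V) (f : nat -> nat).
Hypothesis hf : increasing_seq f.
Hypothesis Uw : Uad w.
Hypothesis hcvg : (fun n => nrm q (u (f n) - w)) @ \oo --> (0 : R).

(** The vanishing linearized decrease at [u (f n)] is transported to w: the Lipschitz gradient
    replaces the functional, and its continuity at w replaces the argument. *)
Lemma linear_decrease_cluster x e : Uad x -> 0 < e ->
  \forall n \near \oo, alpha * tv (u (f n)) <= alpha * tv x + dj w (x - w) + e.
Proof.
move=> Ux e0.
have [L L0 HL] := gradient_lipschitz muT q1 hgradj hgradjL.
have [B B0 HB] := @nrm_bounded _ _ _ oO muT ul uu q q1'.
have [C C0 HC] := dual_bound (hdj Uw).1.
(* L B accounts for the change of functional, C for the change of argument, and 1 makes S
   positive. *)
pose S := L * B + C + 1.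
have S0 : 0 < S by rewrite ltr_wpDl// addr_ge0// mulr_ge0// ltW.
have e2 : 0 < e / 2 by rewrite divr_gt0.
have [N HN] := linear_decrease_vanishes Ux e2.
have e3 : 0 < e / 2 / S by rewrite divr_gt0.
near=> n.
have nN : (N <= f n)%N.
  by apply: leq_trans (increasing_seq_id_le n hf); near: n; exact: nbhs_infty_ge.
have small : nrm q (u (f n) - w) < e / 2 / S.
  near: n; move/cvgrPdist_lt : hcvg => /(_ _ e3); apply: filterS => n.
  by rewrite sub0r normrN ger0_norm// nrm_ge0.
have Lx : Lq oO q (x - w) by exact: (UadB_Lq muT q1' Uw Ux).
have Lxu : Lq oO q (x - u (f n)) by exact: (UadB_Lq muT q1' (Uu (f n)) Ux).
have Luw : Lq oO q (u (f n) - w) by exact: (UadB_Lq muT q1' Uw (Uu (f n))).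
have h1 := HL _ _ _ Uw (Uu (f n)) Lxu.
have h2 := HC _ Luw.
have h3 : dj w (x - w) = dj w (x - u (f n)) + dj w (u (f n) - w).
  by rewrite -(dualD (hdj Uw).1)// addrA subrK.
have h4 : L * nrm q (u (f n) - w) * nrm q (x - u (f n)) <= L * B * nrm q (u (f n) - w).
  rewrite mulrAC ler_wpM2r ?nrm_ge0// ler_wpM2l//; exact: HB.
have h5 : S * nrm q (u (f n) - w) < e / 2 by rewrite mulrC -ltr_pdivlMr.
have h6 := HN _ nN; rewrite /linear_decrease in h6.
have h7 := ler_norm (dj (u (f n)) (x - u (f n)) - dj w (x - u (f n))).
have h8 := ler_norm (- dj w (u (f n) - w)); rewrite normrN in h8.
have n0 := nrm_ge0 mu q (u (f n) - w).
by move: h5; rewrite /S !mulrDl mul1r; lra.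
Unshelve. all: by end_near. Qed.

Lemma limsup_tv_cluster e : 0 < e -> \forall n \near \oo, tv (u (f n)) <= tv w + e.
Proof.
move=> e0; have := linear_decrease_cluster Uw (mulr_gt0 halpha e0).
apply: filterS => n; rewrite subrr.
have Lu : Lq oO q (w - w) by exact: (UadB_Lq muT q1' Uw Uw).
have := dualZ q1' 0 (hdj Uw).1 Lu; rewrite mul0r scale0r => ->.
by rewrite addr0 -mulrDr ler_pM2l.
Qed.

Lemma cluster_variational (L1lsc : forall e, 0 < e -> \forall n \near \oo, tv w - e <= tv (u (f n))) x :
  Uad x -> alpha * tv w <= alpha * tv x + dj w (x - w).
Proof.
move=> Ux; apply/ler_addgt0Pr => e e0.
have e2 : 0 < e / 2 by rewrite divr_gt0.
have ea : 0 < e / 2 / alpha by rewrite divr_gt0.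
have [n [h1 h2]] := filter_ex (filterI (linear_decrease_cluster Ux e2) (L1lsc _ ea)).
have : alpha * tv w - e / 2 <= alpha * tv (u (f n)).
  have := ler_wpM2l (ltW halpha) h2.
  by rewrite mulrBr [alpha * (_ / _)]mulrC divfK ?gt_eqF.
by move: h1; lra.
Qed.

End cluster_point.

(** The choice v = w attains the value alpha TV(w), and for every other v the term in |v - w|^q is
    nonnegative. *)
Lemma stationary_of_variational w : Uad w ->
  (forall x, Uad x -> alpha * tv w <= alpha * tv x + dj w (x - w)) ->
  stationary oO q ul uu alpha gradj w.
Proof.
move=> Uw H; split => //; rewrite /criticality.
have q0 : 0 < q by exact: lt_trans q1.
suff -> : ereal_inf [set stat_model oO q alpha gradj w v | v in Uad] = (alpha%:E * TV oO w)%E.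
  by rewrite (TVE Uw.1) -EFinM subee.
apply/eqP; rewrite eq_le; apply/andP; split.
  apply: ereal_inf_lbound; exists w => //; rewrite /stat_model.
  under eq_Rintegral => x _ do rewrite subrr mulr0.
  rewrite Rintegral_cst//= mul0r subrr /Lnormp.
  have -> : (EFin \o (0 : V)) = cst 0%E by [].
  rewrite Lnorm0; last by rewrite eqe gt_eqF.
  by rewrite poweR0r ?gt_eqF// mule0 !add0e.
apply: le_ereal_inf_tmp => _ [x Ux <-]; rewrite /stat_model.
have Lx : Lq oO q (x - w) by exact: (UadB_Lq muT q1' Uw Ux).
have HI : alpha * tv w <= alpha * tv x + \int[mu]_y (gradj w y * (x y - w y)).
  by have := H _ Ux; rewrite (hgradj Uw).2.
rewrite (TVE Uw.1) (TVE Ux.1) /Lnormp nrmE// poweR_EFin -!EFinM -!EFinD lee_fin.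
have : 0 <= q^-1 * nrm q (x - w) `^ q by rewrite mulr_ge0 ?powR_ge0// invr_ge0 ltW.
by lra.
Qed.

End trust_region_run.

(** * Smooth tensor functions *)

Section C1_real_functions.
Variable R : realType.
Implicit Types (f g df dg : R -> R) (t : R).

(** The derivative is carried along explicitly, so that sums, products and affine substitutions
    produce formulas which are later compared with the wanted derivative. *)
Definition C1_pair f df := (forall t, is_derive t 1 f (df t)) /\ continuous df.

Lemma C1_pair_continuous f df : C1_pair f df -> continuous f.
Proof.
move=> [Hf _] t; apply: differentiable_continuous; apply/derivable1_diffP.
by case: (Hf t).
Qed.

Lemma C1_pair_affine f df (a b : R) : C1_pair f df ->
  C1_pair (fun t => f (a * t + b)) (fun t => a * df (a * t + b)).
Proof.
move=> [Hf cf]; split=> t; last first.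
  apply: cvgM; first exact: cvg_cst.
  apply: (@continuous_comp _ _ _ (fun t : R => a * t + b) df t); last exact: cf.
  by apply: cvgD; [apply: cvgM; [exact: cvg_cst|exact: cvg_id]|exact: cvg_cst].
rewrite mulrC; apply: is_derive1_comp.
have : is_derive t 1 ((fun=> a) * id + (fun=> b)) (a *: 1 + t *: 0 + 0).
  by apply: is_deriveD; apply: is_deriveM.
rewrite scaler0 !addr0 /GRing.scale/= mulr1.
exact.
Qed.

Lemma C1_pairD f g df dg : C1_pair f df -> C1_pair g dg ->
  C1_pair (fun t => f t + g t) (fun t => df t + dg t).
Proof.
move=> [Hf cf] [Hg cg]; split=> t; first exact: is_deriveD.
by apply: cvgD; [exact: cf|exact: cg].
Qed.

Lemma C1_pairM f g df dg : C1_pair f df -> C1_pair g dg ->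
  C1_pair (fun t => f t * g t) (fun t => f t * dg t + g t * df t).
Proof.
move=> Hf Hg; have cf := C1_pair_continuous Hf; have cg := C1_pair_continuous Hg.
case: Hf => [Hf cdf]; case: Hg => [Hg cdg]; split=> t; first exact: is_deriveM.
by apply: cvgD; apply: cvgM; [exact: cf|exact: cdg|exact: cg|exact: cdf].
Qed.

Lemma C1_pair_cst (a : R) : C1_pair (fun=> a) (fun=> 0).
Proof. by split=> t; [exact: is_derive_cst|exact: cvg_cst]. Qed.

Lemma C1_pairZ f df (a : R) : C1_pair f df ->
  C1_pair (fun t => a * f t) (fun t => a * df t).
Proof.
move=> Hf; have := C1_pairM (C1_pair_cst a) Hf.
by congr C1_pair; apply/funext => t; rewrite mulr0 addr0.
Qed.

Definition pospart t := Num.max t 0.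

Definition sqpos t := pospart t ^+ 2.

Lemma C1_pair_sqpos : C1_pair sqpos (fun t => 2 * pospart t).
Proof.
split=> t; last first.
  apply: cvgM; first exact: cvg_cst.
  by apply: continuous_max; [exact: cvg_id|exact: cvg_cst].
apply: is_derive_eps => e e0; exists e => // h he.
apply: (@le_trans _ _ (h ^+ 2)); last first.
  by rewrite -real_normK ?num_real// expr2 ler_wpM2r// ltW.
rewrite /sqpos /pospart ler_norml.
by case: (leP t 0) => t0; case: (leP (t + h) 0) => th; apply/andP; split; nra.
Qed.

Definition smoothstep t := 2 * sqpos t - 4 * sqpos (t - 2^-1) + 2 * sqpos (t - 1).

Lemma C1_smoothstep : exists df, C1_pair smoothstep df.
Proof.
have aff (a b : R) := C1_pair_affine a b C1_pair_sqpos.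
eexists; have := C1_pairD (C1_pairD (C1_pairZ 2 (aff 1 0)) (C1_pairZ (-4) (aff 1 (-2^-1))))
  (C1_pairZ 2 (aff 1 (-1))).
rewrite [X in C1_pair X _](_ : _ = smoothstep)=> [H|]; first exact: H.
by apply/funext => t; rewrite /smoothstep mul1r addr0 mulNr.
Qed.

Lemma smoothstep_le0 t : t <= 0 -> smoothstep t = 0.
Proof.
move=> t0; rewrite /smoothstep /sqpos /pospart !max_r//; last 2 first.
- by lra.
- by lra.
by rewrite expr0n/=; ring.
Qed.

Lemma smoothstep_ge1 t : 1 <= t -> smoothstep t = 1.
Proof.
move=> t1; rewrite /smoothstep /sqpos /pospart !max_l; [by field|lra..].
Qed.

Lemma smoothstep01 t : 0 <= smoothstep t <= 1.
Proof.
have [t0|t0] := leP t 0; first by rewrite smoothstep_le0// lexx ler01.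
have [t1|t1] := leP 1 t; first by rewrite smoothstep_ge1// lexx ler01.
rewrite /smoothstep /sqpos /pospart (max_l (ltW t0)) (@max_r _ _ (t - 1)); last by lra.
by case: (leP (t - 2^-1) 0) => th; apply/andP; split; nra.
Qed.

(** A C^1 function that vanishes off (0, 1) and tends pointwise to the indicator of (0, 1). *)
Definition bump (n : nat) t := smoothstep (n%:R * t) * smoothstep (n%:R * (1 - t)).

Lemma C1_bump n : exists df, C1_pair (bump n) df.
Proof.
have [ds Hs] := C1_smoothstep.
eexists; have := C1_pairM (C1_pair_affine n%:R 0 Hs) (C1_pair_affine (- n%:R) n%:R Hs).
rewrite [X in C1_pair X _](_ : _ = bump n)=> [H|]; first exact: H.
by apply/funext => t; rewrite /bump addr0 mulrBr mulr1 mulNr [- _ + _]addrC.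
Qed.

Lemma bump01 n t : 0 <= bump n t <= 1.
Proof.
have /andP[a0 a1] := smoothstep01 (n%:R * t).
have /andP[b0 b1] := smoothstep01 (n%:R * (1 - t)).
by rewrite mulr_ge0//= mulr_ile1.
Qed.

Lemma bump_out n t : ~~ (0 < t < 1) -> bump n t = 0.
Proof.
rewrite negb_and -!leNgt => /orP[t0|t1]; rewrite /bump.
  by rewrite smoothstep_le0 ?mul0r// mulr_ge0_le0.
by rewrite [X in _ * X]smoothstep_le0 ?mulr0// mulr_ge0_le0// subr_le0.
Qed.

Lemma nat_ge_near (a : R) : \forall n \near \oo, a <= n%:R.
Proof. exact: nbhs_infty_ger. Qed.

Lemma bump_in t : 0 < t < 1 -> \forall n \near \oo, bump n t = 1.
Proof.
move=> /andP[t0 t1]; have t1' : 0 < 1 - t by rewrite subr_gt0.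
near=> n; rewrite /bump !smoothstep_ge1 ?mulr1//.
  rewrite -ler_pdivrMr//; near: n; exact: nat_ge_near.
rewrite -ler_pdivrMr//; near: n; exact: nat_ge_near.
Unshelve. all: by end_near. Qed.

Definition clamp t := pospart t - pospart (t - 1).

Definition clamp_prim t := 2^-1 * sqpos t - 2^-1 * sqpos (t - 1).

Lemma C1_clamp_prim : C1_pair clamp_prim clamp.
Proof.
have aff (a b : R) := C1_pair_affine a b C1_pair_sqpos.
have := C1_pairD (C1_pairZ 2^-1 (aff 1 0)) (C1_pairZ (-2^-1) (aff 1 (-1))).
rewrite [X in C1_pair X _](_ : _ = clamp_prim); last first.
  by apply/funext => t; rewrite /clamp_prim mul1r addr0 mulNr.
congr C1_pair; apply/funext => t; rewrite /clamp !mul1r !addr0.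
by field.
Qed.

Lemma clamp_prim_lipschitz x y : x <= y ->
  0 <= clamp_prim y - clamp_prim x <= y - x.
Proof.
move=> xy; rewrite /clamp_prim /sqpos /pospart.
by case: (leP x 0) => ?; case: (leP y 0) => ?; case: (leP (x - 1) 0) => ?;
  case: (leP (y - 1) 0) => ?; apply/andP; split; nra.
Qed.

Lemma clamp_le0 t : t <= 0 -> clamp t = 0.
Proof. by move=> t0; rewrite /clamp /pospart !max_r ?subrr//; lra. Qed.

Lemma clamp_ge1 t : 1 <= t -> clamp t = 1.
Proof. by move=> t0; rewrite /clamp /pospart !max_l; lra. Qed.

Lemma clamp_mono x y : x <= y -> 0 <= clamp y - clamp x <= 1.
Proof.
move=> xy; rewrite /clamp /pospart.
by case: (leP x 0) => ?; case: (leP y 0) => ?; case: (leP (x - 1) 0) => ?;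
  case: (leP (y - 1) 0) => ?; apply/andP; split; lra.
Qed.

Lemma clamp_prim_le0 t : t <= 0 -> clamp_prim t = 0.
Proof.
move=> t0; rewrite /clamp_prim /sqpos /pospart !max_r ?expr0n/= ?mulr0 ?subrr//.
by lra.
Qed.

Lemma clamp_prim_ge1 t : 1 <= t -> clamp_prim t = t - 2^-1.
Proof. by move=> t0; rewrite /clamp_prim /sqpos /pospart !max_l; [field|lra|lra]. Qed.

(** For 2 <= n it rises from 0 to 1 on [0, 1/n] and falls back on [1 - 1/n, 1]: a continuous
    substitute for the indicator of (0, 1), whose primitive is therefore C^1. *)
Definition trapezoid n t := clamp (n%:R * t) - clamp (n%:R * t - (n%:R - 1)).

Definition trapezoid_prim n t :=
  n%:R^-1 * (clamp_prim (n%:R * t) - clamp_prim (n%:R * t - (n%:R - 1))).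

Lemma C1_trapezoid_prim n : C1_pair (trapezoid_prim n.+1) (trapezoid n.+1).
Proof.
have aff (a b : R) := C1_pair_affine a b C1_clamp_prim.
have := C1_pairZ n.+1%:R^-1 (C1_pairD (aff n.+1%:R 0)
   (C1_pairZ (-1) (aff n.+1%:R (- (n.+1%:R - 1))))).
rewrite [X in C1_pair X _](_ : _ = trapezoid_prim n.+1); last first.
  by apply/funext => t; rewrite /trapezoid_prim addr0 mulN1r.
congr C1_pair; apply/funext => t; rewrite /trapezoid addr0.
have : n.+1%:R != 0 :> R by rewrite pnatr_eq0.
by move: (n.+1%:R : R) => N N0; field.
Qed.

Lemma trapezoid01 n t : 0 <= trapezoid n.+1 t <= 1.
Proof. by apply: clamp_mono; rewrite gerBl subr_ge0 ler1n. Qed.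

Lemma trapezoid_out n t : ~~ (0 < t < 1) -> trapezoid n.+1 t = 0.
Proof.
have n1 : 1 <= n.+1%:R :> R by rewrite ler1n.
rewrite negb_and -!leNgt => /orP[t0|t1]; rewrite /trapezoid.
  have nt : n.+1%:R * t <= 0 by rewrite mulr_ge0_le0.
  by rewrite !clamp_le0 ?subrr//; lra.
have nt : n.+1%:R * 1 <= n.+1%:R * t by rewrite ler_wpM2l.
by rewrite !clamp_ge1 ?subrr//; lra.
Qed.

Lemma trapezoid_in t : 0 < t < 1 -> \forall n \near \oo, trapezoid n.+1 t = 1.
Proof.
move=> /andP[t0 t1]; have t1' : 0 < 1 - t by rewrite subr_gt0.
near=> n.
have h1 : 1 <= n.+1%:R * t.
  rewrite -ler_pdivrMr//; apply: (@le_trans _ _ n%:R); last by rewrite ler_nat.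
  near: n; exact: nat_ge_near.
have h2 : 1 <= n.+1%:R * (1 - t).
  rewrite -ler_pdivrMr//; apply: (@le_trans _ _ n%:R); last by rewrite ler_nat.
  near: n; exact: nat_ge_near.
by rewrite /trapezoid clamp_ge1// clamp_le0 ?subr0//; lra.
Unshelve. all: by end_near. Qed.

Lemma trapezoid_prim_le0 n t : t <= 0 -> trapezoid_prim n.+1 t = 0.
Proof.
have n1 : 1 <= n.+1%:R :> R by rewrite ler1n.
move=> t0; have nt : n.+1%:R * t <= 0 by rewrite mulr_ge0_le0.
by rewrite /trapezoid_prim !clamp_prim_le0 ?subrr ?mulr0//; lra.
Qed.

Lemma trapezoid_prim_ge1 n t : 1 <= t ->
  trapezoid_prim n.+1 t = n.+1%:R^-1 * (n.+1%:R - 1).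
Proof.
have n1 : 1 <= n.+1%:R :> R by rewrite ler1n.
move=> t1; have nt : n.+1%:R * 1 <= n.+1%:R * t by rewrite ler_wpM2l.
by rewrite /trapezoid_prim !clamp_prim_ge1; [congr (_ * _); ring|lra|lra].
Qed.

Lemma trapezoid_prim01 n t : 0 <= trapezoid_prim n.+1 t <= 1.
Proof.
have n1 : 1 <= n.+1%:R :> R by rewrite ler1n.
have n0 : 0 < n.+1%:R :> R by rewrite ltr0n.
have [|h1 h2] := andP (@clamp_prim_lipschitz (n.+1%:R * t - (n.+1%:R - 1)) (n.+1%:R * t) _).
  by rewrite gerBl subr_ge0.
rewrite /trapezoid_prim mulr_ge0 ?invr_ge0 ?(ltW n0)//= ler_pdivrMl// mulr1.
by apply: le_trans h2 _; lra.
Qed.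

(** The primitive of [haar], which tends to 1 on (0, 1/2) and to -1 on (1/2, 1). The two halves have
    equal mass, so the primitive returns to 0 at 1 and is supported in the unit interval. *)
Definition hat n t := 2^-1 * (trapezoid_prim n.+1 (2 * t) - trapezoid_prim n.+1 (2 * t - 1)).

Definition haar n t := trapezoid n.+1 (2 * t) - trapezoid n.+1 (2 * t - 1).

Lemma C1_hat n : C1_pair (hat n) (haar n).
Proof.
have aff (a b : R) := C1_pair_affine a b (C1_trapezoid_prim n).
have := C1_pairZ 2^-1 (C1_pairD (aff 2 0) (C1_pairZ (-1) (aff 2 (-1)))).
rewrite [X in C1_pair X _](_ : _ = hat n); last first.
  by apply/funext => t; rewrite /hat addr0 mulN1r.
by congr C1_pair; apply/funext => t; rewrite /haar addr0; field.
Qed.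

Lemma hat_out n t : ~~ (0 < t < 1) -> hat n t = 0.
Proof.
rewrite negb_and -!leNgt => /orP[t0|t1]; rewrite /hat.
  by rewrite !trapezoid_prim_le0 ?subrr ?mulr0//; lra.
by rewrite !trapezoid_prim_ge1 ?subrr ?mulr0//; lra.
Qed.

Lemma haar_out n t : ~~ (0 < t < 1) -> haar n t = 0.
Proof.
rewrite negb_and -!leNgt => h; rewrite /haar !trapezoid_out ?subrr//.
  by rewrite negb_and -!leNgt; apply/orP; case/orP : h => h; [left|right]; lra.
by rewrite negb_and -!leNgt; apply/orP; case/orP : h => h; [left|right]; lra.
Qed.

Lemma hat_bound n t : `|hat n t| <= 2^-1.
Proof.
have /andP[? ?] := trapezoid_prim01 n (2 * t).
have /andP[? ?] := trapezoid_prim01 n (2 * t - 1).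
by rewrite /hat ler_norml; apply/andP; split; lra.
Qed.

Lemma haar_bound n t : `|haar n t| <= 1.
Proof.
have /andP[? ?] := trapezoid01 n (2 * t).
have /andP[? ?] := trapezoid01 n (2 * t - 1).
by rewrite /haar ler_norml; apply/andP; split; lra.
Qed.

Lemma haar_left t : 0 < t < 2^-1 -> \forall n \near \oo, haar n t = 1.
Proof.
move=> /andP[t0 t1]; have h : 0 < 2 * t < 1 by apply/andP; split; lra.
apply: filterS (trapezoid_in h) => n; rewrite /haar => ->.
by rewrite trapezoid_out ?subr0// negb_and -!leNgt; apply/orP; left; lra.
Qed.

Lemma haar_right t : 2^-1 < t < 1 -> \forall n \near \oo, haar n t = -1.
Proof.
move=> /andP[t0 t1]; have h : 0 < 2 * t - 1 < 1 by apply/andP; split; lra.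
apply: filterS (trapezoid_in h) => n; rewrite /haar => ->.
by rewrite trapezoid_out ?sub0r// negb_and -!leNgt; apply/orP; right; lra.
Qed.

End C1_real_functions.

Section C1_tensors.
Variables (R : realType) (n : nat).
Local Notation V := ('rV[R]_n -> R).

Definition tensor (f : 'I_n -> R -> R) : V := fun x => \prod_i f i (x ord0 i).

Lemma continuous_big_prod (T : topologicalType) I (s : seq I) (P : pred I) (g : I -> T -> R) :
  (forall i, continuous (g i)) -> continuous (fun x => \prod_(i <- s | P i) g i x).
Proof.
move=> cg; elim: s => [|i s ih] x.
  by under eq_fun do rewrite big_nil; exact: cvg_cst.
under eq_fun do rewrite big_cons.
by case: (P i); [apply: cvgM; [exact: cg|exact: ih]|exact: ih].
Qed.

Lemma continuous_big_sum (T : topologicalType) I (s : seq I) (P : pred I) (g : I -> T -> R) :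
  (forall i, continuous (g i)) -> continuous (fun x => \sum_(i <- s | P i) g i x).
Proof.
move=> cg; elim: s => [|i s ih] x.
  by under eq_fun do rewrite big_nil; exact: cvg_cst.
under eq_fun do rewrite big_cons.
by case: (P i); [apply: cvgD; [exact: cg|exact: ih]|exact: ih].
Qed.

Lemma continuous_coord (i : 'I_n) (f : R -> R) : continuous f ->
  continuous (fun x : 'rV[R]_n => f (x ord0 i)).
Proof.
by move=> cf x; apply: (continuous_comp _ (cf _)); exact: coord_continuous.
Qed.

Lemma is_derive_tensor (f df : 'I_n -> R -> R) k x :
  (forall i, C1_pair (f i) (df i)) ->
  is_derive x (delta_mx ord0 k : 'rV[R]_n) (tensor f)
    (df k (x ord0 k) * \prod_(i | i != k) f i (x ord0 i)).
Proof.
move=> Hf; set P := \prod_(i | i != k) _.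
have C : h^-1 *: ((tensor f \o shift x) (h *: (delta_mx ord0 k : 'rV[R]_n)) - tensor f x)
    @[h --> 0^'] --> df k (x ord0 k) * P.
  have [D <-] := (Hf k).1 (x ord0 k).
  have -> : (fun h => h^-1 *: ((tensor f \o shift x) (h *: (delta_mx ord0 k : 'rV[R]_n)) - tensor f x))
    = (fun h => h^-1 *: ((f k \o shift (x ord0 k)) (h *: (1 : R)) - f k (x ord0 k)) * P).
    apply/funext => h; rewrite /tensor /= /shift/= (bigD1 k)//= [in X in _ - X](bigD1 k)//=.
    rewrite !mxE !eqxx/= /GRing.scale/= !mulr1.
    under eq_bigr => i ik do rewrite !mxE (negbTE ik) andbF mulr0 add0r.
    by rewrite -mulrBl mulrA.
  by apply: cvgM; [exact: D|exact: cvg_cst].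
by apply: DeriveDef; [apply/cvg_ex; eexists; exact: C|apply/cvg_lim].
Qed.

Lemma tensor_C1 (f df : 'I_n -> R -> R) : (forall i, C1_pair (f i) (df i)) ->
  C1 (tensor f) /\ forall k x, pderiv k (tensor f) x =
    df k (x ord0 k) * \prod_(i | i != k) f i (x ord0 i).
Proof.
move=> Hf.
have cf i : continuous (fun x : 'rV[R]_n => f i (x ord0 i)).
  by apply: continuous_coord; exact: C1_pair_continuous (Hf i).
have E k x : pderiv k (tensor f) x =
    df k (x ord0 k) * \prod_(i | i != k) f i (x ord0 i).
  by rewrite /pderiv; have [_ ->] := is_derive_tensor k x Hf.
split => //; split; first exact: continuous_big_prod.
move=> k; split; first by move=> x; have [] := is_derive_tensor k x Hf.
rewrite (_ : pderiv k (tensor f) = fun x => df k (x ord0 k) * \prod_(i | i != k) f i (x ord0 i)).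
  have cdk : continuous (fun x : 'rV[R]_n => df k (x ord0 k)).
    by apply: continuous_coord; case: (Hf k).
  have cP : continuous (fun x : 'rV[R]_n => \prod_(i | i != k) f i (x ord0 i)).
    exact: continuous_big_prod.
  by move=> x; exact: (cvgM (cdk x) (cP x)).
by apply/funext => x; rewrite E.
Qed.

Lemma C1_sum I (s : seq I) (c : I -> R) (g : I -> V) : (forall i, C1 (g i)) ->
  C1 (fun x => \sum_(i <- s) c i * g i x) /\
  forall k x, pderiv k (fun x => \sum_(i <- s) c i * g i x) x =
    \sum_(i <- s) c i * pderiv k (g i) x.
Proof.
move=> Hg.
have D k x : is_derive x (delta_mx ord0 k : 'rV[R]_n) (fun x => \sum_(i <- s) c i * g i x)
    (\sum_(i <- s) c i * pderiv k (g i) x).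
  elim: s => [|i s ih].
    under eq_fun do rewrite big_nil; rewrite big_nil; exact: is_derive_cst.
  under eq_fun do rewrite big_cons; rewrite big_cons.
  apply: is_deriveD.
  have := is_deriveZ (c i) (derivableP (((Hg i).2 k).1 x)).
  exact.
have E k x : pderiv k (fun x => \sum_(i <- s) c i * g i x) x =
    \sum_(i <- s) c i * pderiv k (g i) x.
  by have [_] := D k x.
split => //; split.
  apply: continuous_big_sum => i x.
  by apply: continuousM; [exact: cst_continuous|exact: (Hg i).1].
move=> k; split; first by move=> x; have [] := D k x.
rewrite (_ : pderiv k _ = fun x => \sum_(i <- s) c i * pderiv k (g i) x).
  apply: continuous_big_sum => i x.
  by apply: continuousM; [exact: cst_continuous|exact: ((Hg i).2 k).2].
by apply/funext => x; rewrite E.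
Qed.

End C1_tensors.

(** * Dyadic cells *)

Section bounded_domain_measure.
Variables (R : realType) (d : nat) (Omega : set 'rV[R]_d) (oO : open Omega).
Local Notation V := ('rV[R]_d -> R).
Local Notation mu := (lebesgue_on oO).

Lemma norm_coord_le (x : 'rV[R]_d) i : `|x ord0 i| <= `|x|.
Proof.
by rewrite {2}/Num.norm/= mx_normrE (le_trans _ (le_bigmax _ _ (ord0, i))).
Qed.

(** An integral side bounds the dyadic indices by an integer, and strict inequalities make the
    rescaled coordinates of points of Omega positive, where truncation is the floor. *)
Lemma bounded_set_in_cube : bounded_set Omega -> exists (o : R) (L : nat),
  forall x, Omega x -> forall i, o < x ord0 i < o + L%:R.
Proof.
move=> [N [_ HN]]; exists (- (N + 1) - 1), (Num.truncn (2 * (N + 1) + 2)).+1 => x Ox i.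
have xN : `|x ord0 i| <= N + 1.
  by apply: le_trans (norm_coord_le _ _) _; apply: (HN (N + 1)); rewrite ?ltrDl.
have := truncnS_gt (2 * (N + 1) + 2).
by move: xN; rewrite ler_norml => /andP[? ?] ?; apply/andP; split; lra.
Qed.

Lemma measurable_box (a b : 'rV[R]_d) :
  measurable [set x : 'rV[R]_d | forall i, a ord0 i <= x ord0 i <= b ord0 i].
Proof.
rewrite (_ : mkset _ = \bigcap_(i in [set: 'I_d])
    ((fun x : 'rV[R]_d => x ord0 i : measurableTypeR R) @^-1`
       `[a ord0 i, b ord0 i]%classic)); last first.
  by apply/seteqP; split => x /= H i => [_|]; [rewrite /= in_itv; exact: H|
    have := H i I; rewrite /= in_itv].
apply: fin_bigcap_measurable => // i _; rewrite -[X in measurable X]setTI.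
exact: measurable_coord.
Qed.

Variables (o : R) (L : nat).
Hypothesis HO : forall x, Omega x -> forall i, o < x ord0 i < o + L%:R.

Lemma lebesgue_on_finite : (mu setT < +oo)%E.
Proof.
pose a : 'rV[R]_d := const_mx o; pose b : 'rV[R]_d := const_mx (o + L%:R).
have sub : [set: 'rV[R]_d] `&` Omega `<=` [set x | forall i, a ord0 i <= x ord0 i <= b ord0 i].
  by move=> x [_ Ox] i; rewrite !mxE; have /andP[? ?] := HO Ox i; rewrite !ltW.
apply: (@le_lt_trans _ _ (lebesgue_rV R d [set x | forall i, a ord0 i <= x ord0 i <= b ord0 i])).
  apply: le_measure => //; rewrite inE; last exact: measurable_box.
  by rewrite setTI; exact: open_measurable_rV.
rewrite lebesgue_rV_box ?ltry// => i.
by rewrite !mxE lerDl.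
Qed.

(** Inside the cube the hyperplane is a box with one side of length 0. *)
Lemma hyperplane_null i (t : R) : mu [set x : 'rV[R]_d | x ord0 i = t] = 0%E.
Proof.
pose a : 'rV[R]_d := \row_j (if j == i then t else o).
pose b : 'rV[R]_d := \row_j (if j == i then t else o + L%:R).
have sub : [set x : 'rV[R]_d | x ord0 i = t] `&` Omega `<=`
    [set x | forall i, a ord0 i <= x ord0 i <= b ord0 i].
  move=> x [/= xt Ox] j; rewrite !mxE; have [->|_] := eqVneq j i.
    by rewrite xt lexx.
  by have /andP[? ?] := HO Ox j; rewrite !ltW.
have mH : measurable [set x : 'rV[R]_d | x ord0 i = t].
  rewrite -[X in measurable X]setTI.
  exact: (measurable_coord i measurableT (measurable_set1 t)).
apply/eqP; rewrite eq_le measure_ge0 andbT.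
apply: (@le_trans _ _ (lebesgue_rV R d [set x | forall i, a ord0 i <= x ord0 i <= b ord0 i])).
  apply: le_measure => //; rewrite inE; last exact: measurable_box.
  by apply: measurableI => //; exact: open_measurable_rV.
rewrite lebesgue_rV_box.
  by rewrite (bigD1 i)//= !mxE eqxx subrr mul0r.
by move=> j; rewrite !mxE; case: ifP => // _; rewrite lerDl.
Qed.

Lemma ae_in_domain : {ae mu, forall x, Omega x}.
Proof.
exists (~` Omega); split.
- by apply: measurableC; exact: open_measurable_rV.
- rewrite -[LHS]/(lebesgue_rV R d (~` Omega `&` Omega)).
  by rewrite setICl measure0.
- by [].
Qed.

Lemma box_compact n (a b : 'I_n -> R) : (0 < n)%N ->
  compact [set x : 'rV[R]_n | forall i, a i <= x ord0 i <= b i].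
Proof.
case: n a b => // n a b _.
have := @rV_compact R n.+1 (fun i => `[a i, b i]%classic) (fun i => @segment_compact _ _ _).
by congr compact; apply/seteqP; split => x /= H i; have := H i; rewrite in_itv.
Qed.

End bounded_domain_measure.

Section test_function_pairing.
Variables (R : realType) (d : nat) (Omega : set 'rV[R]_d) (oO : open Omega).
Local Notation V := ('rV[R]_d -> R).
Local Notation mu := (lebesgue_on oO).

Lemma test_functionZ (a : R) (psi : V) : test_function Omega psi ->
  test_function Omega (fun x => a * psi x).
Proof.
move=> [C [K [cK KO K0]]]; split; last by exists K; split => // x /K0 ->; rewrite mulr0.
have [] := C1_sum [:: tt] (fun=> a) (fun=> C).
by under eq_fun do rewrite big_seq1.
Qed.

(** A support inside Omega is asked only where the coefficient is nonzero: sums run over a full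
    grid, and the cells that leave Omega get coefficient 0. *)
Lemma test_function_sum I (s : seq I) (c : I -> R) (g : I -> V) :
  (forall i, c i != 0 -> test_function Omega (g i)) -> (forall i, C1 (g i)) ->
  test_function Omega (fun x => \sum_(i <- s) c i * g i x).
Proof.
move=> Hg Cg; split; first exact: (C1_sum s c Cg).1.
elim: s => [|i s [K [cK KO K0]]].
  by exists set0; split => //; [exact: compact0|move=> x _; rewrite big_nil].
have [ci0|ci0] := eqVneq (c i) 0.
  by exists K; split => // x /K0 h; rewrite big_cons ci0 mul0r add0r.
have [_ [K' [cK' KO' K0']]] := Hg i ci0.
exists (K' `|` K); split.
- exact: compactU.
- by move=> x [/KO'|/KO].
- by move=> x /not_orP[h1 h2]; rewrite big_cons K0'// K0// mulr0 addr0.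
Qed.

(** The field whose only nonzero component is psi / B, in direction i, is admissible in the
    definition of TV. *)
Lemma test_function_pairing (u psi : V) i (B : R) : BV oO u -> test_function Omega psi ->
  0 < B -> (forall x, `|psi x| <= B) ->
  `|\int[mu]_x (u x * pderiv i psi x)| <= B * tv oO u.
Proof.
move=> Bu Tpsi B0 HB.
pose phi : 'I_d -> V := fun j => if j == i then (fun x => B^-1 * psi x) else (fun=> 0).
have [Cpsi [K [cK KO K0]]] := Tpsi.
have T0 : test_function Omega (fun=> 0).
  have := test_functionZ 0 Tpsi; congr test_function.
  by apply/funext => x; rewrite mul0r.
have Hphi : unit_test_field Omega phi.
  split.
    by move=> j; rewrite /phi; case: ifP => _; [exact: test_functionZ|exact: T0].
  move=> x; rewrite (bigD1 i)//= big1 ?addr0; last first.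
    by move=> j ji; rewrite /phi (negbTE ji) expr0n.
  rewrite /phi eqxx -real_normK ?num_real// exprn_ile1// normrM.
  by rewrite (@ger0_norm _ B^-1) ?invr_ge0 ?(ltW B0)// mulrC ler_pdivrMr// mul1r.
have E x : divergence phi x = B^-1 * pderiv i psi x.
  rewrite /divergence (bigD1 i)//= big1 ?addr0.
    rewrite /phi eqxx /pderiv; have [_] := is_deriveZ B^-1 (derivableP ((Cpsi.2 i).1 x)).
    exact.
  by move=> j ji; rewrite /phi (negbTE ji) /pderiv derive_cst.
have := norm_pairing_le_tv Bu Hphi.
have ip := integrable_pairing Bu.1 Hphi.
have -> : \int[mu]_x (u x * pderiv i psi x) = B * \int[mu]_x (u x * divergence phi x).
  rewrite -RintegralZl//; apply: eq_Rintegral => x _.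
  by rewrite E mulrCA mulVKf// gt_eqF.
by rewrite normrM (gtr0_norm B0) => h; rewrite ler_wpM2l// ltW.
Qed.

End test_function_pairing.

Section dyadic_cells.
Variables (R : realType) (d : nat) (Omega : set 'rV[R]_d) (oO : open Omega).
Hypothesis d0 : (0 < d)%N.
Local Notation V := ('rV[R]_d -> R).
Local Notation mu := (lebesgue_on oO).
Local Notation index := {ffun 'I_d -> nat}.
Variables (o : R) (L : nat).
Hypothesis HO : forall x, Omega x -> forall i, o < x ord0 i < o + L%:R.
Implicit Types (k : 'I_d -> nat) (z : index) (c : index -> R) (x : 'rV[R]_d).

(** The dyadic level [k j] depends on the direction j, because coarsening will halve one direction
    at a time. *)
Definition scaled k x j : R := 2 ^+ k j * (x ord0 j - o).

Definition cell_index k x : index := [ffun j => Num.truncn (scaled k x j)].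

Definition closed_cell k z : set 'rV[R]_d :=
  [set x | forall j, (z j)%:R <= scaled k x j <= (z j).+1%:R].

Lemma pow2_gt0 n : 0 < 2 ^+ n :> R. Proof. by rewrite exprn_gt0. Qed.

Lemma scaled_gt0 k x j : Omega x -> 0 < scaled k x j.
Proof.
move=> Ox; rewrite /scaled mulr_gt0 ?pow2_gt0// subr_gt0.
by have /andP[] := HO Ox j.
Qed.

Lemma mem_closed_cell k x : Omega x -> closed_cell k (cell_index k x) x.
Proof.
move=> Ox j; rewrite ffunE.
have /andP[-> /ltW ->//] := truncn_itv (ltW (scaled_gt0 k j Ox)).
Qed.

Lemma closed_cell_compact k z : compact (closed_cell k z).
Proof.
have := @box_compact R d (fun j => o + (2 ^+ k j)^-1 * (z j)%:R)
  (fun j => o + (2 ^+ k j)^-1 * (z j).+1%:R) d0.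
congr compact; apply/seteqP; split => x /= H j; have := H j;
  rewrite /scaled -lerBrDl -[x _ _ <= _]lerBlDl ler_pdivrMl ?pow2_gt0//
    ler_pdivlMl ?pow2_gt0//.
Qed.

Lemma cell_index_unique k x z : (forall j, 0 < scaled k x j - (z j)%:R < 1) ->
  cell_index k x = z.
Proof.
move=> H; apply/ffunP => j; rewrite ffunE; apply: truncn_def.
by have /andP[? ?] := H j; rewrite -natr1; apply/andP; split; lra.
Qed.

(** The lower corner of the cell lies in Omega, hence in the cube. The crude exponent, a sum over
    all directions, gives one bound valid for every j. *)
Lemma closed_cell_index_lt k z j : closed_cell k z `<=` Omega ->
  (z j < L * 2 ^ (\sum_i k i))%N.
Proof.
move=> sub; pose x : 'rV[R]_d := \row_i (o + (2 ^+ k i)^-1 * (z i)%:R).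
have S i : scaled k x i = (z i)%:R.
  by rewrite /scaled mxE addrAC subrr add0r mulVKf// gt_eqF// pow2_gt0.
have /sub Ox : closed_cell k z x.
  by move=> i; rewrite S lexx ler_nat leqnSn.
have /andP[_] := HO Ox j; rewrite mxE ltrD2l ltr_pdivrMl ?pow2_gt0//.
rewrite mulrC -natrX -natrM ltr_nat => /leq_trans; apply.
rewrite leq_mul2l; apply/orP; right; rewrite leq_exp2l//.
by rewrite (bigD1 j)//= leq_addr.
Qed.

Section finite_sums.
Variable M : nat.

Definition index_of (y : {ffun 'I_d -> 'I_M}) : index := [ffun j => nat_of_ord (y j)].

Lemma index_of_inj : injective index_of.
Proof.
move=> y y' /ffunP h; apply/ffunP => j; apply: val_inj.
by have := h j; rewrite !ffunE.
Qed.

(** Indices range over all naturals but sums must be finite; this is harmless because coefficients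
    vanish out of range. With G depending on a point x and vanishing off the cell of x, the sum
    collapses to the value at that cell. *)
Lemma sum_single_cell c (G : index -> R) z :
  (c z != 0 -> forall j, (z j < M)%N) -> (forall z', z' != z -> G z' = 0) ->
  \sum_(y : {ffun 'I_d -> 'I_M}) c (index_of y) * G (index_of y) = c z * G z.
Proof.
move=> Hz HG; have [cz0|/Hz zM] := eqVneq (c z) 0.
  rewrite cz0 mul0r big1// => y _.
  by have [->|/HG ->] := eqVneq (index_of y) z; rewrite ?cz0 ?mul0r ?mulr0.
have [y0 Ey0] : exists y, index_of y = z.
  by exists [ffun j => Ordinal (zM j)]; apply/ffunP => j; rewrite !ffunE.
rewrite (bigD1 y0)//= Ey0 big1 ?addr0// => y yy0; rewrite HG ?mulr0//.
by rewrite -Ey0; apply: contra_neq yy0 => /index_of_inj.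
Qed.

End finite_sums.

(** The factor 2 also excludes the midpoints of the cells, where [half_sign] jumps. *)
Lemma ae_off_grid k : {ae mu, forall x, forall j (a : nat), 2 * scaled k x j != a%:R}.
Proof.
apply: filter_forall => j; apply/ae_foralln => a.
exists [set x : 'rV[R]_d | x ord0 j = o + (2 * 2 ^+ k j)^-1 * a%:R]; split.
- rewrite -[X in measurable X]setTI.
  exact: (measurable_coord j measurableT (measurable_set1 _)).
- exact: (hyperplane_null oO HO).
- move=> x /= /negP; rewrite negbK => /eqP <-.
  by rewrite /scaled; field; rewrite gt_eqF// pow2_gt0.
Qed.

Definition half_sign k i x : R :=
  if scaled k x i - (cell_index k x i)%:R < 2^-1 then 1 else -1.

(** A hat in direction i and bumps in the others, moved to the cell z. The argument is spelled as a
    t + b to match [C1_pair_affine]. *)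
Definition cell_fun k i n z : 'I_d -> R -> R := fun j t =>
  (if j == i then hat n else bump n) (2 ^+ k j * t + (- (2 ^+ k j * o) - (z j)%:R)).

Lemma cell_funE k i n z j x : cell_fun k i n z j (x ord0 j) =
  (if j == i then hat n else bump n) (scaled k x j - (z j)%:R).
Proof. by rewrite /cell_fun /scaled; congr ((if _ then _ else _) _); ring. Qed.

Lemma cell_fun_C1 k i n z : C1 (tensor (cell_fun k i n z)) /\
  forall x, pderiv i (tensor (cell_fun k i n z)) x =
    2 ^+ k i * haar n (scaled k x i - (z i)%:R) *
    \prod_(j | j != i) bump n (scaled k x j - (z j)%:R).
Proof.
have /choice[df Hdf] j : exists df, C1_pair (cell_fun k i n z j) df /\
    (j = i -> df = fun t => 2 ^+ k j * haar n (2 ^+ k j * t + (- (2 ^+ k j * o) - (z j)%:R))).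
  rewrite /cell_fun; have [->|ji] := eqVneq j i.
    exists (fun t => 2 ^+ k i * haar n (2 ^+ k i * t + (- (2 ^+ k i * o) - (z i)%:R))).
    split; last by move=> _.
    exact: (C1_pair_affine (2 ^+ k i) (- (2 ^+ k i * o) - (z i)%:R) (C1_hat _ n)).
  have [db Hb] := @C1_bump R n.
  eexists; split; first exact: (C1_pair_affine (2 ^+ k j) (- (2 ^+ k j * o) - (z j)%:R) Hb).
  by move=> E; rewrite E eqxx in ji.
have [C E] := tensor_C1 (fun j => (Hdf j).1).
split => // x; rewrite E (Hdf i).2//; congr (_ * haar _ _ * _).
  by rewrite /scaled; ring.
by apply: eq_bigr => j ji; rewrite cell_funE (negbTE ji).
Qed.

Lemma cell_fun_out k i n z x : z != cell_index k x -> tensor (cell_fun k i n z) x = 0.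
Proof.
move=> zx.
have [j Hj] : exists j, ~~ (0 < scaled k x j - (z j)%:R < 1).
  apply: contrapT => /forallNP H; move/eqP : zx; apply; apply/esym/cell_index_unique => j.
  by apply: contrapT => /negP; exact: H.
rewrite /tensor (bigD1 j)//= cell_funE.
by case: ifP => _; [rewrite hat_out ?mul0r|rewrite bump_out ?mul0r].
Qed.

Lemma cell_fun_pderiv_out k i n z x : z != cell_index k x ->
  haar n (scaled k x i - (z i)%:R) *
    \prod_(j | j != i) bump n (scaled k x j - (z j)%:R) = 0.
Proof.
move=> zx.
have [j Hj] : exists j, ~~ (0 < scaled k x j - (z j)%:R < 1).
  apply: contrapT => /forallNP H; move/eqP : zx; apply; apply/esym/cell_index_unique => j.
  by apply: contrapT => /negP; exact: H.
have [ji|ji] := eqVneq j i; first by rewrite haar_out ?mul0r// -ji.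
by rewrite (bigD1 j)//= bump_out// mul0r mulr0.
Qed.

Lemma cell_fun_bound k i n z x : `|tensor (cell_fun k i n z) x| <= 2^-1.
Proof.
rewrite /tensor (bigD1 i)//= normrM cell_funE eqxx -[leRHS]mulr1.
apply: ler_pM => //; first exact: hat_bound.
rewrite normr_prod; apply: prodr_ile1 => j ji; rewrite normr_ge0/=.
rewrite cell_funE (negbTE ji); have /andP[b0 b1] := bump01 n (scaled k x j - (z j)%:R).
by rewrite ger0_norm.
Qed.

Lemma cell_fun_test k i n z : closed_cell k z `<=` Omega ->
  test_function Omega (tensor (cell_fun k i n z)).
Proof.
move=> sub; split; first by have [] := cell_fun_C1 k i n z.
exists (closed_cell k z); split => //; first exact: closed_cell_compact.
move=> x nx.
have [j Hj] : exists j, ~~ (0 < scaled k x j - (z j)%:R < 1).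
  apply: contrapT => /forallNP H; apply: nx => j.
  have /andP[? ?] : 0 < scaled k x j - (z j)%:R < 1.
    by apply: contrapT => /negP; exact: H.
  by rewrite -natr1; apply/andP; split; lra.
rewrite /tensor (bigD1 j)//= cell_funE.
by case: ifP => _; [rewrite hat_out ?mul0r|rewrite bump_out ?mul0r].
Qed.

End dyadic_cells.

(** * Coarsening of step functions *)

Section Rintegral_limits.
Context d (T : measurableType d) (R : realType).
Variable mu : {measure set T -> \bar R}.

Lemma Rintegral_cvg (f_ : nat -> T -> R) (f g : T -> R) :
  (forall n, measurable_fun setT (f_ n)) -> measurable_fun setT f ->
  {ae mu, forall x, f_ n x @[n --> \oo] --> f x} ->
  mu.-integrable setT (EFin \o g) ->
  {ae mu, forall x n, `|f_ n x| <= g x} ->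
  \int[mu]_x f_ n x @[n --> \oo] --> \int[mu]_x f x.
Proof.
move=> mf_ mf cf gi fg.
have [|||||fi _ C] := @dominated_convergence _ _ _ mu setT measurableT
    (fun n => EFin \o f_ n) (EFin \o f) (EFin \o g).
- by move=> n; exact/measurable_EFinP.
- exact/measurable_EFinP.
- by apply: filterS cf => x cx _; apply: cvg_EFin; [exact: nearW|exact: cx].
- exact: gi.
- by apply: filterS fg => x fgx n _; rewrite /= lee_fin.
apply: fine_cvg; rewrite fineK; first exact: C.
by case/integrableP : (fi) => _ fin; apply/integrable_fin_num.
Qed.

Lemma Rintegral_sum I (s : seq I) (f : I -> T -> R) :
  (forall i, mu.-integrable setT (EFin \o f i)) ->
  \int[mu]_x (\sum_(i <- s) f i x) = \sum_(i <- s) \int[mu]_x f i x.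
Proof.
move=> fi; elim: s => [|i s ih].
  under eq_Rintegral do rewrite big_nil.
  by rewrite big_nil Rintegral_cst//= mul0r.
under eq_Rintegral do rewrite big_cons.
rewrite big_cons RintegralD// ?ih//.
have := @integrable_sum _ _ _ mu setT measurableT _ s xpredT _ (fun i _ => fi i).
by apply: eq_integrable => // x _; rewrite /= sumEFin.
Qed.

End Rintegral_limits.

Section cell_functions.
Variables (R : realType) (d : nat) (Omega : set 'rV[R]_d) (oO : open Omega).
Hypothesis d0 : (0 < d)%N.
Local Notation V := ('rV[R]_d -> R).
Local Notation mu := (lebesgue_on oO).
Local Notation index := {ffun 'I_d -> nat}.
Variables (o : R) (L : nat).
Hypothesis HO : forall x, Omega x -> forall i, o < x ord0 i < o + L%:R.
Local Notation scaled := (scaled o).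
Local Notation cell_index := (cell_index o).
Local Notation closed_cell := (closed_cell o).
Local Notation half_sign := (half_sign o).
Implicit Types (k : 'I_d -> nat) (z : index) (c : index -> R) (x : 'rV[R]_d).

Let muT : (mu setT < +oo)%E. Proof. exact: lebesgue_on_finite HO. Qed.

Lemma continuous_scaled k j : continuous (fun x => scaled k x j).
Proof.
apply: (@continuous_coord R d j (fun t => 2 ^+ k j * (t - o))) => t.
apply: cvgM; first exact: cvg_cst.
by apply: cvgB; [exact: cvg_id|exact: cvg_cst].
Qed.

Lemma measurable_cell k z : measurable [set x | cell_index k x = z].
Proof.
rewrite (_ : mkset _ = \bigcap_(j in [set: 'I_d])
   ((fun x => scaled k x j) @^-1` [set t | Num.truncn t = z j])); last first.
  apply/seteqP; split => x /=; first by move=> <- j _; rewrite /= ffunE.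
  by move=> H; apply/ffunP => j; rewrite ffunE; exact: H j I.
apply: fin_bigcap_measurable => // j _; rewrite -[X in measurable X]setTI.
apply: continuous_measurable_rV => //; first exact: continuous_scaled.
(* [truncn] is 0 on negative reals too, so the cells of index 0 are unbounded below. *)
rewrite (_ : mkset _ = [set t | (z j)%:R <= t \/ z j = 0%N] `&` [set` `]-oo, (z j).+1%:R[]).
  apply: measurableI => //.
  have [->|zj] := eqVneq (z j) 0%N.
    by rewrite (_ : mkset _ = setT)//; apply/seteqP; split => // t _; right.
  rewrite (_ : mkset _ = [set` `[(z j)%:R, +oo[])//.
  apply/seteqP; split => t /=; rewrite in_itv/= andbT; first by case=> // /eqP; rewrite (negbTE zj).
  by left.
apply/seteqP; split => t /=.
  move=> <-; rewrite in_itv/= truncnS_gt; split => //.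
  by have [t0|t0] := leP 0 t; [left; rewrite truncn_le|right; apply/truncn0Pn; rewrite -ltNge (lt_trans t0)].
rewrite in_itv/= => -[[zt|z0]] tz.
  by apply: truncn_def; rewrite zt.
by rewrite z0; apply/truncn0Pn; rewrite -ltNge; move: tz; rewrite z0.
Qed.

Lemma measurable_cell_set k (S : set index) : measurable [set x | S (cell_index k x)].
Proof.
rewrite (_ : mkset _ = \bigcup_(z in [set: index])
  (if `[< S z >] then [set x | cell_index k x = z] else set0)).
  apply: countable_bigcupT_measurable => [|z]; first exact: countableP.
  by case: ifP => // _; exact: measurable_cell.
apply/seteqP; split => x /=.
  by move=> Sx; exists (cell_index k x) => //; rewrite asboolT.
by move=> [z _]; case: asboolP => // Sz /= ->.
Qed.

Lemma measurable_cell_fun k (S : index -> R) :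
  measurable_fun setT (fun x => S (cell_index k x)).
Proof.
move=> _ Y mY; rewrite setTI.
exact: (measurable_cell_set k (S @^-1` Y)).
Qed.

Lemma measurable_half_sign k i : measurable_fun setT (half_sign k i).
Proof.
apply: measurable_fun_ifT => //.
apply: measurable_fun_ltr => //; apply: measurable_funB.
  by apply: continuous_measurable_rV; exact: continuous_scaled.
have := @measurable_cell_fun k (fun z => (z i)%:R).
exact.
Qed.

Lemma half_sign_norm k i x : `|half_sign k i x| = 1.
Proof. by rewrite /half_sign; case: ifP; rewrite ?normrN normr1. Qed.

(* A Haar function in direction i is the i-th derivative of a tensor of a hat and bumps, up
   to a limit of test functions. *)
Lemma haar_pairing (u : V) k i c : BV oO u -> (forall z, `|c z| <= 1) ->
  (forall z, c z != 0 -> closed_cell k z `<=` Omega) ->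
  `|\int[mu]_x (u x * (c (cell_index k x) * half_sign k i x))| <=
    (2 ^+ k i)^-1 * 2^-1 * tv oO u.
Proof.
move=> Bu c1 cO; pose M := (L * 2 ^ (\sum_i k i))%N.
(* At each point at most one summand is nonzero, so Psi is bounded by 1/2 whatever the number of
   cells; D below is its i-th derivative without the factor 2^(k i). *)
pose Psi n : V := fun x => \sum_(y : {ffun 'I_d -> 'I_M})
  c (index_of y) * tensor (cell_fun o k i n (index_of y)) x.
pose D n : V := fun x => c (cell_index k x) *
  (haar n (scaled k x i - (cell_index k x i)%:R) *
    \prod_(j | j != i) bump n (scaled k x j - (cell_index k x j)%:R)).
have range z : c z != 0 -> forall j, (z j < M)%N.
  by move=> /cO zO j; exact: (closed_cell_index_lt HO).
have EPsi n x : Psi n x = c (cell_index k x) * tensor (cell_fun o k i n (cell_index k x)) x.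
  apply: (sum_single_cell (G := fun z => tensor (cell_fun o k i n z) x)); first exact: range.
  by move=> z zx; exact: cell_fun_out.
have C1c n (y : {ffun 'I_d -> 'I_M}) := (cell_fun_C1 o k i n (index_of y)).1.
have EdPsi n x : pderiv i (Psi n) x = 2 ^+ k i * D n x.
  rewrite (C1_sum _ _ (C1c n)).2.
  under eq_bigr => y _ do rewrite (cell_fun_C1 o k i n (index_of y)).2 -mulrA mulrCA.
  rewrite -mulr_sumr; congr (_ * _).
  apply: (sum_single_cell (G := fun z => haar n (scaled k x i - (z i)%:R) *
    \prod_(j | j != i) bump n (scaled k x j - (z j)%:R))); first exact: range.
  by move=> z zx; exact: cell_fun_pderiv_out.
have TPsi n : test_function Omega (Psi n).
  apply: test_function_sum; last exact: C1c.
  by move=> y cy; apply: (cell_fun_test d0); exact: cO.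
have BPsi n x : `|Psi n x| <= 2^-1.
  rewrite EPsi normrM -[leRHS]mul1r; apply: ler_pM => //; exact: cell_fun_bound.
have pk := pow2_gt0 R (k i).
have mD n : measurable_fun setT (D n).
  rewrite (_ : D n = fun x => (2 ^+ k i)^-1 * pderiv i (Psi n) x).
    apply: measurable_funM => //; apply: C1_pderiv_measurable; exact: (TPsi n).1.
  by apply/funext => x; rewrite EdPsi mulKf// gt_eqF.
have Dle n x : `|D n x| <= 1.
  rewrite /D normrM -[leRHS]mul1r; apply: ler_pM => //.
  rewrite normrM -[leRHS]mul1r; apply: ler_pM => //; first exact: haar_bound.
  rewrite normr_prod; apply: prodr_ile1 => j _; rewrite normr_ge0/=.
  have /andP[b0 b1] := bump01 n (scaled k x j - (cell_index k x j)%:R).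
  by rewrite ger0_norm.
have mu_u := LfunP_meas Bu.1.
have iu : mu.-integrable setT (EFin \o u) by exact/Lfun1_integrable/Bu.1.
have iuD n : mu.-integrable setT (EFin \o (fun x => u x * D n x)).
  by apply: (integrableT_mulr (M := 1)) => //; exact: aeW.
have half0 : 0 < 2^-1 :> R by rewrite invr_gt0.
have bound n : `|\int[mu]_x (u x * D n x)| <= (2 ^+ k i)^-1 * 2^-1 * tv oO u.
  have := test_function_pairing i Bu (TPsi n) half0 (BPsi n).
  under eq_Rintegral => x _ do rewrite EdPsi mulrCA.
  rewrite RintegralZl// normrM (gtr0_norm pk) => h.
  by rewrite -mulrA ler_pdivlMl.
have inside x j : Omega x -> (forall j (a : nat), 2 * scaled k x j != a%:R) ->
    0 < scaled k x j - (cell_index k x j)%:R < 1.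
  move=> Ox off; rewrite ffunE.
  have /andP[h1 h2] := truncn_itv (ltW (scaled_gt0 HO k j Ox)).
  move: h2; rewrite -natr1 => h2; apply/andP; split; last by lra.
  rewrite subr_gt0 lt_neqAle h1 andbT; apply/negP => /eqP E.
  by have := off j (2 * Num.truncn (scaled k x j))%N; rewrite natrM -E natrK ?eqxx.
have C : \int[mu]_x (u x * D n x) @[n --> \oo] -->
    \int[mu]_x (u x * (c (cell_index k x) * half_sign k i x)).
  apply: (@Rintegral_cvg _ _ _ _ _ _ (fun x => `|u x|)).
  - by move=> n; exact: measurable_funM.
  - apply: measurable_funM => //; apply: measurable_funM; first exact: measurable_cell_fun.
    exact: measurable_half_sign.
  - apply: filterS2 (ae_in_domain oO) (ae_off_grid oO HO k) => x Ox off.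
    apply: cvgM; first exact: cvg_cst.
    apply: cvgM; first exact: cvg_cst.
    apply: cvg_near_cst.
    have hb : \forall n \near \oo, forall j, bump n (scaled k x j - (cell_index k x j)%:R) = 1.
      by apply: filter_forall => j; apply: bump_in; exact: inside.
    have hh : \forall n \near \oo,
        haar n (scaled k x i - (cell_index k x i)%:R) = half_sign k i x.
      have /andP[s0 s1] := inside x i Ox off.
      rewrite /half_sign; case: ltP => sh; first by apply: haar_left; rewrite s0.
      apply: haar_right; rewrite s1 andbT lt_neqAle sh andbT.
      apply/negP => /eqP E; have := off i (2 * cell_index k x i + 1)%N.
      rewrite natrD natrM => /eqP; apply.
      by rewrite -(subrK (cell_index k x i)%:R (scaled k x i)) -E; field.
    apply: filterS2 hb hh => n hb ->.
    by rewrite big1 ?mulr1.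
  - exact: integrableT_abs.
  - by apply: aeW => x n; rewrite normrM ler_piMr.
rewrite ler_norml; apply/andP; split.
  by apply: (cvgr_to_ge C); apply: nearW => n; have := bound n; rewrite ler_norml => /andP[].
by apply: (cvgr_to_le C); apply: nearW => n; have := bound n; rewrite ler_norml => /andP[].
Qed.

Definition update z i (a : nat) : index := [ffun j => if j == i then a else z j].

Definition refine_level k i : 'I_d -> nat := fun j => if j == i then (k j).+1 else k j.

Lemma scaledE k x j : scaled k x j = 2 ^+ k j * (x ord0 j - o).
Proof. by []. Qed.

Lemma cell_index_refine k i x : Omega x -> cell_index (refine_level k i) x =
  update (cell_index k x) i (2 * cell_index k x i
     + ~~ (scaled k x i - (cell_index k x i)%:R < 2^-1)%R)%N.
Proof.
move=> Ox; apply/ffunP => j; rewrite !ffunE !scaledE /refine_level.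
have [->|//] := eqVneq j i.
have := truncn_itv (ltW (scaled_gt0 HO k i Ox)); rewrite scaledE.
rewrite exprS -[2 * _ * _]mulrA; set s := 2 ^+ k i * _; set a := Num.truncn s.
rewrite -natr1 => /andP[h1 h2]; apply: truncn_def.
case: ltP => hs; rewrite -natr1 natrD natrM /=; apply/andP; split; lra.
Qed.

Definition avg i c z : R :=
  2^-1 * (c (update z i (2 * z i + false)%N) + c (update z i (2 * z i + true)%N)).

Definition dif i c z : R :=
  2^-1 * (c (update z i (2 * z i + false)%N) - c (update z i (2 * z i + true)%N)).

(** One level of the Haar decomposition in direction i: mean plus half difference on the left half
    cell, mean minus half difference on the right one. *)
Lemma refine_split k i c x : Omega x -> c (cell_index (refine_level k i) x) =
  avg i c (cell_index k x) + dif i c (cell_index k x) * half_sign k i x.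
Proof.
move=> Ox; rewrite cell_index_refine// /avg /dif /half_sign.
by case: ifP => _ /=; field.
Qed.

(** Index of the level m cell that contains the cell z; meaningful when m <= k j for all j, because
    of the truncated subtraction. *)
Definition ancestor (m : nat) k z : index := [ffun j => (z j %/ 2 ^ (k j - m))%N].

Lemma closed_cell_ancestor m k z : (forall j, (m <= k j)%N) ->
  closed_cell k z `<=` closed_cell (fun=> m) (ancestor m k z).
Proof.
move=> mk x Hx j; have := Hx j; rewrite !scaledE ffunE.
set e := (k j - m)%N; set a := x ord0 j - o.
have -> : k j = (m + e)%N by rewrite subnKC.
have e0 : 0 < 2 ^+ e :> R by exact: pow2_gt0.
rewrite exprD mulrAC => /andP[h1 h2].
have d1 : (z j %/ 2 ^ e)%:R * 2 ^+ e <= (z j)%:R :> R.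
  by rewrite -natrX -natrM ler_nat leq_trunc_div.
have d2 : (z j).+1%:R <= (z j %/ 2 ^ e).+1%:R * 2 ^+ e :> R.
  by rewrite -natrX -natrM ler_nat ltn_ceil// expn_gt0.
by rewrite -(ler_pM2r e0) -[X in _ && X](ler_pM2r e0) (le_trans d1)//= (le_trans h2).
Qed.

Lemma cell_index_ancestor m k x : Omega x -> (forall j, (m <= k j)%N) ->
  ancestor m k (cell_index k x) = cell_index (fun=> m) x.
Proof.
move=> Ox mk; apply/ffunP => j; rewrite !ffunE; apply/esym/truncn_def.
have := truncn_itv (ltW (scaled_gt0 HO k j Ox)); rewrite !scaledE.
set e := (k j - m)%N; set a := x ord0 j - o; set t := Num.truncn _.
have -> : k j = (m + e)%N by rewrite subnKC.
have e0 : 0 < 2 ^+ e :> R by exact: pow2_gt0.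
rewrite exprD mulrAC => /andP[h1 h2].
have d1 : (t %/ 2 ^ e)%:R * 2 ^+ e <= t%:R :> R.
  by rewrite -natrX -natrM ler_nat leq_trunc_div.
have d2 : t.+1%:R <= (t %/ 2 ^ e).+1%:R * 2 ^+ e :> R.
  by rewrite -natrX -natrM ler_nat ltn_ceil// expn_gt0.
by rewrite -(ler_pM2r e0) -[X in _ && X](ltr_pM2r e0) (le_trans d1)//= (lt_le_trans h2).
Qed.

Lemma ancestor_update m k i z (b : bool) : (m <= k i)%N ->
  ancestor m (refine_level k i) (update z i (2 * z i + b)%N) = ancestor m k z.
Proof.
move=> mk; apply/ffunP => j; rewrite !ffunE /refine_level.
have [->|//] := eqVneq j i.
rewrite subSn// expnS divnMA mulnC divnMDl//.
by rewrite [(b %/ 2)%N]divn_small ?addn0//; case: b.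
Qed.

Lemma integrable_cell_fun (u : V) k c B : BV oO u -> (forall z, `|c z| <= B) ->
  mu.-integrable setT (EFin \o (fun x => u x * c (cell_index k x))).
Proof.
move=> Bu cB; apply: (integrableT_mulr (M := B)); first exact: measurable_cell_fun.
- by apply: aeW => x; exact: cB.
- exact/Lfun1_integrable/Bu.1.
Qed.

(** The support condition concerns the level m ancestor, not the cell itself: sibling half cells
    share their ancestor, so the condition survives averaging. *)
Definition interior_coefficients m k c := (forall z, `|c z| <= 1) /\
  forall z, c z != 0 -> closed_cell (fun=> m) (ancestor m k z) `<=` Omega.

(* One halving step at a time, in one direction: replacing the values on two neighbouring
   half cells by their mean changes the step function by a Haar function. *)
Lemma coarsen (u : V) m k c : BV oO u -> (forall j, (m <= k j)%N) ->
  interior_coefficients m k c ->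
  exists2 c0, interior_coefficients m (fun=> m) c0 &
    `|\int[mu]_x (u x * (c (cell_index k x) - c0 (cell_index (fun=> m) x)))| <=
      (\sum_(j < d) ((2 ^+ m)^-1 - (2 ^+ k j)^-1)) * tv oO u.
Proof.
move=> Bu; have [N] := ubnP (\sum_j (k j - m))%N.
elim: N k c => // N ih k c kN mk [c1 cO].
have [km|] := pselect (forall j, k j = m).
  have -> : k = fun=> m by apply/funext.
  exists c; first by split => // z cz; have := cO z cz; have -> : k = fun=> m by apply/funext.
  rewrite [X in _ <= X * _]big1 ?mul0r; last by move=> j _; rewrite subrr.
  under eq_Rintegral => x _ do rewrite subrr mulr0.
  by rewrite Rintegral_cst//= mul0r normr0.
move=> /existsNP[i kim].
have mki : (m < k i)%N by rewrite ltn_neqAle mk andbT; apply/eqP => E; exact: kim.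
pose k1 : 'I_d -> nat := fun j => if j == i then (k i).-1 else k j.
have mk1 j : (m <= k1 j)%N.
  by rewrite /k1; case: ifP => // _; rewrite -ltnS (ltn_predK mki).
have Ek : k = refine_level k1 i.
  apply/funext => j; rewrite /refine_level /k1.
  by have [->|//] := eqVneq j i; rewrite (ltn_predK mki).
have k1N : (\sum_j (k1 j - m) < N)%N.
  have kN' : (\sum_j (k j - m) <= N)%N by [].
  apply: leq_trans kN'; rewrite (bigD1 i)//= [in X in (_ < X)%N](bigD1 i)//=.
  rewrite [X in (_ + X < _)%N](eq_bigr (fun j => k j - m)%N); last first.
    by move=> j ji; rewrite /k1 (negbTE ji).
  by rewrite ltn_add2r /k1 eqxx ltn_sub2r// ltn_predL (leq_ltn_trans _ mki).
have anc z (b : bool) : ancestor m k (update z i (2 * z i + b)%N) = ancestor m k1 z.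
  by rewrite Ek ancestor_update.
have nz z : (c (update z i (2 * z i + false)%N) != 0) ||
    (c (update z i (2 * z i + true)%N) != 0) ->
    closed_cell (fun=> m) (ancestor m k1 z) `<=` Omega.
  by case/orP => /cO; rewrite anc.
have half_le (a b : R) : `|a| <= 1 -> `|b| <= 1 -> `|2^-1 * (a + b)| <= 1.
  by rewrite !ler_norml => /andP[? ?] /andP[? ?]; apply/andP; split; lra.
have Iavg : interior_coefficients m k1 (avg i c).
  split; first by move=> z; apply: half_le.
  move=> z nzz; apply: nz; apply: contraR nzz.
  by rewrite negb_or !negbK /avg => /andP[/eqP -> /eqP ->]; rewrite addr0 mulr0.
have dif1 z : `|dif i c z| <= 1 by apply: half_le; rewrite ?normrN.
have difO z : dif i c z != 0 -> closed_cell k1 z `<=` Omega.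
  move=> nzz x xz; apply: nz (@closed_cell_ancestor m k1 z mk1 x xz).
  apply: contraR nzz.
  by rewrite negb_or !negbK /dif => /andP[/eqP -> /eqP ->]; rewrite subr0 mulr0.
have [c0 Ic0 Hc0] := ih k1 (avg i c) k1N mk1 Iavg.
exists c0 => //.
have mu_u := LfunP_meas Bu.1.
have iu : mu.-integrable setT (EFin \o u) by exact/Lfun1_integrable/Bu.1.
have i1 : mu.-integrable setT (EFin \o (fun x => u x * (dif i c (cell_index k1 x) * half_sign k1 i x))).
  apply: (integrableT_mulr (M := 1)) => //.
    apply: measurable_funM; first exact: measurable_cell_fun.
    exact: measurable_half_sign.
  by apply: aeW => x; rewrite normrM half_sign_norm mulr1.
have i2 : mu.-integrable setT
    (EFin \o (fun x => u x * (avg i c (cell_index k1 x) - c0 (cell_index (fun=> m) x)))).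
  apply: (integrableT_mulr (M := 2)) => //.
    by apply: measurable_funB; exact: measurable_cell_fun.
  apply: aeW => x; apply: le_trans (ler_normB _ _) _.
  by rewrite (_ : 2 = 1 + 1)// lerD//; [exact: Iavg.1|exact: Ic0.1].
have mck kk cc : measurable_fun setT (fun x => cc (cell_index kk x)) := measurable_cell_fun kk cc.
have -> : \int[mu]_x (u x * (c (cell_index k x) - c0 (cell_index (fun=> m) x))) =
   \int[mu]_x (u x * (dif i c (cell_index k1 x) * half_sign k1 i x)) +
   \int[mu]_x (u x * (avg i c (cell_index k1 x) - c0 (cell_index (fun=> m) x))).
  rewrite -RintegralD//; apply: Rintegral_ae_eq.
  - by apply: measurable_funM => //; apply: measurable_funB; exact: mck.
  - by apply: measurable_funD; apply/measurable_EFinP; [case/integrableP : i1|case/integrableP : i2].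
  - apply: filterS (ae_in_domain oO) => x Ox.
    by rewrite {1}Ek refine_split//; ring.
apply: le_trans (ler_normD _ _) _.
(* The cost, half of (2^(k i - 1))^-1, equals (2^(k i - 1))^-1 - (2^(k i))^-1: exactly the term by
   which the sum grows from k1 to k. *)
have h := haar_pairing i Bu dif1 difO.
apply: le_trans (lerD h Hc0) _; rewrite -mulrDl ler_wpM2r ?tv_ge0//.
rewrite (bigD1 i)//= [leRHS](bigD1 i)//=.
rewrite [X in _ + (_ + X) <= _](eq_bigr (fun j => (2 ^+ m)^-1 - (2 ^+ k j)^-1)); last first.
  by move=> j ji; rewrite /k1 (negbTE ji).
rewrite addrA lerD2r /k1 eqxx.
have -> : 2 ^+ k i = 2 * 2 ^+ (k i).-1 :> R by rewrite -exprS (ltn_predK mki).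
by rewrite invfM; lra.
Qed.

End cell_functions.

(** * A cellwise Poincare inequality *)

Section cell_approximation.
Variables (R : realType) (d : nat) (Omega : set 'rV[R]_d) (oO : open Omega).
Hypothesis d0 : (0 < d)%N.
Local Notation V := ('rV[R]_d -> R).
Local Notation mu := (lebesgue_on oO).
Local Notation index := {ffun 'I_d -> nat}.
Variables (o : R) (L : nat).
Hypothesis HO : forall x, Omega x -> forall i, o < x ord0 i < o + L%:R.
Local Notation uindex k := (cell_index o (fun=> k)).
Local Notation ucell k := (closed_cell o (fun=> k)).
Implicit Types (k m : nat) (z : index) (c : index -> R) (x : 'rV[R]_d).

Let muT : (mu setT < +oo)%E. Proof. exact: lebesgue_on_finite HO. Qed.

Lemma ucell_diameter k z x y j : ucell k z x -> ucell k z y ->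
  `|x ord0 j - y ord0 j| <= (2 ^+ k)^-1.
Proof.
move=> /(_ j) + /(_ j); rewrite /scaled => /andP[x1 x2] /andP[y1 y2].
have pk := pow2_gt0 R k.
rewrite -(ler_pM2l pk) divff ?gt_eqF// -{1}(gtr0_norm pk) -normrM mulrBr.
move: x1 x2 y1 y2; rewrite !mulrBr -natr1 => x1 x2 y1 y2.
by rewrite ler_norml; apply/andP; split; lra.
Qed.

Lemma nbhs_coord (U : set 'rV[R]_d) x : nbhs x U -> exists2 e : R, 0 < e &
  forall y : 'rV[R]_d, (forall j, `|x ord0 j - y ord0 j| < e) -> U y.
Proof.
move=> /nbhs_ballP[e /= e0 eU]; exists e => // y Hy; apply: eU.
rewrite mx_norm_ball /ball_/= {1}/Num.norm/= mx_normrE.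
by apply/bigmax_ltP; split => // -[a i] _; rewrite /= ord1 !mxE.
Qed.

Lemma pow2_inv_cvg0 : (2 ^+ k)^-1 @[k --> \oo] --> (0 : R).
Proof.
under eq_fun do rewrite -exprVn; apply: cvg_expr.
by rewrite ger0_norm ?invr_ge0// invf_lt1// ltr1n.
Qed.

Lemma ucell_sub_near (U : set 'rV[R]_d) x : Omega x -> open U -> U x ->
  \forall k \near \oo, ucell k (uindex k x) `<=` U.
Proof.
move=> Ox oU Ux; have [e e0 He] := nbhs_coord (open_nbhs_nbhs (conj oU Ux)).
have /cvgrPdist_lt /(_ e e0) := pow2_inv_cvg0.
apply: filterS => k; rewrite sub0r normrN ger0_norm ?invr_ge0 ?exprn_ge0// => ke y Hy.
by apply: He => j; apply: le_lt_trans ke; apply: ucell_diameter Hy; exact: mem_closed_cell HO _ _ Ox.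
Qed.

Lemma measurable_indicT (A : set 'rV[R]_d) : measurable A ->
  measurable_fun setT (\1_A : V).
Proof. by move=> mA; exact: measurable_indic. Qed.

(** L^1 approximation of the indicator by dyadic step functions, demanded at all fine levels and not
    at one, so that two sets can be approximated at a common level. *)
Definition approximable (A : set 'rV[R]_d) : Prop := measurable A /\
  forall dl, 0 < dl -> exists K, forall k, (K <= k)%N -> exists b : index -> bool,
    \int[mu]_x `|\1_A x - (b (uindex k x))%:R| < dl.

Lemma measurable_bool_cell k (b : index -> bool) :
  measurable_fun setT (fun x => (b (uindex k x))%:R : R).
Proof. exact: (measurable_cell_fun o (fun=> k) (fun z => (b z)%:R)). Qed.

Lemma indic_bool_bound (A : set 'rV[R]_d) (b : bool) x : `|\1_A x - b%:R| <= 1 :> R.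
Proof.
rewrite indicE; case: (x \in A); case: b; rewrite /= ?subrr ?subr0 ?sub0r ?normrN ?normr0 ?normr1//.
Qed.

Lemma integrable_indic_bool (A : set 'rV[R]_d) k (b : index -> bool) : measurable A ->
  mu.-integrable setT (EFin \o (fun x => `|\1_A x - (b (uindex k x))%:R|)).
Proof.
move=> mA; apply: (integrable_ae_bounded muT (M := 1)).
  apply: measurableT_comp => //; apply: measurable_funB; first exact: measurable_indicT.
  exact: measurable_bool_cell.
by apply: aeW => x; rewrite normr_id; exact: indic_bool_bound.
Qed.

Lemma approximable_open (U : set 'rV[R]_d) : open U -> approximable U.
Proof.
move=> oU; have mU : measurable U by exact: open_measurable_rV.
split => // dl dl0.
pose b k z := `[< ucell k z `<=` U >].
have C : \int[mu]_x `|\1_U x - (b k (uindex k x))%:R| @[k --> \oo] --> \int[mu]_x (0 : R).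
  apply: (@Rintegral_cvg _ _ _ _ _ _ (cst 1)).
  - move=> k; apply: measurableT_comp => //; apply: measurable_funB; first exact: measurable_indicT.
    exact: measurable_bool_cell.
  - exact: measurable_cst.
  - apply: filterS (ae_in_domain oO) => x Ox; apply: cvg_near_cst.
    rewrite indicE; have [Ux|Ux] := boolP (x \in U).
      apply: filterS (ucell_sub_near Ox oU (set_mem Ux)) => k Hk.
      by rewrite /b asboolT// subrr normr0.
    apply: nearW => k; rewrite /b asboolF ?subrr ?normr0// => /(_ x).
    move=> /(_ (mem_closed_cell HO _ Ox)) Ux'.
    by rewrite mem_set in Ux.
  - exact: integrableT_cst.
  - by apply: aeW => x k; rewrite normr_id; exact: indic_bool_bound.
move: C; rewrite Rintegral_cst//= mul0r => /cvgrPdist_lt /(_ _ dl0) [K _ HK].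
exists K => k Kk; exists (b k); have := HK k Kk.
by rewrite /= sub0r normrN ger0_norm// Rintegral_ge0.
Qed.

Lemma approximable_setC A : approximable A -> approximable (~` A).
Proof.
move=> [mA HA]; split; first exact: measurableC.
move=> dl dl0; have [K HK] := HA dl dl0; exists K => k /HK[b Hb].
exists (fun z => ~~ b z); apply: le_lt_trans Hb.
rewrite le_eqVlt; apply/orP; left; apply/eqP; apply: eq_Rintegral => x _.
rewrite !indicE in_setC; case: (x \in A); case: (b _) => /=;
  by rewrite ?subrr ?subr0 ?sub0r ?normrN.
Qed.

Lemma approximable_setU A B : approximable A -> approximable B -> approximable (A `|` B).
Proof.
move=> [mA HA] [mB HB]; split; first exact: measurableU.
move=> dl dl0; have dl2 : 0 < dl / 2 by rewrite divr_gt0.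
have [K HK] := HA _ dl2; have [K' HK'] := HB _ dl2.
exists (maxn K K') => k; rewrite geq_max => /andP[/HK[a Ha] /HK'[b Hb]].
exists (fun z => a z || b z); rewrite [dl]splitr.
apply: le_lt_trans (ltrD Ha Hb).
have iA := integrable_indic_bool k a mA; have iB := integrable_indic_bool k b mB.
rewrite -RintegralD//; apply: le_Rintegral => //.
- by apply: (integrable_indic_bool k (fun z => a z || b z)); exact: measurableU.
- by have := integrableD measurableT iA iB; exact: eq_integrable.
move=> x _; rewrite !indicE in_setU; case: (x \in A); case: (x \in B); case: (a _); case: (b _);
  by rewrite /= ?subrr ?subr0 ?sub0r ?normrN ?normr0 ?normr1 ?addr0 ?add0r ?ler01 ?lexx ?lerDl.
Qed.

Lemma approximable_bigcup (A : nat -> set 'rV[R]_d) : (forall n, approximable (A n)) ->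
  approximable (\bigcup_n A n).
Proof.
move=> HA; have mA : measurable (\bigcup_n A n) by apply: bigcup_measurable => n _; case: (HA n).
split => // dl dl0; have dl2 : 0 < dl / 2 by rewrite divr_gt0.
pose B n := \big[setU/set0]_(i < n) A i.
have aB n : approximable (B n).
  rewrite /B; elim: n => [|n ih].
    by rewrite big_ord0; apply: approximable_open; exact: open0.
  by rewrite big_ord_recr; exact: approximable_setU.
have C : \int[mu]_x `|\1_(\bigcup_n A n) x - \1_(B n) x| @[n --> \oo] --> \int[mu]_x (0 : R).
  apply: (@Rintegral_cvg _ _ _ _ _ _ (cst 1)).
  - move=> n; apply: measurableT_comp => //; apply: measurable_funB; first exact: measurable_indicT.
    by apply: measurable_indicT; case: (aB n).
  - exact: measurable_cst.
  - apply: aeW => x; apply: cvg_near_cst.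
    have [[n _ An]|nA] := pselect ((\bigcup_n A n) x).
      exists n.+1 => // k /= nk.
      rewrite !indicE !mem_set ?subrr ?normr0//; last by exists n.
      by rewrite /B -bigcup_mkord; exists n.
    apply: nearW => n; rewrite !indicE !memNset ?subrr ?normr0//.
    by move=> H; apply: nA; move: H; rewrite /B -bigcup_mkord => -[i _ Ai]; exists i.
  - exact: integrableT_cst.
  - apply: aeW => x n; rewrite normr_id indicE (_ : \1_(B n) x = (x \in B n)%:R)//.
    by case: (_ \in _); case: (_ \in _); rewrite /= ?subrr ?subr0 ?sub0r ?normrN ?normr0 ?normr1.
move: C; rewrite Rintegral_cst//= mul0r => /cvgrPdist_lt /(_ _ dl2) [N _ /(_ N (leqnn N))].
rewrite /= sub0r normrN ger0_norm; last exact: Rintegral_ge0.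
move=> HN; have [mB /(_ _ dl2) [K HK]] := aB N.
exists K => k /HK[b Hb]; exists b; rewrite [dl]splitr.
apply: le_lt_trans (ltrD HN Hb).
have iB := integrable_indic_bool k b mB.
have iA : mu.-integrable setT (EFin \o (fun x => `|\1_(\bigcup_n A n) x - \1_(B N) x|)).
  apply: (integrable_ae_bounded muT (M := 1)).
    apply: measurableT_comp => //; apply: measurable_funB; exact: measurable_indicT.
  apply: aeW => x; rewrite normr_id (_ : \1_(B N) x = (x \in B N)%:R)//.
  exact: indic_bool_bound.
rewrite -RintegralD//; apply: le_Rintegral => //.
- exact: integrable_indic_bool.
- by have := integrableD measurableT iA iB; exact: eq_integrable.
move=> x _; exact: ler_distD.
Qed.

(** Approximable sets form a sigma-algebra that contains the open sets, and these generate the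
    measurable sets. *)
Lemma measurable_approximable A : measurable A -> approximable A.
Proof.
move=> mA; have : <<s @open 'rV[R]_d >> A by exact: mA.
apply: smallest_sub; last by move=> U oU; exact: approximable_open.
split.
- by apply: approximable_open; exact: open0.
- by move=> B aB; rewrite setTD; exact: approximable_setC.
- exact: approximable_bigcup.
Qed.

Definition interior_cell m z : bool := `[< ucell m z `<=` Omega >].

Definition cell_number m := (L * 2 ^ (\sum_(i < d) m))%N.

(* Test u against a step function approximating its sign, then coarsen that step function:
   the difference costs at most the mesh size times the total variation. *)
Lemma poincare (u : V) m B : BV oO u -> {ae mu, forall x, `|u x| <= B} ->
  \int[mu]_x (`|u x| * (interior_cell m (uindex m x))%:R) <=
    d%:R * (2 ^+ m)^-1 * tv oO u +
    \sum_(y : {ffun 'I_d -> 'I_(cell_number m)})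
      `|\int[mu]_x (u x * (uindex m x == index_of y)%:R)|.
Proof.
move=> Bu uB; apply/ler_addgt0Pr => e e0.
have mu_u := LfunP_meas Bu.1.
pose A := [set x | 0 < u x].
have mA : measurable A.
  rewrite -[A]setTI (_ : A = u @^-1` `]0, +oo[%classic).
    by apply: mu_u => //; exact: measurable_itv.
  by apply/seteqP; split => x /=; rewrite in_itv/= andbT.
have B0 : 0 < 2 * `|B| + 1 by rewrite ltr_wpDl// mulr_ge0.
have [_ /(_ _ (divr_gt0 e0 B0)) [K HK]] := measurable_approximable mA.
set k := maxn K m; have [b Hb] := HK k (leq_maxl _ _).
have mk (j : 'I_d) : (m <= k)%N by exact: leq_maxr.
(* A dyadic version of sign(u) on the cells with an interior ancestor. Replacing 2 1_A - 1 by 2 b -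
   1 costs at most 2 |B| times the L^1 error of b, hence at most e. *)
pose c z : R := if interior_cell m (ancestor m (fun=> k) z) then (if b z then 1 else -1) else 0.
have Ic : interior_coefficients Omega o m (fun=> k) c.
  split => z; rewrite /c; first by case: ifP => _; [case: ifP|]; rewrite ?normrN ?normr1 ?normr0.
  by case: ifPn => [/asboolP//|]; rewrite eqxx.
have [c0 [c01 c0O] Hc0] := coarsen d0 HO Bu mk Ic.
have iu : mu.-integrable setT (EFin \o u) by exact/Lfun1_integrable/Bu.1.
pose g x : R := (interior_cell m (uindex m x))%:R.
have mg : measurable_fun setT g by exact: measurable_bool_cell.
have g1 x : `|g x| <= 1 by rewrite /g; case: interior_cell; rewrite ?normr0 ?normr1.
have cE x : Omega x -> c (uindex k x) = g x * (2 * (b (uindex k x))%:R - 1).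
  move=> Ox; rewrite /c (cell_index_ancestor HO Ox mk) /g.
  case: interior_cell; rewrite ?mul0r// mul1r; case: (b _); rewrite /= ?mulr1 ?mulr0 ?sub0r//.
  by ring.
have i1 : mu.-integrable setT (EFin \o (fun x => `|u x| * g x)).
  by apply: (integrableT_mulr (M := 1)) => //; [exact: aeW|exact: integrableT_abs].
have ic := integrable_cell_fun o (fun=> k) Bu Ic.1.
have ic0 := integrable_cell_fun o (fun=> m) Bu c01.
have idiff : mu.-integrable setT (EFin \o (fun x => 2 * `|B| * `|\1_A x - (b (uindex k x))%:R|)).
  have := @integrableZl _ _ _ mu setT measurableT (2 * `|B|) _ (integrable_indic_bool k b mA).
  exact: eq_integrable.
have S1 : \int[mu]_x (`|u x| * g x) <=
    \int[mu]_x (u x * c (uindex k x)) + \int[mu]_x (2 * `|B| * `|\1_A x - (b (uindex k x))%:R|).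
  rewrite -RintegralD//; apply: Rintegral_ae_le => //.
    by have := integrableD measurableT ic idiff; exact: eq_integrable.
  apply: filterS2 (ae_in_domain oO) uB => x Ox uxB.
  rewrite cE// -lerBlDl.
  have -> : `|u x| * g x - u x * (g x * (2 * (b (uindex k x))%:R - 1)) =
      g x * u x * (2 * (\1_A x - (b (uindex k x))%:R)).
    rewrite indicE; have [xA|xA] := boolP (x \in A).
      by have /= := set_mem xA; move=> ux; rewrite gtr0_norm//= ; ring.
    have ux : u x <= 0 by rewrite leNgt; apply/negP => ux; rewrite mem_set in xA.
    by rewrite ler0_norm//=; ring.
  apply: le_trans (ler_norm _) _; rewrite normrM [X in _ * X]normrM (@ger0_norm _ 2)//.
  have -> : 2 * `|B| * `|\1_A x - (b (uindex k x))%:R| =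
      `|B| * (2 * `|\1_A x - (b (uindex k x))%:R|) by ring.
  rewrite ler_wpM2r ?mulr_ge0// normrM -[leRHS]mul1r; apply: ler_pM => //.
  exact: le_trans uxB (ler_norm _).
have S2 : \int[mu]_x (2 * `|B| * `|\1_A x - (b (uindex k x))%:R|) <= e.
  rewrite RintegralZl//; last exact: integrable_indic_bool.
  have := Hb; rewrite ltr_pdivlMr// => h; apply: le_trans (ltW h).
  by rewrite mulrC ler_wpM2l ?lerDl// Rintegral_ge0.
have S3 : \int[mu]_x (u x * c (uindex k x)) =
    \int[mu]_x (u x * (c (uindex k x) - c0 (uindex m x))) + \int[mu]_x (u x * c0 (uindex m x)).
  rewrite -RintegralD//.
    by apply: eq_Rintegral => x _; ring.
  have := integrableB measurableT ic ic0; apply: eq_integrable => // x _.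
  by rewrite /= -EFinB; congr EFin; ring.
pose M := cell_number m.
have range z : c0 z != 0 -> forall j, (z j < M)%N.
  move=> /c0O; have -> : ancestor m (fun=> m) z = z.
    by apply/ffunP => j; rewrite ffunE subnn divn1.
  by move=> zO j; exact: (closed_cell_index_lt HO).
have iy (y : {ffun 'I_d -> 'I_M}) :
    mu.-integrable setT (EFin \o (fun x => u x * (uindex m x == index_of y)%:R)).
  apply: (integrable_cell_fun o (fun=> m) (c := fun z => (z == index_of y)%:R) (B := 1)) => // z.
  by case: (_ == _); rewrite ?normr0 ?normr1.
have S4 : \int[mu]_x (u x * c0 (uindex m x)) =
    \sum_(y : {ffun 'I_d -> 'I_M}) c0 (index_of y) * \int[mu]_x (u x * (uindex m x == index_of y)%:R).
  transitivity (\int[mu]_x (\sum_(y : {ffun 'I_d -> 'I_M})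
      c0 (index_of y) * (u x * (uindex m x == index_of y)%:R))).
    apply: eq_Rintegral => x _.
    under eq_bigr => y _ do rewrite mulrCA.
    rewrite -mulr_sumr; congr (_ * _).
    rewrite (sum_single_cell (G := fun z => (uindex m x == z)%:R) (range (uindex m x))).
      by rewrite eqxx mulr1.
    by move=> z /negbTE; rewrite eq_sym => ->.
  rewrite Rintegral_sum.
    by apply: eq_bigr => y _; rewrite RintegralZl.
  move=> y; have := @integrableZl _ _ _ mu setT measurableT (c0 (index_of y)) _ (iy y).
  exact: eq_integrable.
have S5 : \int[mu]_x (u x * c0 (uindex m x)) <=
    \sum_(y : {ffun 'I_d -> 'I_M}) `|\int[mu]_x (u x * (uindex m x == index_of y)%:R)|.
  rewrite S4; apply: ler_sum => y _; apply: le_trans (ler_norm _) _.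
  by rewrite normrM ler_piMl.
have S6 : (\sum_(j < d) ((2 ^+ m)^-1 - (2 ^+ k)^-1)) * tv oO u <= d%:R * (2 ^+ m)^-1 * tv oO u.
  apply: ler_wpM2r; first exact: tv_ge0.
  apply: (@le_trans _ _ (\sum_(j < d) (2 ^+ m)^-1)); last by rewrite sumr_const card_ord mulr_natl.
  by apply: ler_sum => j _; rewrite gerBl invr_ge0 exprn_ge0.
have S0 := le_trans (ler_norm _) Hc0.
apply: le_trans S1 _; rewrite S3.
exact: lerD (lerD (le_trans S0 S6) S5) S2.
Qed.

(** Small cells around a point of the open set Omega lie inside Omega, so the part of Omega covered
    by the other cells has vanishing measure. *)
Lemma interior_cell_cvg :
  \int[mu]_x (1 - (interior_cell m (uindex m x))%:R) @[m --> \oo] --> (0 : R).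
Proof.
have b1 (b : bool) : `|1 - b%:R| <= 1 :> R by case: b; rewrite ?subrr ?subr0 ?normr0 ?normr1.
have -> : 0 = \int[mu]_x (0 : R) by rewrite Rintegral_cst//= mul0r.
apply: (@Rintegral_cvg _ _ _ _ _ _ (cst 1)).
- by move=> m; apply: measurable_funB => //; exact: measurable_bool_cell.
- exact: measurable_cst.
- apply: filterS (ae_in_domain oO) => x Ox; apply: cvg_near_cst.
  by apply: filterS (ucell_sub_near Ox oO Ox) => m Hm; rewrite /interior_cell asboolT// subrr.
- exact: integrableT_cst.
- by apply: aeW => x m; exact: b1.
Qed.

Lemma L1_norm_le_cells (u : V) m B : BV oO u -> {ae mu, forall x, `|u x| <= B} ->
  nrm mu 1 u <= d%:R * (2 ^+ m)^-1 * tv oO u +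
    \sum_(y : {ffun 'I_d -> 'I_(cell_number m)})
      `|\int[mu]_x (u x * (uindex m x == index_of y)%:R)| +
    B * \int[mu]_x (1 - (interior_cell m (uindex m x))%:R).
Proof.
move=> Bu uB.
have mg := measurable_bool_cell m (interior_cell m).
have iu : mu.-integrable setT (EFin \o u) by exact/Lfun1_integrable/Bu.1.
have g01 x : 0 <= ((interior_cell m (uindex m x))%:R : R) <= 1.
  by case: interior_cell; rewrite ?lexx ?ler01.
have i1 : mu.-integrable setT (EFin \o (fun x => `|u x| * (interior_cell m (uindex m x))%:R)).
  apply: (integrableT_mulr (M := 1)) => //; last exact: integrableT_abs.
  by apply: aeW => x; have /andP[? ?] := g01 x; rewrite ger0_norm.
have i2' : mu.-integrable setT (EFin \o (fun x => 1 - (interior_cell m (uindex m x))%:R)).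
  apply: (integrable_ae_bounded muT (M := 1)).
    by apply: measurable_funB.
  by apply: aeW => x; have /andP[? ?] := g01 x; rewrite ger0_norm ?subr_ge0// gerBl.
have i2 : mu.-integrable setT (EFin \o (fun x => B * (1 - (interior_cell m (uindex m x))%:R))).
  have := @integrableZl _ _ _ mu setT measurableT B _ i2'; exact: eq_integrable.
apply: le_trans (lerD (poincare m Bu uB) (lexx _)).
rewrite nrm1 -RintegralZl// -RintegralD//; apply: Rintegral_ae_le => //.
- exact: integrableT_abs.
- by have := integrableD measurableT i1 i2; exact: eq_integrable.
apply: filterS uB => x uxB; have /andP[g0 g1] := g01 x.
have : `|u x| * (1 - (interior_cell m (uindex m x))%:R) <=
       B * (1 - (interior_cell m (uindex m x))%:R) by rewrite ler_wpM2r ?subr_ge0.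
by rewrite !mulrBr !mulr1; lra.
Qed.

Section ultrafilter_limit.
Variables (U : set_system nat) (UU : UltraFilter U).

Lemma ultrafilter_cvg (a : nat -> R) M : (forall n, `|a n| <= M) ->
  exists l : R, a n @[n --> U] --> l.
Proof.
move=> aM; have := @segment_compact R (- M) M; rewrite compact_ultra => /(_ (a n @[n --> U])).
have UF : UltraFilter (a n @[n --> U]).
  split; first exact: fmap_proper_filter.
  move=> G PG sub; apply/seteqP; split => // A GA.
  have [//|UAC] := in_ultra_setVsetC (a @^-1` A) UU.
  have GAC : G (~` A) by apply: sub.
  by have [x []] := filter_ex (filterI GA GAC).
move=> /(_ UF)[|l [_ ?]]; last by exists l.
apply: nearW => n; rewrite /= in_itv/=.
by have := aM n; rewrite ler_norml.
Qed.

Variable (un : nat -> V).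
Variables (B C : R).
Hypothesis Bun : forall n, BV oO (un n).
Hypothesis unB : forall n, {ae mu, forall x, `|un n x| <= B}.
Hypothesis tvC : forall n, tv oO (un n) <= C.

Lemma BVB n p : BV oO (un n - un p) /\ tv oO (un n - un p) <= 2 * C.
Proof.
have -> : un n - un p = 1 *: un n + (-1) *: un p by rewrite scale1r scaleN1r.
split; first exact: BV_linear.
apply: tv_le; apply: le_trans (TV_linear 1 (-1) (Bun n) (Bun p)) _.
rewrite normrN normr1 !mul1r lee_fin.
by have := tvC n; have := tvC p; lra.
Qed.

(* Along an ultrafilter all bounded sequences of cell integrals converge at once, so that no
   diagonal extraction is needed. *)
Lemma ultrafilter_Cauchy e : 0 < e -> exists2 A, U A &
  forall n p, A n -> A p -> nrm mu 1 (un n - un p) < e.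
Proof.
move=> e0.
have B0 : 0 <= `|B| by [].
have C0 : 0 <= C by exact: le_trans (tv_ge0 oO (un 0%N)) (tvC 0%N).
have e3 : 0 < e / 4 by rewrite divr_gt0.
have K1 : 0 < d%:R * (2 * C) + 1 by rewrite ltr_wpDl// !mulr_ge0.
have K2 : 0 < 2 * `|B| + 1 by rewrite ltr_wpDl// mulr_ge0.
(* The level is fixed first: for differences, of variation at most 2 C and size at most 2 |B|, the
   TV term and the boundary term fall below e / 4. Only finitely many cell integrals are then
   left. *)
have [m [Hm1 Hm2]] : exists m, d%:R * (2 ^+ m)^-1 * (2 * C) < e / 4 /\
    2 * `|B| * \int[mu]_x (1 - (interior_cell m (uindex m x))%:R) < e / 4.
  have /cvgrPdist_lt /(_ _ (divr_gt0 e3 K1)) h1 := pow2_inv_cvg0.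
  have /cvgrPdist_lt /(_ _ (divr_gt0 e3 K2)) h2 := interior_cell_cvg.
  have [m [H1 H2]] := filter_ex (filterI h1 h2).
  exists m; move: H1 H2; rewrite /= !sub0r !normrN ger0_norm ?invr_ge0 ?exprn_ge0//.
  rewrite ltr_pdivlMr// => H1.
  rewrite ger0_norm; last first.
    by apply: Rintegral_ge0 => x _; case: interior_cell; rewrite ?subrr ?subr0.
  rewrite ltr_pdivlMr// => H2.
  have P0 : 0 <= (2 ^+ m)^-1 :> R by rewrite invr_ge0 exprn_ge0.
  split; first by move: H1; rewrite mulrDr; lra.
  have I0 : 0 <= \int[mu]_x (1 - (interior_cell m (uindex m x))%:R).
    by apply: Rintegral_ge0 => x _; case: interior_cell; rewrite ?subrr ?subr0.
  by move: H2; rewrite mulrDr; lra.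
pose Y := {ffun 'I_d -> 'I_(cell_number m)}.
pose a (y : Y) n := \int[mu]_x (un n x * (uindex m x == index_of y)%:R).
have iy (y : Y) n : mu.-integrable setT (EFin \o (fun x => un n x * (uindex m x == index_of y)%:R)).
  apply: (integrable_cell_fun o (fun=> m) (c := fun z => (z == index_of y)%:R) (B := 1)) => // z.
  by case: (_ == _); rewrite ?normr0 ?normr1.
have aB y n : `|a y n| <= B * fine (mu setT).
  apply: le_trans (le_normr_Rintegral measurableT (iy y n)) _.
  rewrite -(Rintegral_cst mu measurableT); apply: Rintegral_ae_le.
  - exact: integrableT_abs.
  - exact: integrableT_cst.
  apply: filterS (unB n) => x; apply: le_trans; rewrite normrM ler_piMr//.
  by case: (_ == _); rewrite ?normr0 ?normr1.
have card0 : 0 < #|{: Y}|%:R + 1 :> R by rewrite ltr_wpDl.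
(* Half the tolerance per cell, since both indices are compared with the limit; summed over all
   cells the differences stay below e / 4. *)
have eta0 : 0 < e / 4 / (#|{: Y}|%:R + 1) / 2 by rewrite !divr_gt0.
have /choice[A HA] (y : Y) : exists A, U A /\ forall n p, A n -> A p ->
    `|a y n - a y p| < e / 4 / (#|{: Y}|%:R + 1).
  have [l Hl] := ultrafilter_cvg (aB y).
  exists [set n | `|l - a y n| < e / 4 / (#|{: Y}|%:R + 1) / 2]; split.
    by move/cvgrPdist_lt : Hl => /(_ _ eta0).
  move=> n p /= hn hp; rewrite [ltRHS]splitr -(subrKA l); apply: le_lt_trans (ler_normD _ _) _.
  by rewrite ltrD// distrC.
exists [set n | forall y, A y n].
  by apply: filter_forall => y; case: (HA y).
move=> n p An Ap; have [BVnp tvnp] := BVB n p.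
have npB : {ae mu, forall x, `|(un n - un p) x| <= 2 * `|B|}.
  apply: filterS2 (unB n) (unB p) => x h1 h2; apply: le_trans (ler_normB _ _) _.
  by have := ler_norm B; lra.
apply: le_lt_trans (L1_norm_le_cells m BVnp npB) _.
have S : \sum_(y : Y) `|\int[mu]_x ((un n - un p) x * (uindex m x == index_of y)%:R)| <= e / 4.
  apply: (@le_trans _ _ (\sum_(y : Y) e / 4 / (#|{: Y}|%:R + 1))).
    apply: ler_sum => y _; apply: ltW; have := (HA y).2 n p (An y) (Ap y).
    rewrite /a -RintegralB//; congr (`|_| < _).
    by apply: eq_Rintegral => x _; rewrite -mulrBl.
  by rewrite sumr_const -[leLHS]mulr_natr -mulrA ger_pMr// mulrC ler_pdivrMr// mul1r lerDl.
have T : d%:R * (2 ^+ m)^-1 * tv oO (un n - un p) <= d%:R * (2 ^+ m)^-1 * (2 * C).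
  by rewrite ler_wpM2l// mulr_ge0// invr_ge0 exprn_ge0.
by lra.
Qed.

End ultrafilter_limit.

End cell_approximation.

(** * Approximation of vanishing functions by test functions *)

Section splines.
Variable R : realType.
Implicit Types t : R.

(** A C^1 bump supported in [-1, 1], written as a difference so that the sum of its integer
    translates telescopes to 1. *)
Definition spline t : R := smoothstep (t + 1) - smoothstep t.

Lemma C1_spline : exists df : R -> R, C1_pair spline df.
Proof.
have [ds Hs] := C1_smoothstep R.
eexists; have := C1_pairD (C1_pair_affine 1 1 Hs) (C1_pairZ (-1) Hs).
rewrite [X in C1_pair X _](_ : _ = spline)=> [H|]; first exact: H.
by apply/funext => t; rewrite mul1r mulN1r.
Qed.

Lemma spline_ge0 t : 0 <= spline t.
Proof.
rewrite /spline; have /andP[a0 a1] := smoothstep01 t; have /andP[b0 b1] := smoothstep01 (t + 1).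
have [t0|t0] := leP t 0; first by rewrite [X in _ - X]smoothstep_le0// subr0.
by rewrite (@smoothstep_ge1 _ (t + 1)) ?subr_ge0//; lra.
Qed.

Lemma spline_out t : ~~ (-1 <= t <= 1) -> spline t = 0.
Proof.
rewrite negb_and -!ltNge => /orP[t1|t1]; rewrite /spline.
  by rewrite !smoothstep_le0 ?subrr//; lra.
by rewrite !smoothstep_ge1 ?subrr//; lra.
Qed.

Lemma spline_partition n t : 0 <= t <= n%:R -> \sum_(m < n.+1) spline (t - m%:R) = 1.
Proof.
move=> /andP[t0 tn].
have -> k : \sum_(m < k.+1) spline (t - m%:R) = smoothstep (t + 1) - smoothstep (t - k%:R).
  elim: k => [|k ih]; first by rewrite big_ord_recr big_ord0 /= add0r subr0.
  rewrite big_ord_recr ih /= /spline (_ : t - k.+1%:R + 1 = t - k%:R); first by ring.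
  by rewrite -natr1; ring.
by rewrite smoothstep_ge1 ?smoothstep_le0 ?subr0//; lra.
Qed.

End splines.

Section test_functions_dense.
Variables (R : realType) (d : nat) (Omega : set 'rV[R]_d).
Hypothesis d0 : (0 < d)%N.
Local Notation V := ('rV[R]_d -> R).
Variables (o : R) (L : nat).
Hypothesis HO : forall x, Omega x -> forall i, o < x ord0 i < o + L%:R.

(** Uniform continuity by compactness of the cube, with y left free: it will also be a grid point or
    a point outside Omega. *)
Lemma continuous_uniform_on (psi : V) (e : R) : continuous psi -> 0 < e ->
  \forall k \near \oo, forall x, Omega x ->
    forall y : 'rV[R]_d, (forall j, `|x ord0 j - y ord0 j| <= k.+1%:R^-1) ->
      `|psi x - psi y| <= e.
Proof.
move=> cpsi e0.
pose K := [set x : 'rV[R]_d | forall i, o <= x ord0 i <= o + L%:R].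
have /compact_near_coveringP cK : compact K by exact: box_compact.
pose P k (x : 'rV[R]_d) := forall y : 'rV[R]_d, (forall j, `|x ord0 j - y ord0 j| <= k.+1%:R^-1) -> `|psi x - psi y| <= e.
have : \forall k \near \oo, K `<=` P k.
  apply: cK => x0 _.
  have e2 : 0 < e / 2 by rewrite divr_gt0.
  have /cvgrPdist_lt /(_ _ e2) /nbhs_coord [e1 e10 He1] := cpsi x0.
  have e12 : 0 < e1 / 2 by rewrite divr_gt0.
  exists ([set x : 'rV[R]_d | forall j, `|x0 ord0 j - x ord0 j| < e1 / 2], [set k | k.+1%:R^-1 < e1 / 2]).
    split => /=.
      have A j : \forall x \near x0, `|x0 ord0 j - (x : 'rV[R]_d) ord0 j| < e1 / 2.
        by move/cvgrPdist_lt : (@coord_continuous R 1 d ord0 j x0); exact.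
      exact: filter_forall A.
    exact: (near_infty_natSinv_lt (PosNum e12)).
  move=> [x k] [/= xj ke] y xy.
  have psix : `|psi x0 - psi x| < e / 2.
    by apply: He1 => j; apply: lt_trans (xj j) _; rewrite gtr_pMr// invf_lt1// ltr1n.
  have psiy : `|psi x0 - psi y| < e / 2.
    apply: He1 => j; rewrite [e1]splitr -(subrKA (x ord0 j)).
    apply: le_lt_trans (ler_normD _ _) _; rewrite ltrD//.
    exact: le_lt_trans (xy j) ke.
  rewrite [e]splitr -(subrKA (psi x0)); apply: le_trans (ler_normD _ _) _.
  by rewrite lerD ?(ltW psiy)// distrC ltW.
apply: filterS => k Kk x Ox; apply: Kk => i.
by have /andP[? ?] := HO Ox i; rewrite !ltW.
Qed.

(* Quasi-interpolation by tensor splines; the splines whose support leaves Omega are dropped,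
   which is harmless since psi is small on their supports. *)
Lemma test_function_dense (psi : V) (e : R) : vanishing_function Omega psi -> 0 < e ->
  exists2 theta, test_function Omega theta & forall x, `|psi x - theta x| <= e.
Proof.
move=> [cpsi psi0] e0.
have [k0 _ /(_ k0 (leqnn k0)) Hk] := continuous_uniform_on cpsi e0.
(* A spline on this grid has a support of width 2 / N = 1 / (k0 + 1), the distance within which psi
   varies by at most e. *)
pose N := k0.+1.*2; pose M := (N * L)%N.
have N0 : 0 < N%:R :> R by rewrite ltr0n double_gt0.
have N2 : 2 * N%:R^-1 = k0.+1%:R^-1 :> R.
  by rewrite /N -muln2 natrM invfM mulrCA mulfV ?mulr1// gt_eqF.
pose Z := {ffun 'I_d -> 'I_M.+1}.
pose f (z : Z) (j : 'I_d) t : R := spline (N%:R * t + (- (N%:R * o) - (z j)%:R)).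
pose g z := tensor (f z).
pose s (x : 'rV[R]_d) j := N%:R * (x ord0 j - o).
have gE z x : g z x = \prod_j spline (s x j - (z j)%:R).
  by apply: eq_bigr => j _; rewrite /f /s; congr spline; ring.
have [ds Hs] := C1_spline R.
have Cg z : C1 (g z).
  have [|//] := @tensor_C1 _ _ (f z) (fun j t => N%:R * ds (N%:R * t + (- (N%:R * o) - (z j)%:R))).
  by move=> j; exact: C1_pair_affine.
pose box (z : Z) := [set x : 'rV[R]_d | forall j,
  o + N%:R^-1 * ((z j)%:R - 1) <= x ord0 j <= o + N%:R^-1 * ((z j)%:R + 1)].
have boxE z x : box z x <-> forall j, -1 <= s x j - (z j)%:R <= 1.
  suff E j : (o + N%:R^-1 * ((z j)%:R - 1) <= x ord0 j <= o + N%:R^-1 * ((z j)%:R + 1)) =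
      (-1 <= s x j - (z j)%:R <= 1) by split => H j; have := H j; rewrite /= E.
  rewrite /s -lerBrDl -[x _ _ <= _]lerBlDl ler_pdivrMl// ler_pdivlMl//.
  by apply/idP/idP => /andP[? ?]; apply/andP; split; lra.
have g_out z x : ~ box z x -> g z x = 0.
  move=> /boxE /existsNP[j /negP h].
  by rewrite gE (bigD1 j)//= spline_out ?mul0r.
have g_ge0 z x : 0 <= g z x by rewrite gE; apply: prodr_ge0 => j _; exact: spline_ge0.
have close z x y : box z x -> box z y -> forall j, `|x ord0 j - y ord0 j| <= k0.+1%:R^-1.
  move=> bx bY j; have /andP[x1 x2] := bx j; have /andP[y1 y2] := bY j; rewrite -N2.
  by move: x1 x2 y1 y2; rewrite !mulrDr mulrN mulr1 => *; rewrite ler_norml; apply/andP; split; lra.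
pose grid (z : Z) : 'rV[R]_d := \row_j (o + N%:R^-1 * (z j)%:R).
have box_grid z : box z (grid z).
  by move=> j; rewrite mxE !lerD2l !ler_pM2l ?invr_gt0// gerBl lerDl ler01.
pose c z := if `[< box z `<=` Omega >] then psi (grid z) else 0.
pose theta x := \sum_z c z * g z x.
have Ttheta : test_function Omega theta.
  apply: test_function_sum => // z; rewrite /c; case: asboolP => [bO _|_]; last by rewrite eqxx.
  split; first exact: Cg.
  by exists (box z); split => //; [exact: box_compact|exact: g_out].
exists theta => // x.
have [Ox|nOx] := pselect (Omega x); last first.
  have [_ [K [_ KO K0]]] := Ttheta.
  by rewrite psi0// K0 ?subrr ?normr0 ?(ltW e0)// => /KO.
have part : \sum_z g z x = 1.
  under eq_bigr => z _ do rewrite gE.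
  (* By distributivity the tensor splines sum to the product of the one-dimensional partitions of
     unity. *)
  rewrite -(bigA_distr_bigA (fun j m => spline (s x j - (nat_of_ord m)%:R))).
  apply: big1 => j _; apply: spline_partition.
  have /andP[x1 x2] := HO Ox j; rewrite /s mulr_ge0 ?(ltW N0) ?subr_ge0 ?(ltW x1)//=.
  by rewrite natrM ler_pM2l// lerBlDl ltW.
rewrite -[psi x]mulr1 -part mulr_sumr -sumrB.
apply: le_trans (ler_norm_sum _ _ _) _.
rewrite -[leRHS]mulr1 -part mulr_sumr; apply: ler_sum => z _.
rewrite -mulrBl normrM (ger0_norm (g_ge0 z x)).
have [bx|nbx] := pselect (box z x); last by rewrite g_out ?mulr0.
rewrite ler_wpM2r// /c; case: asboolP => [_|nb].
  by apply: Hk => //; exact: close (box_grid z).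
have [y by_ nOy] : exists2 y, box z y & ~ Omega y.
  by apply: contrapT => H; apply: nb => y By; apply: contrapT => nOy; apply: H; exists y.
by rewrite -(psi0 y nOy); apply: Hk => //; exact: close by_.
Qed.

End test_functions_dense.

(** * Compactness in BV *)

Section fast_L1_limit.
Context d (T : measurableType d) (R : realType) (mu : {measure set T -> \bar R}).
Hypothesis muT : (mu setT < +oo)%E.

Lemma sum_pow2_inv_le n : \sum_(0 <= i < n) (2 ^+ i)^-1 <= 2 :> R.
Proof.
suff -> : \sum_(0 <= i < n) (2 ^+ i)^-1 = 2 - 2 * (2 ^+ n)^-1 :> R.
  by rewrite gerBl mulr_ge0// invr_ge0 exprn_ge0.
elim: n => [|n ih]; first by rewrite big_geq// expr0 invr1 mulr1 subrr.
rewrite big_nat_recr//= ih exprS invfM.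
have : (2 * 2^-1 : R) = 1 by rewrite divff.
by move=> h; rewrite mulrA h mul1r; ring.
Qed.

Lemma summable_increments_cvg (a : nat -> R) :
  (\big[+%E/0%R]_(0 <= n <oo) (`|a n.+1 - a n|)%:E)%E \is a fin_num ->
  exists l : R, a n @[n --> \oo] --> l.
Proof.
set S := (\big[_/_]_(_ <= _ <oo) _) => Sfin.
have cN : cvgn [normed series (telescope a)].
  apply: nondecreasing_is_cvgn; first by apply: nondecreasing_series => n _ _; exact: normr_ge0.
  exists (fine S) => _ [n _ <-].
  rewrite -lee_fin fineK// [X in (X <= _)%E](_ : _ = (\sum_(0 <= i < n) (`|a i.+1 - a i|)%:E)%E).
    by apply: nneseries_lim_ge => k _ _; rewrite lee_fin.
  by rewrite sumEFin.
have /cvg_ex[l Hl] := normed_cvg cN.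
exists (a 0%N + l).
suff : (fun n => a 0%N + series (telescope a) n) @ \oo --> a 0%N + l.
  by rewrite (_ : (fun n => _) = a)//; apply/funext => n; rewrite -eq_sum_telescope.
by apply: cvgD; first exact: cvg_cst.
Qed.

(** The increments are summable in L^1, so their pointwise sum is integrable, hence a.e. finite, and
    the sequence converges a.e.; the uniform bound then gives L^1 convergence by domination. *)
Lemma fast_L1_limit (v : nat -> T -> R) (B : R) :
  (forall n, measurable_fun setT (v n)) ->
  (forall n, {ae mu, forall x, `|v n x| <= B}) ->
  (forall n, \int[mu]_x `|v n.+1 x - v n x| <= (2 ^+ n)^-1) ->
  exists w : T -> R, [/\ measurable_fun setT w, {ae mu, forall x, v n x @[n --> \oo] --> w x} &
    \int[mu]_x `|v n x - w x| @[n --> \oo] --> (0 : R)].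
Proof.
move=> mv vB vinc.
pose g n x := (`|v n.+1 x - v n x|)%:E.
have mg n : measurable_fun setT (g n).
  by apply/measurable_EFinP; apply: measurableT_comp => //; exact: measurable_funB.
have gint n : mu.-integrable setT (g n).
  apply: (integrable_ae_bounded muT (M := B + B)).
    by apply: measurableT_comp => //; exact: measurable_funB.
  apply: filterS2 (vB n) (vB n.+1) => x h1 h2; rewrite normr_id.
  by apply: le_trans (ler_normB _ _) _; rewrite lerD.
have G0 n x : (0 <= g n x)%E by rewrite lee_fin.
pose S x := (\big[+%E/0%R]_(0 <= n <oo) g n x)%E.
have mS : measurable_fun setT S.
  by apply: ge0_emeasurable_sum => // n x _ _.
have S0 x : (0 <= S x)%E by apply: nneseries_ge0 => n _ _.
have Sint : mu.-integrable setT S.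
  apply/integrableP; split => //.
  under eq_integral => x _ do rewrite gee0_abs//.
  rewrite integral_nneseries//.
  apply: le_lt_trans (ltry 2); apply: lime_le.
    by apply: is_cvg_nneseries => n _ _; apply: integral_ge0.
  apply: nearW => n; apply: le_trans (lee_sum _ (_ : forall i, _ -> (_ <= ((2 ^+ i)^-1)%:E)%E)) _.
    move=> i _; rewrite -(fineK (integrable_fin_num measurableT (gint i))) lee_fin.
    exact: vinc.
  by rewrite sumEFin lee_fin sum_pow2_inv_le.
(* The limsup is defined everywhere, so w is measurable without treating the exceptional null set
   separately. *)
pose w x := fine (limn_esup (fun n => (v n x)%:E)).
have mw : measurable_fun setT w.
  apply: measurableT_comp => //; apply: measurable_fun_limn_esup => n; exact/measurable_EFinP.
have cw : {ae mu, forall x, v n x @[n --> \oo] --> w x}.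
  apply: filterS (integrable_ae measurableT Sint) => x /(_ I) Sx.
  have [l vl] := summable_increments_cvg Sx.
  have El : (v n x)%:E @[n --> \oo] --> l%:E.
    by apply: cvg_EFin; [exact: nearW|exact: vl].
  rewrite /w is_cvg_limn_esupE; last by apply/cvg_ex; exists l%:E.
  by rewrite (cvg_lim _ El).
exists w; split => //.
have -> : 0 = \int[mu]_x (0 : R) by rewrite Rintegral_cst//= mul0r.
apply: (@Rintegral_cvg _ _ _ _ _ _ (cst (B + B))).
- by move=> n; apply: measurableT_comp => //; exact: measurable_funB.
- exact: measurable_cst.
- apply: filterS cw => x cx.
  have : `|v n x - w x| @[n --> \oo] --> `|w x - w x|.
    by apply: cvg_norm; apply: cvgB => //; exact: cvg_cst.
  by rewrite subrr normr0.
- exact: integrableT_cst.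
- have vBn : {ae mu, forall x n, `|v n x| <= B} by exact/ae_foralln.
  apply: filterS2 vBn cw => x vx cx n; rewrite normr_id.
  apply: le_trans (ler_normB _ _) _; rewrite lerD//.
  have : `|v n x| @[n --> \oo] --> `|w x| by exact: cvg_norm.
  by move/cvgr_to_le; apply; exact: nearW.
Qed.

End fast_L1_limit.

Section BV_compactness.
Variables (R : realType) (d : nat) (Omega : set 'rV[R]_d) (oO : open Omega).
Hypothesis d0 : (0 < d)%N.
Hypothesis bO : bounded_set Omega.
Local Notation V := ('rV[R]_d -> R).
Local Notation mu := (lebesgue_on oO).

Lemma BV_compact (un : nat -> V) (B C : R) : (forall n, BV oO (un n)) ->
  (forall n, {ae mu, forall x, `|un n x| <= B}) -> (forall n, tv oO (un n) <= C) ->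
  exists (f : nat -> nat) w, [/\ increasing_seq f, BV oO w,
    {ae mu, forall x, un (f n) x @[n --> \oo] --> w x} &
    nrm mu 1 (un (f n) - w) @[n --> \oo] --> (0 : R)].
Proof.
move=> Bun unB tvC.
have [orig [L HO]] := bounded_set_in_cube bO.
have muT : (mu setT < +oo)%E by exact: lebesgue_on_finite HO.
have [U [UU UF]] := ultraFilterLemma (@eventually_filter).
have pe l : 0 < (2 ^+ l)^-1 :> R by rewrite invr_gt0 exprn_gt0.
have /choice[A HA] l : exists A, U A /\ forall n p, A n -> A p ->
    nrm mu 1 (un n - un p) < (2 ^+ l)^-1.
  by have [A] := ultrafilter_Cauchy d0 HO UU Bun unB tvC (pe l); exists A.
(* U contains every tail and is closed under finite intersections, so A 0, ..., A l have common
   elements beyond any N. The sequence g then lies in A i from position i on, and consecutive terms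
   are 2^-l close. *)
have /choice[h Hh] (lN : nat * nat) : exists n, (lN.2 < n)%N /\ forall i, (i <= lN.1)%N -> A i n.
  case: lN => l N /=.
  have UN : U [set n | (N < n)%N] by apply: UF; exact: nbhs_infty_gt.
  have UA : U [set n | forall i : 'I_l.+1, A i n].
    by apply: filter_forall => i; case: (HA i).
  have [n [n1 n2]] := filter_ex (filterI UN UA).
  exists n; split => // i il; exact: (n2 (Ordinal (il : (i < l.+1)%N))).
pose g := fix g l := if l is l'.+1 then h (l'.+1, g l') else h (0, 0)%N.
have gA i l : (i <= l)%N -> A i (g l).
  by case: l => [|l] il; [apply: (Hh (0, 0)%N).2|apply: (Hh (l.+1, g l)).2].
have gS l : (g l < g l.+1)%N by exact: (Hh (l.+1, g l)).1.
have gi : increasing_seq g.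
  by apply: leq_mono; apply: homo_ltn => [? ? ?|l]; [exact: ltn_trans|exact: gS].
have mu_u n : measurable_fun setT (un n) := LfunP_meas (Bun n).1.
have [|w [mw cw dw]] := fast_L1_limit muT (fun n => mu_u (g n)) (fun n => unB (g n)).
  move=> n; have := (HA n).2 (g n.+1) (g n) (gA _ _ (leqnSn n)) (gA _ _ (leqnn n)).
  by rewrite nrm1 => /ltW.
have Bw : {ae mu, forall x, `|w x| <= B}.
  have vBn : {ae mu, forall x n, `|un n x| <= B} by exact/ae_foralln.
  apply: filterS2 vBn cw => x vx cx.
  have : `|un (g n) x| @[n --> \oo] --> `|w x| by exact: cvg_norm.
  by move/cvgr_to_le; apply; exact: nearW.
have Lw : w \in Lfun mu 1%:E.
  by apply/Lfun1_integrable; exact: integrable_ae_bounded Bw.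
have nw : nrm mu 1 (un (g n) - w) @[n --> \oo] --> (0 : R).
  by under eq_fun do rewrite nrm1.
exists g, w; split => //; split => //.
apply: le_lt_trans (ltry C); apply: TV_lsc => // e e0.
have /cvgrPdist_lt /(_ e e0) [N _ /(_ N (leqnn N))] := nw.
rewrite /= sub0r normrN => HN; exists (un (g N)); split => //.
exact: le_lt_trans (ler_norm _) HN.
Qed.

End BV_compactness.

(** * Weak-* convergence *)

Section weak_star.
Variables (R : realType) (d : nat) (Omega : set 'rV[R]_d) (oO : open Omega).
Hypothesis d0 : (0 < d)%N.
Hypothesis bO : bounded_set Omega.
Local Notation V := ('rV[R]_d -> R).
Local Notation mu := (lebesgue_on oO).
Local Notation finite_measure := {finite_measure set 'rV[R]_d -> \bar R}.
Implicit Types (nu nup nun : finite_measure) (psi theta : V).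

Lemma test_function_vanishing theta : test_function Omega theta -> vanishing_function Omega theta.
Proof.
move=> [[c _] [K [_ KO K0]]]; split => // x nOx; apply: K0 => /KO; exact: nOx.
Qed.

Lemma vanishing_functionB psi theta : vanishing_function Omega psi ->
  vanishing_function Omega theta -> vanishing_function Omega (psi - theta).
Proof.
move=> [c1 z1] [c2 z2]; split; first by move=> x; exact: (cvgB (c1 x) (c2 x)).
by move=> x nOx; rewrite -[LHS]/(psi x - theta x) z1// z2// subr0.
Qed.

Lemma vanishing_bounded psi : vanishing_function Omega psi -> exists M, forall x, `|psi x| <= M.
Proof.
move=> [cpsi psi0]; have [orig [L HO]] := bounded_set_in_cube bO.
have [M HM] := continuous_bounded_on cpsi
  (@box_compact R d (fun=> orig) (fun=> orig + L%:R) d0).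
exists (Num.max M 0) => x; have [Ox|nOx] := pselect (Omega x).
  by rewrite le_max HM// => i; have /andP[? ?] := HO _ Ox i; rewrite !ltW.
by rewrite psi0// normr0 le_max lexx orbT.
Qed.

Lemma vanishing_integrable nu psi : vanishing_function Omega psi ->
  nu.-integrable Omega (EFin \o psi).
Proof.
move=> Vpsi; have [M HM] := vanishing_bounded Vpsi.
apply: measurable_bounded_integrable.
- exact: open_measurable_rV.
- by rewrite ltey_eq fin_num_measure//; exact: open_measurable_rV.
- by apply: measurable_funTS; apply: continuous_measurable_rV; case: Vpsi.
- by exists M; split; [exact: num_real|move=> N MN x _; exact: le_trans (HM x) (ltW MN)].
Qed.

Lemma signed_intB nup nun psi theta : vanishing_function Omega psi ->
  vanishing_function Omega theta ->
  signed_int Omega nup nun (psi - theta) =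
    signed_int Omega nup nun psi - signed_int Omega nup nun theta.
Proof.
move=> Vpsi Vtheta; have mO := open_measurable_rV oO.
by rewrite /signed_int !RintegralB//; [ring|exact: vanishing_integrable..].
Qed.

Lemma signed_int_bound nup nun psi (e : R) : vanishing_function Omega psi ->
  (forall x, `|psi x| <= e) ->
  `|signed_int Omega nup nun psi| <= e * (fine (nup Omega) + fine (nun Omega)).
Proof.
move=> Vpsi psie; have mO := open_measurable_rV oO.
have H nu : `|\int[nu]_(x in Omega) psi x| <= e * fine (nu Omega).
  have ipsi := vanishing_integrable nu Vpsi.
  apply: le_trans (le_normr_Rintegral mO ipsi) _.
  rewrite -(Rintegral_cst nu mO); apply: le_Rintegral => //.
    by have := integrable_abse ipsi; exact: eq_integrable.
  apply: measurable_bounded_integrable => //.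
    by rewrite ltey_eq fin_num_measure//; exact: open_measurable_rV.
  by exists `|e|; split; [exact: num_real|move=> N eN x _; exact: ltW].
by rewrite mulrDr; apply: le_trans (ler_normB _ _) _; rewrite lerD.
Qed.

(* The bound involves the total variation only, not the masses of nup and nun, which need
   not be the minimal decomposition of the derivative. *)
Lemma derivative_measure_approx u i nup nun psi theta (e : R) : BV oO u ->
  is_derivative_measure oO u i nup nun -> vanishing_function Omega psi ->
  test_function Omega theta -> 0 < e -> (forall x, `|psi x - theta x| <= e) ->
  `|signed_int Omega nup nun psi - signed_int Omega nup nun theta| <= e * tv oO u.
Proof.
move=> Bu Du Vpsi Ttheta e0 He; have [orig [L HO]] := bounded_set_in_cube bO.
have Vtheta := test_function_vanishing Ttheta.
pose m := fine (nup Omega) + fine (nun Omega).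
have m0 : 0 <= m by rewrite addr_ge0// fine_ge0.
have D0 : 0 < m + tv oO u + 1 by rewrite ltr_wpDl// addr_ge0// tv_ge0.
apply/ler_addgt0Pr => h h0.
have h'0 : 0 < h / (m + tv oO u + 1) by rewrite divr_gt0.
set h' := h / _ in h'0.
(* theta' may be chosen according to the masses of nup and nun, so that psi - theta' contributes
   little; theta' - theta is a test function and is therefore controlled by TV. *)
have [theta' Ttheta' Htheta'] := test_function_dense d0 HO Vpsi h'0.
have Vtheta' := test_function_vanishing Ttheta'.
rewrite -(subrKA (signed_int Omega nup nun theta')).
apply: le_trans (ler_normD _ _) _.
rewrite -!signed_intB//.
have b1 : `|signed_int Omega nup nun (psi - theta')| <= h' * m.
  by apply: signed_int_bound => //; exact: vanishing_functionB.
have Tdiff : test_function Omega (theta' - theta).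
  have := @test_function_sum _ _ Omega bool [:: true; false] (fun b => if b then 1 else -1)
    (fun b => if b then theta' else theta).
  have -> : (fun x => \sum_(b <- [:: true; false]) (if b then 1 else -1 : R) *
     (if b then theta' else theta) x) = theta' - theta.
    by apply/funext => x; rewrite !big_cons big_nil mul1r mulN1r addr0.
  apply; first by case.
  by case; [case: Ttheta'|case: Ttheta].
have b2 : `|signed_int Omega nup nun (theta' - theta)| <= (h' + e) * tv oO u.
  rewrite -normrN -(Du _ Tdiff); apply: test_function_pairing => //.
    exact: addr_gt0.
  move=> x; rewrite [X in `|X|](_ : _ = (theta' x - psi x) + (psi x - theta x)).
    by apply: le_trans (ler_normD _ _) _; rewrite lerD// distrC.
  by rewrite /= addrA subrK.
apply: le_trans (lerD b1 b2) _.
rewrite mulrDl addrA addrC lerD2l -mulrDr /h' mulrAC ler_pdivrMr// ler_wpM2l ?(ltW h0)//.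
by rewrite lerDl.
Qed.

(** Replacing psi by a test function theta costs a small multiple of the variations, uniformly in n;
    for theta the derivative falls on the bounded function [pderiv i theta], and L^1 convergence
    concludes. *)
Lemma weak_star_of_L1 (un : nat -> V) u (C : R) : (forall n, BV oO (un n)) -> BV oO u ->
  (forall n, tv oO (un n) <= C) -> nrm mu 1 (un n - u) @[n --> \oo] --> (0 : R) ->
  weak_star_cvg oO un u.
Proof.
move=> Bun Bu tvC cu; have [orig [L HO]] := bounded_set_in_cube bO.
have Ldiff n : (un n - u) \in Lfun mu 1%:E by apply: LfunB => //; [exact: (Bun n).1|exact: Bu.1].
split => //.
  have -> : (fun n => Lnormp oO 1 (un n - u)) = (fun n => (nrm mu 1 (un n - u))%:E).
    by apply/funext => n; rewrite -nrmE.
  by apply: cvg_EFin; [exact: nearW|exact: cu].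
move=> i nupn nunn nup nun Dn D psi Vpsi.
have tu0 := tv_ge0 oO u.
have C0 : 0 <= C by exact: le_trans (tv_ge0 oO (un 0%N)) (tvC 0%N).
have D0 : 0 < C + tv oO u + 1 by rewrite ltr_wpDl// addr_ge0.
apply/cvgrPdist_lt => e e0.
have e2 : 0 < e / 2 by rewrite divr_gt0.
have h0 : 0 < e / 2 / (C + tv oO u + 1) by rewrite divr_gt0.
set h := _ / (_ + 1) in h0.
have [theta Ttheta Htheta] := test_function_dense d0 HO Vpsi h0.
have [Ctheta [K [cK _ K0]]] := Ttheta.
have [M HM] := C1_compact_pderiv_bounded i Ctheta cK K0.
have M0 : 0 <= M by exact: le_trans (normr_ge0 _) (HM 0).
have M1 : 0 < M + 1 by rewrite ltr_wpDl.
have mtheta := C1_pderiv_measurable i Ctheta.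
have ip (w : V) : w \in Lfun mu 1%:E ->
    mu.-integrable setT (EFin \o (fun x => w x * pderiv i theta x)).
  move=> Lw; apply: (@integrableT_mulr _ _ _ _ _ _ M) => //; first exact: aeW.
  exact/Lfun1_integrable.
move/cvgrPdist_lt : cu => /(_ _ (divr_gt0 e2 M1)); apply: filterS => n.
rewrite sub0r normrN => Hn.
have b1 := derivative_measure_approx (Bun n) (Dn n) Vpsi Ttheta h0 Htheta.
have b2 := derivative_measure_approx Bu D Vpsi Ttheta h0 Htheta.
have b3 : `|signed_int Omega nup nun theta - signed_int Omega (nupn n) (nunn n) theta| <= e / 2.
  have E : signed_int Omega nup nun theta - signed_int Omega (nupn n) (nunn n) theta =
      \int[mu]_x ((un n - u) x * pderiv i theta x).
    rewrite (_ : \int[mu]_x _ = \int[mu]_x (un n x * pderiv i theta x - u x * pderiv i theta x)).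
      rewrite RintegralB//; [|exact: ip (Bun n).1|exact: ip Bu.1].
      by rewrite (Dn n _ Ttheta) (D _ Ttheta); ring.
    by apply: eq_Rintegral => x _; rewrite -mulrBl.
  rewrite E; apply: le_trans (le_normr_Rintegral measurableT (ip _ (Ldiff n))) _.
  apply: (@le_trans _ _ (M * nrm mu 1 (un n - u))).
    have iabs : mu.-integrable setT (EFin \o (fun x => `|(un n - u) x|)).
      by apply: integrableT_abs; exact/Lfun1_integrable.
    rewrite nrm1 -RintegralZl//; apply: Rintegral_ae_le => //.
    - by apply: integrableT_abs; exact: ip.
    - have := @integrableZl _ _ _ mu setT measurableT M _ iabs; exact: eq_integrable.
    by apply: aeW => x; rewrite normrM mulrC ler_wpM2r.
  apply: le_trans (ler_wpM2l M0 (ltW (le_lt_trans (ler_norm _) Hn))) _.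
  by rewrite mulrA ler_pdivrMr// mulrC ler_wpM2l ?(ltW e2)// lerDl.
rewrite -(subrKA (signed_int Omega nup nun theta)).
apply: le_lt_trans (ler_normD _ _) _.
rewrite -(subrKA (signed_int Omega (nupn n) (nunn n) theta) (signed_int Omega nup nun theta)).
rewrite [ltRHS]splitr -ltrBrDl.
apply: le_lt_trans (ler_normD _ _) _; rewrite distrC in b1.
have b4 : h * tv oO u + h * tv oO (un n) < e / 2.
  apply: (@lt_le_trans _ _ (h * (C + tv oO u + 1))).
    rewrite -mulrDr ltr_pM2l//; have := tvC n; lra.
  by rewrite /h divfK// gt_eqF.
by lra.
Qed.

End weak_star.

(** * Limits of bounded sequences *)

Section L1_limits_of_bounded_functions.
Context d (T : measurableType d) (R : realType) (mu : {measure set T -> \bar R}).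
Hypothesis muT : (mu setT < +oo)%E.

(** The distance h of w to [a, b] is dominated a.e. by |v n - w|, so its integral is 0. *)
Lemma L1_limit_bounds (v : nat -> T -> R) (w : T -> R) (a b : R) :
  (forall n, v n \in Lfun mu 1%:E) -> w \in Lfun mu 1%:E ->
  (forall n, {ae mu, forall x, a <= v n x <= b}) ->
  nrm mu 1 (v n - w) @[n --> \oo] --> (0 : R) -> {ae mu, forall x, a <= w x <= b}.
Proof.
move=> Lv Lw vab cv.
pose h x := Num.max (w x - b) 0 + Num.max (a - w x) 0.
have mw := LfunP_meas Lw.
have h0 x : 0 <= h x by rewrite addr_ge0// le_max lexx orbT.
have mh : measurable_fun setT h.
  by apply: measurable_funD; apply: measurable_maxr => //; apply: measurable_funB.
have hv n : {ae mu, forall x, `|h x| <= `|v n x - w x|}.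
  apply: filterS (vab n) => x /andP[ax xb]; rewrite ger0_norm// /h.
  have := ler_norm (v n x - w x); have := ler_norm (- (v n x - w x)); rewrite normrN.
  have := normr_ge0 (v n x - w x).
  by case: (leP (w x - b) 0) => ?; case: (leP (a - w x) 0) => ?; lra.
have Lvw n : v n - w \in Lfun mu 1%:E by apply: LfunB.
have ivw n : mu.-integrable setT (EFin \o (fun x => `|v n x - w x|)).
  by apply: integrableT_abs; have /Lfun1_integrable := Lvw n.
have ih : mu.-integrable setT (EFin \o h).
  by apply: integrable_ae_le (ivw 0%N) _ => //; apply: filterS (hv 0%N) => x; rewrite normr_id.
have Ih : \int[mu]_x `|h x| <= 0.
  apply/ler_addgt0Pr => e e0; rewrite add0r.
  move/cvgrPdist_lt : cv => /(_ _ e0) [N _ /(_ N (leqnn N))].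
  rewrite /= sub0r normrN nrm1 => /(le_lt_trans (ler_norm _)) /ltW; apply: le_trans.
  by apply: Rintegral_ae_le (hv N); [exact: integrableT_abs|exact: ivw].
have Ih0 : (\int[mu]_x `|(EFin \o h) x|)%E = 0%E.
  apply/eqP; rewrite eq_le integral_ge0 ?andbT//.
  by rewrite -(fineK (integrable_fin_num measurableT (integrableT_abs ih))) lee_fin.
have /(ae_eq_integral_abs mu measurableT) := Ih0.
have mEh : measurable_fun setT (EFin \o h) by exact/measurable_EFinP.
move=> /(_ mEh) A; apply: filterS A => x /(_ I) /= [].
rewrite /h; case: (leP (w x - b) 0) => ?; case: (leP (a - w x) 0) => ?; lra.
Qed.

(** Interpolation between L^1 and L^oo: the q-th power of the L^q norm is at most M^(q - 1) times
    the L^1 norm. *)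
Lemma Lq_cvg_of_L1 (v : nat -> T -> R) (w : T -> R) (q M : R) : 1 <= q -> 0 <= M ->
  (forall n, measurable_fun setT (v n - w)) ->
  (forall n, {ae mu, forall x, `|(v n - w) x| <= M}) ->
  nrm mu 1 (v n - w) @[n --> \oo] --> (0 : R) -> nrm mu q (v n - w) @[n --> \oo] --> (0 : R).
Proof.
move=> q1 M0 mvw vwM cv; apply/cvgrPdist_lt => e e0.
have q0 : 0 <= q by exact: le_trans q1.
have D0 : 0 < M `^ (q - 1) + 1 by rewrite ltr_wpDl// powR_ge0.
have E0 : 0 < e `^ q / (M `^ (q - 1) + 1) by rewrite divr_gt0// powR_gt0.
move/cvgrPdist_lt : cv => /(_ _ E0); apply: filterS => n.
rewrite !sub0r !normrN !ger0_norm ?nrm_ge0// ltr_pdivlMr// => Hn.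
rewrite ltNge; apply/negP => en.
have := ge0_ler_powR q0 (ltW e0 : e \is Num.nneg) (nrm_ge0 mu q (v n - w)) en.
apply/negP; rewrite -ltNge.
apply: le_lt_trans (nrm_interpolation (lexx 1) q1 muT M0 (mvw n) (vwM n)) _.
apply: le_lt_trans Hn; rewrite powRr1 ?nrm_ge0// mulrC ler_wpM2l ?nrm_ge0// lerDl//.
Qed.

End L1_limits_of_bounded_functions.

(** Otherwise arbitrarily late terms have variation below tv w - e, and [TV_lsc] applied to them
    gives tv w <= tv w - e. *)
Lemma tv_lsc_near (R : realType) (d : nat) (Omega : set 'rV[R]_d) (oO : open Omega)
    (un : nat -> 'rV[R]_d -> R) (w : 'rV[R]_d -> R) (e : R) :
  (forall n, BV oO (un n)) -> w \in Lfun (lebesgue_on oO) 1%:E ->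
  nrm (lebesgue_on oO) 1 (un n - w) @[n --> \oo] --> (0 : R) ->
  0 < e -> \forall n \near \oo, tv oO w - e <= tv oO (un n).
Proof.
move=> Bun Lw cu e0; apply: contrapT => nnear.
suff /tv_le : (TV oO w <= (tv oO w - e)%:E)%E by apply/negP; rewrite -ltNge gtrBl.
apply: TV_lsc => // h h0.
move/cvgrPdist_lt : cu => /(_ _ h0) [N _ HN].
have [n [Nn tvn]] : exists n, (N <= n)%N /\ tv oO (un n) < tv oO w - e.
  apply: contrapT => H; apply: nnear; exists N => // n /= Nn.
  by rewrite leNgt; apply/negP => tvn; apply: H; exists n.
exists (un n); split => //; last exact: ltW.
by have := HN n Nn; rewrite /= sub0r normrN; apply: le_lt_trans; exact: ler_norm.
Qed.

(** * Convergence of the trust-region iterates *)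

Theorem theorem4p12 (R : realType) (d : nat) (hd : (2 <= d)%N)
  (Omega : set 'rV[R]_d) (oO : open Omega)
  (hO : [/\ Omega !=set0, connected Omega & bounded_set Omega])
  (hLip : lipschitz_boundary Omega)
  (hC1 : exists2 a : R, 0 < a <= 1 & C1_holder_boundary a Omega)
  (ul uu : R) (hul : 0 < ul) (hulu : ul <= uu)
  (alpha : R) (halpha : 0 < alpha)
  (s q : R) (hs : 2 < s) (hq : 2 * s / (s - 2) < q)
  (r : R) (hr1 : 1 <= r) (hrq : q / 2 < r)
  (j : ('rV[R]_d -> R) -> R)
  (dj : ('rV[R]_d -> R) -> ('rV[R]_d -> R) -> R)
  (gradj : ('rV[R]_d -> R) -> 'rV[R]_d -> R)
  (d2j : ('rV[R]_d -> R) -> ('rV[R]_d -> R) -> ('rV[R]_d -> R) -> R)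
  (hjb : exists m : R, forall u, Uad oO ul uu u -> m <= j u)
  (hdj : forall u, Uad oO ul uu u ->
     has_gradient oO q (Uad oO ul uu) j u (dj u))
  (hgradj : forall u, Uad oO ul uu u -> represents oO q (gradj u) (dj u))
  (hgradjL : lipschitz_gradient oO q (Uad oO ul uu) gradj)
  (hd2j : forall u, Uad oO ul uu u ->
     has_hessian oO q (Uad oO ul uu) dj u (d2j u))
  (hd2jc : op_continuous_on oO q (Uad oO ul uu) d2j)
  (hd2jb : op_bounded_on oO q (Uad oO ul uu) d2j)
  (qm : ('rV[R]_d -> R) -> ('rV[R]_d -> R) -> R)
  (hqm : forall u, Uad oO ul uu u -> exists2 kappa : R, 1 <= kappa &
     model_assumption oO q ul uu j gradj kappa u (qm u))
  (F : set ('rV[R]_d -> R)) (hF : F `<=` Uad oO ul uu)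
  (kappa_umh : R) (hkappa : 1 <= kappa_umh)
  (hqmF : forall u, F u ->
     model_assumption oO q ul uu j gradj kappa_umh u (qm u))
  (Delta_res sigma gamma : R) (hDelta : 0 < Delta_res)
  (hsigma : 0 < sigma < 1) (hgamma : 0 < gamma < 1)
  (u0 : 'rV[R]_d -> R) (hu0 : Uad oO ul uu u0)
  (u v : nat -> 'rV[R]_d -> R) (Delta : nat -> R)
  (hrun : tr_run oO r ul uu alpha j qm Delta_res sigma gamma u0 u v Delta)
  (hsteps : approximate_steps oO r ul uu alpha qm u v Delta)
  (huF : forall k, F (u k)) :
  [/\ forall k, Uad oO ul uu (u k),
      nonincreasing_seq (fun k => objective oO alpha j (u k)),
      forall f : nat -> nat, increasing_seq f ->
        exists w, cluster_point (weak_star_cvg oO) (u \o f) w &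
      forall w, cluster_point (weak_star_cvg oO) u w ->
        [/\ Uad oO ul uu w,
            cluster_point (strict_cvg oO) u w,
            cluster_point (Lp_cvg oO q) u w &
            stationary oO q ul uu alpha gradj w]].
Proof.
have d0 : (0 < d)%N by exact: leq_trans hd.
have [_ _ bO] := hO.
have [orig [L HO]] := bounded_set_in_cube bO.
have muT : (lebesgue_on oO setT < +oo)%E by exact: lebesgue_on_finite HO.
have q1 : 1 < q.
  apply: lt_trans hq; have s2 : 0 < s - 2 by rewrite subr_gt0.
  by rewrite ltr_pdivlMr//; lra.
have [eta [eta01 hst]] := hsteps.
have Uu k : Uad oO ul uu (u k) by have [] := Uad_iterate hDelta hgamma hu0 hrun k.
have Bu k : BV oO (u k) by case: (Uu k).
have mono := objective_nonincreasing hr1 hDelta hsigma hgamma hu0 hrun eta01 hst.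
have hmodel k := hqmF _ (huF k).
(* Monotone objective values and the lower bound on j bound alpha TV along the run; this is the
   bound that compactness and weak-* convergence need. *)
have [C tvC] : exists C, forall k, tv oO (u k) <= C.
  have [m Hm] := hjb; exists ((real_objective oO alpha j (u 0%N) - m) / alpha) => k.
  rewrite ler_pdivlMr// mulrC lerBrDl; apply: le_trans (mono 0%N k (leq0n k)).
  by rewrite lerD2r; exact: Hm.
split => //.
- by move=> k l kl; rewrite !(objectiveE _ _ (Uu _)) lee_fin; exact: mono.
- move=> f _.
  have [g [w [gi Bw _ cw]]] := BV_compact d0 bO (fun n => Bu (f n))
    (fun n => Uad_norm_bound (Uu (f n))) (fun n => tvC (f n)).
  by exists w, g => //; exact: (weak_star_of_L1 d0 bO (fun n => Bu _) Bw (fun n => tvC _) cw).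
move=> w [f hf [_ Bw cN _]].
have LfB n : (u (f n) - w) \in Lfun (lebesgue_on oO) 1%:E.
  by apply: LfunB => //; [exact: (Bu (f n)).1|exact: Bw.1].
have c1 : nrm (lebesgue_on oO) 1 (u (f n) - w) @[n --> \oo] --> (0 : R).
  exact: fine_cvg cN.
have Uw : Uad oO ul uu w.
  by split => //; apply: L1_limit_bounds c1 => [n||n]; [exact: (Bu _).1|exact: Bw.1|case: (Uu (f n))].
have cq : nrm (lebesgue_on oO) q (u (f n) - w) @[n --> \oo] --> (0 : R).
  apply: (@Lq_cvg_of_L1 _ _ _ _ muT _ _ q (uu - ul)) c1.
  - exact: ltW.
  - by rewrite subr_ge0.
  - by move=> n; exact: LfunP_meas (LfB n).
  - by move=> n; exact: (UadB_bound Uw (Uu _)).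
have lsc e : 0 < e -> \forall n \near \oo, tv oO w - e <= tv oO (u (f n)).
  by apply: tv_lsc_near => //; exact: Bw.1.
split => //.
- exists f => //; split => //; first by move=> n; exact: Bu.
  have -> : (fun n => TV oO ((u \o f) n)) = (fun n => (tv oO (u (f n)))%:E).
    by apply/funext => n; rewrite /= (TVE (Bu _)).
  rewrite (TVE Bw); apply: cvg_EFin; first exact: nearW.
  apply/cvgrPdist_le => e e0.
  have := limsup_tv_cluster muT q1 hr1 hrq halpha hdj hgradj hgradjL hjb hkappa hDelta
    hsigma hgamma hu0 hrun eta01 hst hmodel hf Uw cq e0.
  apply: filterS2 (lsc e e0) => n h1 h2.
  by rewrite /= ler_norml; apply/andP; split; lra.
- exists f => //; split => //.
  + by move=> n; exact: (Uad_Lfun muT (ltW q1) (Uu _)).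
  + exact: (Uad_Lfun muT (ltW q1) Uw).
  have -> : (fun n => Lnormp oO q ((u \o f) n - w)) =
      (fun n => (nrm (lebesgue_on oO) q (u (f n) - w))%:E).
    by apply/funext => n; rewrite -nrmE//; exact: (UadB_Lq muT (ltW q1) Uw (Uu _)).
  by apply: cvg_EFin; [exact: nearW|exact: cq].
apply: stationary_of_variational => //; first exact: hgradj.
move=> x Ux; exact: (cluster_variational muT q1 hr1 hrq halpha hdj hgradj hgradjL hjb hkappa
  hDelta hsigma hgamma hu0 hrun eta01 hst hmodel hf Uw cq lsc Ux).
Qed.
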